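(* Let $\rho=1.4\cdot10^{-4}$ and $\mathcal V=\bigcup_{\tau\in\mathcal R_1}\{x\in\mathbb C:|x-\Theta(\tau)|<\rho\}$. Then for every $x\in\mathcal V$ the good Borchardt means below are well defined, and $$F(x)=i\,\frac{\mu\big(1,\frac{2x}{1+x^2}\big)}{\mu\big(1,\frac{1-x^2}{1+x^2}\big)}$$ defines an analytic function $F\colon\mathcal V\to\mathbb C$ such that $F(\Theta(\tau))=\tau$ for each $\tau\in\mathcal R_1$. Moreover $|F(x)|\le27$ for all $x\in\mathcal V$.
   Context: For $\mathrm{Im}\,\tau>0$ and $a,b\in\{0,1\}$, $\theta_{a,b}(z,\tau)=\sum_{m\in\mathbb Z}\exp\big(i\pi(m+\frac a2)^2\tau+2i\pi(m+\frac a2)(z+\frac b2)\big)$. $\mathcal R_1$ is the set of $\tau$ in the upper half plane with $|\mathrm{Re}\,\tau|\le\frac12$, $|\tau|\ge1$, $\mathrm{Im}\,\tau\le2$. $\Theta(\tau)=\theta_{0,1}(0,\tau/2)/\theta_{0,0}(0,\tau/2)$. Good Borchardt mean (genus 1): for $(s_0,s_1)\in\mathbb C^2$ with both entries in a common open half plane $\{w:\mathrm{Re}(e^{-i\alpha}w)>0\}$, a good step replaces $(s_0,s_1)$ by $\big(\frac{s_0+s_1}2,t_0t_1\big)$, where $t_0,t_1$ are square roots of $s_0,s_1$ both lying in a common open quarter plane $\{re^{i\theta}:r>0,\ \beta<\theta<\beta+\frac\pi2\}$ for some $\beta$. Iterating good steps converges to some $(\mu,\mu)$ with $\mu\ne0$,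 and $\mu(s_0,s_1):=\mu$. The formula for $F$ comes from the duplication formula ($\theta_{0,0}^2,\theta_{0,1}^2,\theta_{1,0}^2$ at $(0,\tau)$, divided by $\theta_{0,0}^2(0,\tau/2)$, are $\frac{1+x^2}2$, $x$, $\frac{1-x^2}2$ at $x=\Theta(\tau)$), the transformation $\theta_{0,1}^2/\theta_{0,0}^2(0,-1/\tau)=\theta_{1,0}^2/\theta_{0,0}^2(0,\tau)$, and the relation $\theta_{0,0}^2(0,-1/\tau)=-i\tau\,\theta_{0,0}^2(0,\tau)$. *)

(* Defs.v *)
From Stdlib Require Import Reals ZArith ClassicalEpsilon.
From Coquelicot Require Import Coquelicot.

Open Scope R_scope.
Open Scope C_scope.

Definition Cexp (z : C) : C :=
  RtoC (exp (Re z)) * (cos (Im z), sin (Im z)).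

(* Coquelicot's [Series] is real-valued and total.  The two definitions below
   give the usual sum whenever the series converges absolutely, which is the
   case for theta series with [0 < Im tau]. *)
Definition CSeries (f : nat -> C) : C :=
  (Series (fun n => Re (f n)), Series (fun n => Im (f n))).

Definition ZSeries (f : Z -> C) : C :=
  CSeries (fun n => f (Z.of_nat n)) + CSeries (fun n => f (- Z.of_nat (S n))%Z).

(* Only [a] and [b] in {0, 1} are meaningful. *)
Definition theta (a b : nat) (z tau : C) : C :=
  ZSeries (fun m : Z =>
    let k := RtoC (IZR m + INR a / 2)%R in
    Cexp (Ci * RtoC PI * k ^ 2 * tau
          + 2 * Ci * RtoC PI * k * (z + RtoC (INR b / 2)%R))).

Definition calR1 (tau : C) : Prop :=
  (0 < Im tau /\ Rabs (Re tau) <= 1 / 2 /\ 1 <= Cmod tau /\ Im tau <= 2)%R.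

Definition Theta (tau : C) : C :=
  theta 0 1 0 (tau / 2) / theta 0 0 0 (tau / 2).

Definition in_half_plane (alpha : R) (w : C) : Prop :=
  (0 < Re (Cexp (- (Ci * RtoC alpha)) * w))%R.

Definition in_common_half_plane (w0 w1 : C) : Prop :=
  exists alpha : R, in_half_plane alpha w0 /\ in_half_plane alpha w1.

Definition in_quarter_plane (beta : R) (w : C) : Prop :=
  exists r phi : R,
    (0 < r)%R /\ (beta < phi < beta + PI / 2)%R /\
    w = RtoC r * Cexp (Ci * RtoC phi).

Definition in_common_quarter_plane (w0 w1 : C) : Prop :=
  exists beta : R, in_quarter_plane beta w0 /\ in_quarter_plane beta w1.

Definition good_step (s s' : C * C) : Prop :=
  let '(s0, s1) := s in
  in_common_half_plane s0 s1 /\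
  exists t0 t1 : C,
    t0 ^ 2 = s0 /\ t1 ^ 2 = s1 /\ in_common_quarter_plane t0 t1 /\
    s' = ((s0 + s1) / 2, t0 * t1).

Definition good_iterates (s0 s1 : C) (u : nat -> C * C) : Prop :=
  u O = (s0, s1) /\ forall n, good_step (u n) (u (S n)).

Definition is_good_mean (s0 s1 mu : C) : Prop :=
  in_common_half_plane s0 s1 /\ mu <> 0 /\
  (exists u, good_iterates s0 s1 u) /\
  forall u, good_iterates s0 s1 u ->
    filterlim (fun n => fst (u n)) eventually (@locally C_UniformSpace mu) /\
    filterlim (fun n => snd (u n)) eventually (@locally C_UniformSpace mu).

Definition good_mean_defined (s0 s1 : C) : Prop :=
  exists mu : C, is_good_mean s0 s1 mu.

(* By uniqueness of limits, at most one [mu] satisfies [is_good_mean s0 s1];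
   the value is arbitrary outside [good_mean_defined]. *)
Definition good_mean (s0 s1 : C) : C :=
  epsilon (inhabits (RtoC 0)) (is_good_mean s0 s1).

Definition rho : R := (14 / 100000)%R.

Definition calV (x : C) : Prop :=
  exists tau : C, calR1 tau /\ (Cmod (x - Theta tau) < rho)%R.

Definition F (x : C) : C :=
  Ci * (good_mean 1 (2 * x / (1 + x ^ 2))
        / good_mean 1 ((1 - x ^ 2) / (1 + x ^ 2))).

(* For [D] open: [f] is given near each point of [D] by a convergent power
   series. *)
Definition analytic_on (D : C -> Prop) (f : C -> C) : Prop :=
  forall x0 : C, D x0 ->
  exists (a : nat -> C) (r : R), (0 < r)%R /\
    forall x : C, (Cmod (x - x0) < r)%R ->
      @is_pseries C_AbsRing C_NormedModule a (x - x0) (f x).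

(* Main.v *)
(** [Theta tau] is a quotient of theta constants at nome [q = exp(i pi tau/2)]; at [x = Theta tau] the
    two quotients in [F] are [theta01^2/theta00^2] at [tau] and at [-1/tau].  Duplication
    makes [theta00^2, theta01^2] at [2^n tau] a sequence of good Borchardt iterates tending to [(1, 1)], so
    [mu (1, theta01^2/theta00^2) = 1/theta00^2], and [theta00^2(-1/tau) = - i tau theta00^2(tau)]
    yields [F (Theta tau) = tau].

    On [calV] one has [Re x > 0] and [|x|^2 <= 13/14], which puts both quotients in the right half plane;
    there good steps use principal square roots, halve the distance of the two entries and keep the real
    part above [min (1, Re s)].  So [F] is a uniform limit of holomorphic functions,
    hence analytic, and the lower bound for the real parts also bounds [|F|].

    Duplication comes from summing [Q^(2u^2 + 2v^2)] along [u + v = m], and the transformation from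
    Poisson summation, where the Fourier transform of the Gaussian is found from its differential
    equations in the frequency and in the width, and the normalisation from the self-dual point [tau = i]. *)

Require Import Defs.
From Stdlib Require Import Reals ZArith Lra Lia ClassicalEpsilon Machin.
From Coquelicot Require Import Coquelicot.

Local Open Scope R_scope.

(** A sequence of theta squares is a Borchardt sequence only if the right square roots are taken.
    One sign decides: two roots at an acute angle have a product that does not depend on their
    choice. At nomes of modulus at most 1/4 theta values have argument below pi/4, so they pass this
    test, and the condition Im tau <= 2 is what keeps the nome of -1/tau in that range. The
    constants 13/14 and 27 are linked by (1 + X) / (1 - X) = 27 at X = 13/14, where X bounds |x|^2;
    the theta estimates leave room below 13/14 for the radius [rho]. Poisson summation is done
    without improper integrals. Gaussians are integrated over [-M - 1/2, M + 1/2], where each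
    differential equation holds up to an explicit boundary term, and only then does M tend to
    infinity. The transformation law is proved for the square of theta_00, which avoids a branch of
    the square root of -i tau; the law that turns theta_01 into theta_10 is then deduced from
    duplication. *)

Lemma C_eq (z w : C) : Re z = Re w -> Im z = Im w -> z = w.
Proof. destruct z, w; unfold Re, Im; simpl; intros -> ->; reflexivity. Qed.

Lemma re_minus (z w : C) : Re (z - w)%C = Re z - Re w.
Proof. reflexivity. Qed.

Lemma im_minus (z w : C) : Im (z - w)%C = Im z - Im w.
Proof. reflexivity. Qed.

Lemma im_le_Cmod (z : C) : Rabs (Im z) <= Cmod z.
Proof. exact (Rle_trans _ _ _ (Rmax_r _ _) (Rmax_Cmod z)). Qed.

Lemma Cmod_le_re_im (z : C) : Cmod z <= Rabs (Re z) + Rabs (Im z).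
Proof.
  assert (H := Cmod2_alt z). assert (H0 := Cmod_ge_0 z).
  assert (H1 := Rabs_pos (Re z)). assert (H2 := Rabs_pos (Im z)).
  apply Rsqr_incr_0; [| assumption | lra].
  unfold Rsqr.
  assert (Re z ^ 2 = Rabs (Re z) ^ 2) by (symmetry; apply pow2_abs).
  assert (Im z ^ 2 = Rabs (Im z) ^ 2) by (symmetry; apply pow2_abs).
  nra.
Qed.

Lemma Cmod_minus_sym (z w : C) : Cmod (z - w) = Cmod (w - z).
Proof. replace (z - w)%C with (- (w - z))%C by ring. apply Cmod_opp. Qed.

Lemma Cmod_triangle_minus (z w : C) : Cmod (z - w) <= Cmod z + Cmod w.
Proof. unfold Cminus. rewrite <- (Cmod_opp w). apply Cmod_triangle. Qed.

Lemma Cmod_triangle_lower (z w : C) : Cmod z - Cmod w <= Cmod (z + w).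
Proof.
  assert (H := Cmod_triangle (z + w) (- w)).
  replace (z + w + - w)%C with z in H by ring. rewrite Cmod_opp in H. lra.
Qed.

Lemma Cmod_RtoC_pos (r : R) : 0 <= r -> Cmod (RtoC r) = r.
Proof. intros; rewrite Cmod_R; apply Rabs_pos_eq; assumption. Qed.

Lemma Cminus_neq_0 (z w : C) : z <> w -> (z - w <> 0)%C.
Proof. intros H E; apply H. replace z with (z - w + w)%C by ring. rewrite E. ring. Qed.

Lemma sqrt_2_le_2 : sqrt 2 <= 2.
Proof. rewrite <- (sqrt_Rsqr 2) at 2 by lra. apply sqrt_le_1_alt. unfold Rsqr; lra. Qed.

(** * Limits of complex sequences *)

(** Stated through the modulus, so that squeezing and the arithmetic of real limits apply at once;
    [Ccv_filterlim] translates to the filter that [is_good_mean] uses. *)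
Definition Ccv (u : nat -> C) (l : C) : Prop :=
  is_lim_seq (fun n => Cmod (u n - l)) 0.

Lemma is_lim_seq_0_eps (u : nat -> R) :
  (forall n, 0 <= u n) ->
  is_lim_seq u 0 <-> forall eps, 0 < eps -> exists N, forall n, (N <= n)%nat -> u n < eps.
Proof.
  intros Hu; split.
  - intros H eps He. apply is_lim_seq_spec in H.
    destruct (H (mkposreal eps He)) as [N HN]. exists N. intros n Hn.
    specialize (HN n Hn). simpl in HN. rewrite Rminus_0_r in HN.
    rewrite Rabs_pos_eq in HN; auto.
  - intros H. apply is_lim_seq_spec. intros [eps He]. destruct (H eps He) as [N HN].
    exists N. intros n Hn. simpl. rewrite Rminus_0_r, Rabs_pos_eq; auto.
Qed.

Lemma Ccv_eps (u : nat -> C) (l : C) :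
  Ccv u l <->
  forall eps, 0 < eps -> exists N, forall n, (N <= n)%nat -> Cmod (u n - l) < eps.
Proof. apply is_lim_seq_0_eps. intros; apply Cmod_ge_0. Qed.

Lemma Ccv_squeeze (u : nat -> C) (l : C) (e : nat -> R) :
  (forall n, Cmod (u n - l) <= e n) -> is_lim_seq e 0 -> Ccv u l.
Proof.
  intros H He. apply is_lim_seq_le_le with (fun _ => 0) e; auto using is_lim_seq_const.
  intros n; split; [apply Cmod_ge_0 | apply H].
Qed.

Lemma Ccv_ext (u v : nat -> C) (l : C) : (forall n, u n = v n) -> Ccv u l -> Ccv v l.
Proof. intros H. apply is_lim_seq_ext. intros n; rewrite H; reflexivity. Qed.

Lemma Ccv_eq (u : nat -> C) (l m : C) : Ccv u l -> l = m -> Ccv u m.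
Proof. intros H <-. exact H. Qed.

Lemma Ccv_const (l : C) : Ccv (fun _ => l) l.
Proof.
  apply Ccv_squeeze with (fun _ => 0); [|apply is_lim_seq_const].
  intros _. replace (l - l)%C with (RtoC 0) by ring. rewrite Cmod_0; lra.
Qed.

Lemma Ccv_plus (u v : nat -> C) (l m : C) :
  Ccv u l -> Ccv v m -> Ccv (fun n => u n + v n)%C (l + m)%C.
Proof.
  intros Hu Hv. apply Ccv_squeeze with (fun n => Cmod (u n - l) + Cmod (v n - m)).
  - intros n. replace (u n + v n - (l + m))%C with ((u n - l) + (v n - m))%C by ring.
    apply Cmod_triangle.
  - replace (Finite 0) with (Finite (0 + 0)) by (f_equal; ring).
    apply is_lim_seq_plus'; assumption.
Qed.

Lemma Ccv_Cmod (u : nat -> C) (l : C) : Ccv u l -> is_lim_seq (fun n => Cmod (u n)) (Cmod l).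
Proof.
  intros H. apply is_lim_seq_le_le with
    (fun n => Cmod l - Cmod (u n - l)) (fun n => Cmod l + Cmod (u n - l)).
  - intros n; split.
    + assert (X := Cmod_triangle (u n) (l - u n)).
      replace (u n + (l - u n))%C with l in X by ring.
      rewrite (Cmod_minus_sym (u n) l). lra.
    + assert (X := Cmod_triangle l (u n - l)).
      replace (l + (u n - l))%C with (u n) in X by ring. lra.
  - replace (Finite (Cmod l)) with (Finite (Cmod l - 0)) by (f_equal; ring).
    apply is_lim_seq_minus'; [apply is_lim_seq_const | exact H].
  - replace (Finite (Cmod l)) with (Finite (Cmod l + 0)) by (f_equal; ring).
    apply is_lim_seq_plus'; [apply is_lim_seq_const | exact H].
Qed.

Lemma Ccv_mult (u v : nat -> C) (l m : C) :
  Ccv u l -> Ccv v m -> Ccv (fun n => u n * v n)%C (l * m)%C.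
Proof.
  intros Hu Hv.
  apply Ccv_squeeze with (fun n => Cmod (u n - l) * Cmod (v n) + Cmod l * Cmod (v n - m)).
  - intros n.
    replace (u n * v n - l * m)%C with ((u n - l) * v n + l * (v n - m))%C by ring.
    eapply Rle_trans; [apply Cmod_triangle|]. rewrite !Cmod_mult. lra.
  - replace (Finite 0) with (Finite (0 * Cmod m + Cmod l * 0)) by (f_equal; ring).
    apply is_lim_seq_plus'; apply is_lim_seq_mult';
      auto using is_lim_seq_const, Ccv_Cmod.
Qed.

Lemma Ccv_scal (c : C) (u : nat -> C) (l : C) : Ccv u l -> Ccv (fun n => c * u n)%C (c * l)%C.
Proof. intros; apply Ccv_mult; auto using Ccv_const. Qed.

Lemma Ccv_minus (u v : nat -> C) (l m : C) :
  Ccv u l -> Ccv v m -> Ccv (fun n => u n - v n)%C (l - m)%C.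
Proof.
  intros Hu Hv. replace (l - m)%C with (l + (-(1)) * m)%C by ring.
  apply Ccv_ext with (fun n => u n + (-(1)) * v n)%C; [intros; ring|].
  apply Ccv_plus; auto using Ccv_scal.
Qed.

Lemma Ccv_unique (u : nat -> C) (l m : C) : Ccv u l -> Ccv u m -> l = m.
Proof.
  intros Hl Hm.
  assert (H : Ccv (fun _ => RtoC 0) (l - m)%C).
  { replace (l - m)%C with (- (1) * (m - l))%C by ring.
    apply Ccv_ext with (fun n => -(1) * (u n - u n))%C; [intros; ring|].
    apply Ccv_scal. apply Ccv_minus; assumption. }
  apply Ccv_Cmod in H. rewrite Cmod_0 in H.
  apply is_lim_seq_unique in H. rewrite Lim_seq_const in H.
  injection H as H. symmetry in H. apply Cmod_eq_0 in H.
  replace l with (l - m + m)%C by ring. rewrite H. ring.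
Qed.

Lemma Ccv_re (u : nat -> C) (l : C) : Ccv u l -> is_lim_seq (fun n => Re (u n)) (Re l).
Proof.
  intros H. apply is_lim_seq_spec. intros [eps He].
  destruct (proj1 (Ccv_eps u l) H eps He) as [N HN]. exists N. intros n Hn. simpl.
  rewrite <- re_minus. eapply Rle_lt_trans; [apply re_le_Cmod | auto].
Qed.

Lemma Ccv_im (u : nat -> C) (l : C) : Ccv u l -> is_lim_seq (fun n => Im (u n)) (Im l).
Proof.
  intros H. apply is_lim_seq_spec. intros [eps He].
  destruct (proj1 (Ccv_eps u l) H eps He) as [N HN]. exists N. intros n Hn. simpl.
  rewrite <- im_minus. eapply Rle_lt_trans; [apply im_le_Cmod | auto].
Qed.

Lemma is_lim_seq_scal_0 (c : R) (u : nat -> R) : is_lim_seq u 0 -> is_lim_seq (fun n => c * u n) 0.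
Proof.
  intros H. replace (Finite 0) with (Finite (c * 0)) by (f_equal; ring).
  apply is_lim_seq_mult'; [apply is_lim_seq_const | exact H].
Qed.

Lemma Ccv_components (u : nat -> C) (l : C) :
  is_lim_seq (fun n => Re (u n)) (Re l) -> is_lim_seq (fun n => Im (u n)) (Im l) -> Ccv u l.
Proof.
  intros Hr Hi.
  apply Ccv_squeeze with (fun n => Rabs (Re (u n) - Re l) + Rabs (Im (u n) - Im l)).
  - intros n. rewrite <- re_minus, <- im_minus. apply Cmod_le_re_im.
  - replace (Finite 0) with (Finite (Rabs (Re l - Re l) + Rabs (Im l - Im l)))
      by (f_equal; rewrite !Rminus_diag, Rabs_R0; ring).
    apply is_lim_seq_plus';
      refine (is_lim_seq_abs _ (Finite _) _);
      apply is_lim_seq_minus'; auto using is_lim_seq_const.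
Qed.

Lemma Ccv_incr_n (u : nat -> C) (k : nat) (l : C) : Ccv u l -> Ccv (fun n => u (n + k)%nat) l.
Proof. intros H. apply (is_lim_seq_incr_n (fun n => Cmod (u n - l)) k 0). exact H. Qed.

(** The balls of [C_UniformSpace] are squares, which costs a factor [sqrt 2] against the discs of
    [Cmod]. *)
Lemma Ccv_filterlim (u : nat -> C) (l : C) :
  Ccv u l <-> filterlim u eventually (@locally C_UniformSpace l).
Proof.
  rewrite Ccv_eps. split.
  - intros H P [eps HP]. destruct (H eps (cond_pos eps)) as [N HN].
    exists N. intros n Hn. apply HP. apply C_NormedModule_mixin_compat1.
    apply HN; assumption.
  - intros H eps He.
    assert (He' : 0 < eps / 2) by lra.
    destruct (H (fun z => ball (M := C_UniformSpace) l (mkposreal _ He') z)) as [N HN].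
    { exists (mkposreal _ He'). auto. }
    exists N. intros n Hn. specialize (HN n Hn).
    apply C_NormedModule_mixin_compat2 in HN.
    change (Cmod (u n - l) < sqrt 2 * (eps / 2)) in HN.
    assert (H2 := sqrt_2_le_2). nra.
Qed.

(** * Finite sums and series *)

Fixpoint csum (f : nat -> C) (n : nat) : C :=
  match n with O => RtoC 0 | S k => (csum f k + f k)%C end.

Fixpoint rsum (f : nat -> R) (n : nat) : R :=
  match n with O => 0 | S k => rsum f k + f k end.

Lemma csum_ext (f g : nat -> C) (n : nat) :
  (forall k, (k < n)%nat -> f k = g k) -> csum f n = csum g n.
Proof. induction n; intros H; simpl; auto. rewrite IHn, H by auto. reflexivity. Qed.

Lemma csum_plus (f g : nat -> C) (n : nat) :
  csum (fun k => f k + g k)%C n = (csum f n + csum g n)%C.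
Proof. induction n; simpl; [|rewrite IHn]; ring. Qed.

Lemma csum_scal (c : C) (f : nat -> C) (n : nat) :
  csum (fun k => c * f k)%C n = (c * csum f n)%C.
Proof. induction n; simpl; [|rewrite IHn]; ring. Qed.

Lemma csum_minus (f g : nat -> C) (n : nat) :
  csum (fun k => f k - g k)%C n = (csum f n - csum g n)%C.
Proof. induction n; simpl; [|rewrite IHn]; ring. Qed.

Lemma csum_split_first (f : nat -> C) (n : nat) :
  csum f (S n) = (f O + csum (fun k => f (S k)) n)%C.
Proof. induction n; [simpl; ring|]. change (csum f (S (S n))) with (csum f (S n) + f (S n))%C.
  rewrite IHn. simpl. ring. Qed.

Lemma csum_switch (f : nat -> nat -> C) (n m : nat) :
  csum (fun i => csum (f i) m) n = csum (fun j => csum (fun i => f i j) n) m.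
Proof.
  induction n; simpl.
  - induction m; simpl; [|rewrite <- IHm]; ring.
  - rewrite IHn, csum_plus. reflexivity.
Qed.

Lemma csum_telescope (u : nat -> C) (n : nat) :
  csum (fun k => u (S k) - u k)%C n = (u n - u O)%C.
Proof. induction n; simpl; [|rewrite IHn]; ring. Qed.

Lemma re_csum (f : nat -> C) (n : nat) : Re (csum f n) = rsum (fun k => Re (f k)) n.
Proof. induction n; cbn [csum rsum]; [reflexivity|]. rewrite re_plus, IHn; reflexivity. Qed.

Lemma im_csum (f : nat -> C) (n : nat) : Im (csum f n) = rsum (fun k => Im (f k)) n.
Proof. induction n; cbn [csum rsum]; [reflexivity|]. rewrite im_plus, IHn; reflexivity. Qed.

Lemma rsum_le (f g : nat -> R) (n : nat) :
  (forall k, (k < n)%nat -> f k <= g k) -> rsum f n <= rsum g n.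
Proof.
  induction n; intros H; simpl; [lra|].
  apply Rplus_le_compat; auto.
Qed.

Lemma rsum_scal (c : R) (f : nat -> R) (n : nat) : rsum (fun k => c * f k) n = c * rsum f n.
Proof. induction n; simpl; [|rewrite IHn]; ring. Qed.

Lemma Cmod_csum_le (f : nat -> C) (n : nat) : Cmod (csum f n) <= rsum (fun k => Cmod (f k)) n.
Proof.
  induction n; simpl; [rewrite Cmod_0; lra|].
  eapply Rle_trans; [apply Cmod_triangle | lra].
Qed.

Lemma rsum_sum_n (f : nat -> R) (n : nat) : sum_n f n = rsum f (S n).
Proof.
  induction n; [rewrite sum_O; simpl; ring|].
  rewrite sum_Sn, IHn. reflexivity.
Qed.

Lemma csum_sum_n (f : nat -> C) (n : nat) : @sum_n C_AbelianMonoid f n = csum f (S n).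
Proof.
  induction n; [rewrite sum_O; simpl; ring|].
  rewrite sum_Sn, IHn. reflexivity.
Qed.

Lemma is_series_rsum (f : nat -> R) (l : R) : is_series f l <-> is_lim_seq (rsum f) l.
Proof.
  split; intros H.
  - apply is_lim_seq_incr_1. apply is_lim_seq_ext with (sum_n f).
    + intros; apply rsum_sum_n.
    + exact H.
  - apply is_lim_seq_incr_1 in H.
    apply (is_lim_seq_ext _ (sum_n f)) in H; [exact H|].
    intros; symmetry; apply rsum_sum_n.
Qed.

Lemma CSeries_unique (f : nat -> C) (l : C) : Ccv (csum f) l -> CSeries f = l.
Proof.
  intros H. apply C_eq; unfold CSeries; simpl; apply is_series_unique, is_series_rsum.
  - apply is_lim_seq_ext with (fun n => Re (csum f n)); [apply re_csum | apply Ccv_re, H].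
  - apply is_lim_seq_ext with (fun n => Im (csum f n)); [apply im_csum | apply Ccv_im, H].
Qed.

Lemma Ccv_csum_abs (f : nat -> C) (g : nat -> R) :
  (forall n, Cmod (f n) <= g n) -> ex_series g -> Ccv (csum f) (CSeries f).
Proof.
  intros H Hg.
  assert (X : forall p : C -> R, (forall z, Rabs (p z) <= Cmod z) ->
              is_lim_seq (rsum (fun n => p (f n))) (Series (fun n => p (f n)))).
  { intros p Hp. apply is_series_rsum, Series_correct.
    apply (ex_series_le (K := R_AbsRing) (V := R_CompleteNormedModule) _ g); auto.
    intros n. eapply Rle_trans; [apply Hp | apply H]. }
  apply Ccv_components.
  - apply is_lim_seq_ext with (rsum (fun n => Re (f n))).
    + intros; symmetry; apply re_csum.
    + apply X, re_le_Cmod.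
  - apply is_lim_seq_ext with (rsum (fun n => Im (f n))).
    + intros; symmetry; apply im_csum.
    + apply X, im_le_Cmod.
Qed.

Lemma rsum_Series_bounds (g : nat -> R) :
  (forall n, 0 <= g n) -> ex_series g ->
  (forall n m, (n <= m)%nat -> rsum g n <= rsum g m) /\ (forall n, rsum g n <= Series g).
Proof.
  intros Hg Hs.
  assert (Hm : forall n m, (n <= m)%nat -> rsum g n <= rsum g m).
  { intros n m Hnm; induction Hnm; [lra|]. simpl. specialize (Hg m). lra. }
  split; auto. intros n.
  apply Series_correct, is_series_rsum in Hs.
  apply is_lim_seq_incr_n with (N := n) in Hs.
  refine (is_lim_seq_le (fun _ => rsum g n) _ (rsum g n) _ _ (is_lim_seq_const _) Hs).
  intros k; apply Hm; lia.
Qed.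

Lemma Cmod_csum_range (f : nat -> C) (g : nat -> R) (n m : nat) :
  (forall k, Cmod (f k) <= g k) -> (n <= m)%nat ->
  Cmod (csum f m - csum f n) <= rsum g m - rsum g n.
Proof.
  intros H Hnm; induction Hnm.
  - replace (csum f n - csum f n)%C with (RtoC 0) by ring. rewrite Cmod_0; lra.
  - simpl. replace (csum f m + f m - csum f n)%C with (csum f m - csum f n + f m)%C by ring.
    eapply Rle_trans; [apply Cmod_triangle|]. specialize (H m). lra.
Qed.

Lemma Ccv_Cmod_le (u : nat -> C) (l : C) (M : R) :
  (forall n, Cmod (u n) <= M) -> Ccv u l -> Cmod l <= M.
Proof.
  intros H Hu. apply Ccv_Cmod in Hu.
  exact (is_lim_seq_le _ (fun _ => M) _ M H Hu (is_lim_seq_const M)).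
Qed.

Lemma Ccv_csum_fixed (f : nat -> nat -> C) (l : nat -> C) (n : nat) :
  (forall k, Ccv (fun N => f N k) (l k)) -> Ccv (fun N => csum (f N) n) (csum l n).
Proof.
  intros H; induction n; simpl; [apply Ccv_const | apply Ccv_plus; auto].
Qed.

(** Tannery's theorem, where the number of terms [K N] may grow at any rate from N upwards. Cut at a
    fixed [n0] beyond which [g] sums to less than eps/4: the head converges termwise, and the tails
    of [f N] and of [l] are both below that of [g]. The freedom in [K] serves the diagonal argument
    of [gint_theta_null]. *)
Lemma csum_dominated (f : nat -> nat -> C) (l : nat -> C) (g : nat -> R) (K : nat -> nat) :
  (forall N, (N <= K N)%nat) -> (forall N n, Cmod (f N n) <= g n) -> ex_series g ->
  (forall n, Ccv (fun N => f N n) (l n)) ->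
  Ccv (fun N => csum (f N) (K N)) (CSeries l).
Proof.
  intros HK Hf Hg Hl.
  assert (Hg0 : forall n, 0 <= g n).
  { intros n. eapply Rle_trans; [apply Cmod_ge_0 | apply (Hf O)]. }
  assert (Hlg : forall n, Cmod (l n) <= g n).
  { intros n. apply Ccv_Cmod_le with (fun N => f N n); auto. }
  destruct (rsum_Series_bounds g Hg0 Hg) as [Hm HS].
  assert (HL := Ccv_csum_abs l g Hlg Hg).
  apply Ccv_eps. intros eps He.
  assert (Hlim := proj1 (is_series_rsum g _) (Series_correct g Hg)).
  apply is_lim_seq_spec in Hlim.
  assert (He4 : 0 < eps / 4) by lra.
  destruct (Hlim (mkposreal _ He4)) as [n0 Hn0]. specialize (Hn0 n0 (Nat.le_refl _)).
  simpl in Hn0. apply Rabs_def2 in Hn0.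
  assert (H1 := proj1 (Ccv_eps _ _) (Ccv_csum_fixed f l n0 Hl) _ He4).
  destruct H1 as [N1 HN1].
  assert (Ht : Cmod (CSeries l - csum l n0) <= Series g - rsum g n0).
  { apply Ccv_Cmod_le with (fun N => csum l (N + n0) - csum l n0)%C.
    - intros N. eapply Rle_trans; [apply (Cmod_csum_range l g); auto; lia|].
      specialize (HS (N + n0)%nat). lra.
    - apply Ccv_minus; [apply Ccv_incr_n, HL | apply Ccv_const]. }
  exists (N1 + n0)%nat. intros N HN.
  assert (Hf' : Cmod (csum (f N) (K N) - csum (f N) n0) <= Series g - rsum g n0).
  { eapply Rle_trans; [apply (Cmod_csum_range (f N) g); auto; specialize (HK N); lia|].
    specialize (HS (K N)). lra. }
  assert (H2 := HN1 N ltac:(lia)).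
  replace (csum (f N) (K N) - CSeries l)%C with
    ((csum (f N) (K N) - csum (f N) n0) + (csum (f N) n0 - csum l n0)
     - (CSeries l - csum l n0))%C by ring.
  eapply Rle_lt_trans; [apply Cmod_triangle_minus|].
  assert (H3 := Cmod_triangle (csum (f N) (K N) - csum (f N) n0) (csum (f N) n0 - csum l n0)).
  lra.
Qed.

Lemma csum_0 (n : nat) : csum (fun _ => RtoC 0) n = RtoC 0.
Proof. induction n; simpl; [reflexivity | rewrite IHn; ring]. Qed.

Lemma is_lim_seq_inv_INR : is_lim_seq (fun n => / (INR n + 1)) 0.
Proof.
  refine (is_lim_seq_inv _ p_infty _ _); [|discriminate].
  apply is_lim_seq_ext with (fun n => INR (S n)); [intros; apply S_INR|].
  apply -> is_lim_seq_incr_1. apply is_lim_seq_INR.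
Qed.

(** * The exponential *)

Lemma re_Cexp (z : C) : Re (Cexp z) = exp (Re z) * cos (Im z).
Proof. unfold Cexp. rewrite re_scal_l. reflexivity. Qed.

Lemma im_Cexp (z : C) : Im (Cexp z) = exp (Re z) * sin (Im z).
Proof. unfold Cexp. rewrite im_scal_l. reflexivity. Qed.

Lemma Cexp_plus (z w : C) : Cexp (z + w) = (Cexp z * Cexp w)%C.
Proof.
  apply C_eq; rewrite ?re_mult, ?im_mult, !re_Cexp, !im_Cexp, re_plus, im_plus, exp_plus.
  - rewrite cos_plus; ring.
  - rewrite sin_plus; ring.
Qed.

Lemma Cexp_0 : Cexp 0 = RtoC 1.
Proof.
  apply C_eq; rewrite ?re_Cexp, ?im_Cexp; simpl; rewrite exp_0, ?cos_0, ?sin_0; ring.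
Qed.

Lemma Cmod_Cexp (z : C) : Cmod (Cexp z) = exp (Re z).
Proof.
  assert (H := exp_pos (Re z)).
  unfold Cexp. rewrite Cmod_mult, Cmod_RtoC_pos by lra.
  unfold Cmod; simpl. replace (cos (Im z) * (cos (Im z) * 1) + sin (Im z) * (sin (Im z) * 1))
    with (Rsqr (sin (Im z)) + Rsqr (cos (Im z))) by (unfold Rsqr; ring).
  rewrite sin2_cos2, sqrt_1. ring.
Qed.

Lemma exp_le_compat (x y : R) : x <= y -> exp x <= exp y.
Proof. intros [H | ->]; [left; apply exp_increasing, H | right; reflexivity]. Qed.

Lemma Cexp_neq_0 (z : C) : Cexp z <> 0%C.
Proof. apply Cmod_gt_0. rewrite Cmod_Cexp. apply exp_pos. Qed.

Lemma Cexp_opp (z : C) : Cexp (- z) = (/ Cexp z)%C.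
Proof.
  assert (H := Cexp_neq_0 z).
  replace (Cexp (- z)) with (Cexp (- z) * Cexp z / Cexp z)%C by (field; assumption).
  rewrite <- Cexp_plus. replace (- z + z)%C with (RtoC 0) by ring. rewrite Cexp_0. field. assumption.
Qed.

Lemma Cexp_nat (n : nat) (z : C) : Cexp (RtoC (INR n) * z) = (Cexp z ^ n)%C.
Proof.
  induction n.
  - simpl Cpow. rewrite <- Cexp_0. f_equal. simpl. ring.
  - rewrite Cpow_S, <- IHn, <- Cexp_plus. f_equal. rewrite S_INR, RtoC_plus. ring.
Qed.

Lemma Cexp_PI : Cexp (Ci * RtoC PI) = (- (1))%C.
Proof.
  apply C_eq; rewrite ?re_Cexp, ?im_Cexp; simpl.
  - replace (0 * PI - 1 * 0) with 0 by ring. replace (0 * 0 + 1 * PI) with PI by ring.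
    rewrite exp_0, cos_PI; ring.
  - replace (0 * PI - 1 * 0) with 0 by ring. replace (0 * 0 + 1 * PI) with PI by ring.
    rewrite exp_0, sin_PI; ring.
Qed.

(** * The good Borchardt mean on the right half plane *)

(* Principal square root; only used when [0 < Re z]. *)
Definition csqrt (z : C) : C :=
  let p := sqrt ((Cmod z + Re z) / 2) in (p, Im z / (2 * p)).

(** Half-angle formulas: the squares of the two parts are (|z| + Re z)/2 and (|z| - Re z)/2. Their
    difference is Re z, so a positive real part is what puts the root in the open sector of
    half-angle pi/4. *)
Lemma csqrt_spec (z : C) : 0 < Re z ->
  (csqrt z ^ 2 = z)%C /\ Rabs (Im (csqrt z)) < Re (csqrt z).
Proof.
  intros Hz. assert (Hm := re_le_Cmod z). rewrite Rabs_pos_eq in Hm by lra.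
  assert (H2 := Cmod2_alt z).
  unfold csqrt. set (p := sqrt ((Cmod z + Re z) / 2)).
  assert (Hp : 0 < p) by (apply sqrt_lt_R0; lra).
  assert (Hpp : p * p = (Cmod z + Re z) / 2) by (apply sqrt_sqrt; lra).
  assert (Hq : (Im z / (2 * p)) * (Im z / (2 * p)) = (Cmod z - Re z) / 2).
  { replace (Im z / (2 * p) * (Im z / (2 * p))) with (Im z ^ 2 / (4 * (p * p))) by (field; lra).
    rewrite Hpp. apply Rmult_eq_reg_r with (4 * ((Cmod z + Re z) / 2)); [|lra].
    unfold Rdiv at 1. rewrite Rmult_assoc, Rinv_l by lra. nra. }
  split.
  - apply C_eq; simpl Cpow; rewrite Cmult_1_r, ?re_mult, ?im_mult; simpl Re; simpl Im.
    + rewrite Hpp, Hq. lra.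
    + field. lra.
  - simpl. apply Rsqr_incrst_0; [|apply Rabs_pos | lra].
    rewrite <- Rsqr_abs. unfold Rsqr. rewrite Hq, Hpp. lra.
Qed.

Lemma Csqr_eq (t u : C) : (t ^ 2 = u ^ 2)%C -> t = u \/ t = (- u)%C.
Proof.
  intros H. assert (H0 : ((t - u) * (t + u) = 0)%C).
  { replace ((t - u) * (t + u))%C with (t ^ 2 - u ^ 2)%C by ring. rewrite H. ring. }
  destruct (excluded_middle_informative (t = u)) as [|Hne]; [left; assumption|right].
  destruct (excluded_middle_informative ((t + u)%C = 0%C)) as [E|Hne'].
  - replace t with (t + u - u)%C by ring. rewrite E. ring.
  - exfalso. apply (Cmult_neq_0 (t - u) (t + u)); auto using Cminus_neq_0.
Qed.

(** Changing the sign of exactly one root changes the sign of [Re (t0 * Cconj t1)]; changing both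
    leaves the product as it is. *)
Lemma acute_roots_product_unique (t0 t1 u0 u1 : C) :
  (t0 ^ 2 = u0 ^ 2)%C -> (t1 ^ 2 = u1 ^ 2)%C ->
  0 < Re (t0 * Cconj t1) -> 0 < Re (u0 * Cconj u1) -> (t0 * t1 = u0 * u1)%C.
Proof.
  intros H0 H1 Ht Hu. rewrite re_mult, re_conj, im_conj in Ht, Hu.
  destruct (Csqr_eq _ _ H0) as [-> | ->], (Csqr_eq _ _ H1) as [-> | ->]; try ring;
    rewrite ?re_opp, ?im_opp in Ht; exfalso; nra.
Qed.

(* A scale-invariant weakening of [good_step] that still determines the result. *)
Definition acute_step (s s' : C * C) : Prop :=
  exists t0 t1 : C, (t0 ^ 2)%C = fst s /\ (t1 ^ 2)%C = snd s /\
    0 < Re (t0 * Cconj t1) /\ s' = (((fst s + snd s) / 2)%C, (t0 * t1)%C).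

Lemma acute_step_unique (s s' s'' : C * C) : acute_step s s' -> acute_step s s'' -> s' = s''.
Proof.
  intros (t0 & t1 & H0 & H1 & H2 & ->) (u0 & u1 & G0 & G1 & G2 & ->).
  f_equal. apply acute_roots_product_unique; auto; congruence.
Qed.

Lemma acute_iterates_unique (u v : nat -> C * C) :
  u O = v O -> (forall n, acute_step (u n) (u (S n))) ->
  (forall n, acute_step (v n) (v (S n))) -> forall n, u n = v n.
Proof.
  intros H0 Hu Hv n; induction n; auto.
  apply acute_step_unique with (u n); auto. rewrite IHn; auto.
Qed.

Lemma common_quarter_plane_acute (t0 t1 : C) :
  in_common_quarter_plane t0 t1 -> 0 < Re (t0 * Cconj t1).
Proof.
  intros (beta & (r & phi & Hr & Hphi & ->) & (r' & phi' & Hr' & Hphi' & ->)).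
  rewrite re_mult, re_conj, im_conj, !re_scal_l, !im_scal_l, !re_Cexp, !im_Cexp.
  replace (Re (Ci * phi)) with 0 by (rewrite re_mult; simpl; ring).
  replace (Re (Ci * phi')) with 0 by (rewrite re_mult; simpl; ring).
  replace (Im (Ci * phi)) with phi by (rewrite im_mult; simpl; ring).
  replace (Im (Ci * phi')) with phi' by (rewrite im_mult; simpl; ring).
  rewrite exp_0.
  replace (r * (1 * cos phi) * (r' * (1 * cos phi')) - r * (1 * sin phi) * - (r' * (1 * sin phi')))
    with (r * r' * cos (phi - phi')) by (rewrite cos_minus; ring).
  apply Rmult_lt_0_compat; [nra|]. apply cos_gt_0; lra.
Qed.

Lemma good_step_acute (s s' : C * C) : good_step s s' -> acute_step s s'.
Proof.
  destruct s as [s0 s1]. intros (_ & t0 & t1 & H0 & H1 & H2 & ->).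
  exists t0, t1. auto using common_quarter_plane_acute.
Qed.

Lemma in_quarter_plane_sector (t : C) :
  Rabs (Im t) < Re t -> in_quarter_plane (- (PI / 4)) t.
Proof.
  intros H. assert (Hr : 0 < Re t) by (assert (X := Rabs_pos (Im t)); lra).
  apply Rabs_def2 in H.
  set (phi := atan (Im t / Re t)).
  assert (Hphi : - (PI / 4) < phi < PI / 4).
  { rewrite <- atan_1, <- atan_opp. split; apply atan_increasing.
    - apply Rmult_lt_reg_r with (Re t); auto. unfold Rdiv.
      rewrite Rmult_assoc, Rinv_l; lra.
    - apply Rmult_lt_reg_r with (Re t); auto. unfold Rdiv.
      rewrite Rmult_assoc, Rinv_l; lra. }
  assert (Hpi := PI_RGT_0).
  assert (Hc : 0 < cos phi) by (apply cos_gt_0; lra).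
  exists (Re t / cos phi), phi. split; [apply Rdiv_lt_0_compat; auto|split; [lra|]].
  apply C_eq; rewrite ?re_scal_l, ?im_scal_l, ?re_Cexp, ?im_Cexp;
    replace (Re (Ci * phi)) with 0 by (rewrite re_mult; simpl; ring);
    replace (Im (Ci * phi)) with phi by (rewrite im_mult; simpl; ring); rewrite exp_0.
  - field. lra.
  - replace (Re t / cos phi * (1 * sin phi)) with (Re t * tan phi) by (unfold tan; field; lra).
    unfold phi. rewrite tan_atan. field. lra.
Qed.

Lemma common_quarter_plane_sector (t0 t1 : C) :
  Rabs (Im t0) < Re t0 -> Rabs (Im t1) < Re t1 -> in_common_quarter_plane t0 t1.
Proof. intros; exists (- (PI / 4)); split; apply in_quarter_plane_sector; assumption. Qed.

Lemma common_half_plane_right (w0 w1 : C) : 0 < Re w0 -> 0 < Re w1 -> in_common_half_plane w0 w1.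
Proof.
  intros H0 H1. exists 0. unfold in_half_plane.
  replace (- (Ci * 0))%C with (RtoC 0) by ring. rewrite Cexp_0.
  rewrite !Cmult_1_l. auto.
Qed.

(** * The iteration with principal roots and its limit *)

Definition agm_step (s : C * C) : C * C :=
  (((fst s + snd s) / 2)%C, (csqrt (fst s) * csqrt (snd s))%C).

Definition agm (s : C) (n : nat) : C * C := Nat.iter n agm_step (RtoC 1, s).

Lemma re_half (z : C) : Re (z / 2) = Re z / 2.
Proof.
  unfold Cdiv. rewrite <- RtoC_inv by lra. rewrite re_scal_r. reflexivity.
Qed.

Lemma Cmod_half (z : C) : Cmod (z / 2) = Cmod z / 2.
Proof.
  rewrite Cmod_div by (intros E; apply RtoC_inj in E; lra).
  rewrite Cmod_RtoC_pos; lra.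
Qed.

(* [{w | m <= Re w}] is convex in the coordinate [log w], so it is stable under
   geometric means. *)
Lemma re_geometric_mean (t0 t1 : C) (m : R) :
  0 < m -> 0 < Re t0 -> 0 < Re t1 ->
  m <= Re (t0 ^ 2) -> m <= Re (t1 ^ 2) -> m <= Re (t0 * t1).
Proof.
  intros Hm H0 H1. replace (t0 ^ 2)%C with (t0 * t0)%C by ring.
  replace (t1 ^ 2)%C with (t1 * t1)%C by ring. rewrite !re_mult.
  set (p0 := Re t0) in *. set (p1 := Re t1) in *. set (q0 := Im t0). set (q1 := Im t1).
  intros G0 G1.
  (* Cauchy-Schwarz as an identity: (q0^2 + m)(q1^2 + m) = (m + q0 q1)^2 + m (q0 - q1)^2. *)
  assert (Hx : (m + q0 * q1) ^ 2 <= (p0 * p1) ^ 2).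
  { assert ((q0 * q0 + m) * (q1 * q1 + m) <= (p0 * p0) * (p1 * p1))
      by (apply Rmult_le_compat; nra).
    assert (0 <= m * (q0 - q1) ^ 2) by (apply Rmult_le_pos; [lra | apply pow2_ge_0]). nra. }
  assert (0 < p0 * p1) by nra.
  assert (m + q0 * q1 <= p0 * p1) by nra. lra.
Qed.

Lemma agm_step_re (s : C * C) (m : R) :
  0 < m -> m <= Re (fst s) -> m <= Re (snd s) ->
  m <= Re (fst (agm_step s)) /\ m <= Re (snd (agm_step s)).
Proof.
  intros Hm H0 H1. unfold agm_step; cbn [fst snd].
  destruct (csqrt_spec (fst s)) as [E0 F0]; [lra|].
  destruct (csqrt_spec (snd s)) as [E1 F1]; [lra|].
  assert (X0 := Rabs_pos (Im (csqrt (fst s)))). assert (X1 := Rabs_pos (Im (csqrt (snd s)))).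
  split.
  - rewrite re_half, re_plus. lra.
  - apply re_geometric_mean; try lra; rewrite ?E0, ?E1; assumption.
Qed.

Lemma agm_step_good (s : C * C) :
  0 < Re (fst s) -> 0 < Re (snd s) -> good_step s (agm_step s).
Proof.
  destruct s as [s0 s1]. simpl. intros H0 H1.
  destruct (csqrt_spec s0 H0) as [E0 F0]. destruct (csqrt_spec s1 H1) as [E1 F1].
  split; [apply common_half_plane_right; assumption|].
  exists (csqrt s0), (csqrt s1). auto using common_quarter_plane_sector.
Qed.

Lemma acute_Cmod_minus_le (t0 t1 : C) : 0 < Re (t0 * Cconj t1) -> Cmod (t0 - t1) <= Cmod (t0 + t1).
Proof.
  rewrite re_mult, re_conj, im_conj. intros H.
  apply Rsqr_incr_0; try apply Cmod_ge_0. rewrite !Rsqr_pow2, !Cmod2_alt.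
  rewrite re_minus, im_minus, re_plus, im_plus. nra.
Qed.

(** The old gap is (t0 - t1)(t0 + t1) and the new one (t0 - t1)^2 / 2, so the factor 1/2 follows
    from |t0 - t1| <= |t0 + t1|, which is acuteness. The true rate is quadratic; the linear rate has
    the merit of an error bound that depends on the starting point through |1 - s| alone. *)
Lemma acute_step_contracts (s s' : C * C) : acute_step s s' ->
  Cmod (fst s' - snd s') <= Cmod (fst s - snd s) / 2.
Proof.
  intros (t0 & t1 & H0 & H1 & H2 & ->). rewrite <- H0, <- H1. cbn [fst snd].
  replace ((t0 ^ 2 + t1 ^ 2) / 2 - t0 * t1)%C with ((t0 - t1) * (t0 - t1) / 2)%C by field.
  replace (t0 ^ 2 - t1 ^ 2)%C with ((t0 - t1) * (t0 + t1))%C by ring.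
  rewrite Cmod_half, !Cmod_mult.
  assert (X := acute_Cmod_minus_le t0 t1 H2). assert (Y := Cmod_ge_0 (t0 - t1)). nra.
Qed.

Lemma agm_re (s : C) (m : R) (n : nat) : 0 < m <= 1 -> m <= Re s ->
  m <= Re (fst (agm s n)) /\ m <= Re (snd (agm s n)).
Proof.
  intros Hm Hs; induction n.
  - split; [simpl; lra | exact Hs].
  - change (agm s (S n)) with (agm_step (agm s n)). apply agm_step_re; tauto || lra.
Qed.

Lemma agm_good_step (s : C) (n : nat) : 0 < Re s -> good_step (agm s n) (agm s (S n)).
Proof.
  intros Hs. destruct (agm_re s (Rmin 1 (Re s)) n) as [H0 H1].
  - split; [apply Rmin_glb_lt; lra | apply Rmin_l].
  - apply Rmin_r.
  - assert (0 < Rmin 1 (Re s)) by (apply Rmin_glb_lt; lra).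
    apply agm_step_good; lra.
Qed.

Lemma agm_gap (s : C) (n : nat) : 0 < Re s ->
  Cmod (fst (agm s n) - snd (agm s n)) <= Cmod (1 - s) * (/ 2) ^ n.
Proof.
  intros Hs; induction n.
  - simpl. lra.
  - eapply Rle_trans; [apply acute_step_contracts, good_step_acute, agm_good_step, Hs|].
    simpl. lra.
Qed.

Lemma agm_bound (s : C) (M : R) (n : nat) : 0 < Re s -> 1 <= M -> Cmod s <= M ->
  Cmod (fst (agm s n)) <= M /\ Cmod (snd (agm s n)) <= M.
Proof.
  intros Hs HM HsM; induction n.
  - simpl. rewrite Cmod_1. auto.
  - assert (G := agm_good_step s n Hs).
    destruct (agm s n) as [a b].
    destruct G as (_ & t0 & t1 & H0 & H1 & _ & E).
    rewrite E. cbn [fst snd] in *.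
    split.
    + rewrite Cmod_half. assert (X := Cmod_triangle a b). lra.
    + rewrite <- H0, <- H1 in IHn. rewrite !Cmod_pow in IHn. rewrite Cmod_mult.
      destruct IHn. assert (0 <= (Cmod t0 - Cmod t1) ^ 2) by apply pow2_ge_0. nra.
Qed.

(** Each step moves the first entry by half the current gap. The factor [1 - (/ 2) ^ k] is the
    partial geometric sum, kept exact so that the induction closes. *)
Lemma agm_increment (s : C) (n k : nat) : 0 < Re s ->
  Cmod (fst (agm s (n + k)) - fst (agm s n)) <= Cmod (1 - s) * (/ 2) ^ n * (1 - (/ 2) ^ k).
Proof.
  intros Hs; induction k.
  - rewrite Nat.add_0_r. replace (fst (agm s n) - fst (agm s n))%C with (RtoC 0) by ring.
    rewrite Cmod_0. simpl. lra.
  - rewrite Nat.add_succ_r.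
    replace (fst (agm s (S (n + k))) - fst (agm s n))%C with
      ((fst (agm s (n + k)) - fst (agm s n))
       - (fst (agm s (n + k)) - snd (agm s (n + k))) / 2)%C.
    2: { change (agm s (S (n + k))) with (agm_step (agm s (n + k))). simpl.
         field. }
    eapply Rle_trans; [apply Cmod_triangle_minus|]. rewrite Cmod_half.
    assert (X := agm_gap s (n + k) Hs). rewrite pow_add in X. simpl. lra.
Qed.

(** Written as a telescoping series, so that the existence of the limit reduces to absolute
    convergence. *)
Definition agm_lim (s : C) : C := (1 + CSeries (fun n => fst (agm s (S n)) - fst (agm s n)))%C.

Lemma ex_series_half (c : R) : ex_series (fun n => c * (/ 2) ^ n).
Proof.
  apply (ex_series_scal_l (K := R_AbsRing) c (fun n => (/ 2) ^ n)).
  apply ex_series_geom. rewrite Rabs_pos_eq; lra.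
Qed.

Lemma is_lim_seq_half (c : R) : is_lim_seq (fun n => c * (/ 2) ^ n) 0.
Proof.
  apply is_lim_seq_scal_0, is_lim_seq_geom. rewrite Rabs_pos_eq; lra.
Qed.

Lemma agm_cv (s : C) : 0 < Re s -> Ccv (fun n => fst (agm s n)) (agm_lim s).
Proof.
  intros Hs. unfold agm_lim.
  apply Ccv_ext with (fun n => 1 + csum (fun k => fst (agm s (S k)) - fst (agm s k)) n)%C.
  - intros n. rewrite (csum_telescope (fun k => fst (agm s k))). simpl. ring.
  - apply Ccv_plus; [apply Ccv_const|].
    apply Ccv_csum_abs with (fun n => Cmod (1 - s) * (/ 2) ^ n); [|apply ex_series_half].
    intros n. assert (X := agm_increment s n 1 Hs). rewrite Nat.add_1_r in X.
    assert (0 <= Cmod (1 - s) * (/ 2) ^ n).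
    { apply Rmult_le_pos; [apply Cmod_ge_0 | apply pow_le; lra]. }
    simpl in X |- *. lra.
Qed.

Lemma agm_cv_snd (s : C) : 0 < Re s -> Ccv (fun n => snd (agm s n)) (agm_lim s).
Proof.
  intros Hs.
  apply Ccv_ext with (fun n => fst (agm s n) - (fst (agm s n) - snd (agm s n)))%C;
    [intros; ring|].
  replace (agm_lim s) with (agm_lim s - 0)%C by ring.
  apply Ccv_minus; [apply agm_cv, Hs|].
  apply Ccv_squeeze with (fun n => Cmod (1 - s) * (/ 2) ^ n); [|apply is_lim_seq_half].
  intros n. replace (fst (agm s n) - snd (agm s n) - 0)%C
    with (fst (agm s n) - snd (agm s n))%C by ring. apply agm_gap, Hs.
Qed.

Lemma agm_lim_error (s : C) (n : nat) : 0 < Re s ->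
  Cmod (fst (agm s n) - agm_lim s) <= Cmod (1 - s) * (/ 2) ^ n.
Proof.
  intros Hs. rewrite Cmod_minus_sym.
  apply Ccv_Cmod_le with (fun k => fst (agm s (k + n)) - fst (agm s n))%C.
  - intros k. rewrite Nat.add_comm. eapply Rle_trans; [apply agm_increment, Hs|].
    assert (0 <= Cmod (1 - s) * (/ 2) ^ n).
    { apply Rmult_le_pos; [apply Cmod_ge_0 | apply pow_le; lra]. }
    assert (0 <= (/ 2) ^ k) by (apply pow_le; lra). nra.
  - apply Ccv_minus; [|apply Ccv_const]. apply Ccv_incr_n with (u := fun n => fst (agm s n)).
    apply agm_cv, Hs.
Qed.

Lemma agm_lim_re (s : C) (m : R) : 0 < m <= 1 -> m <= Re s -> m <= Re (agm_lim s).
Proof.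
  intros Hm Hs.
  assert (H := Ccv_re _ _ (agm_cv s ltac:(lra))).
  refine (is_lim_seq_le (fun _ => m) _ m _ _ (is_lim_seq_const _) H).
  intros n. apply agm_re; assumption.
Qed.

Lemma agm_lim_bound (s : C) (M : R) : 0 < Re s -> 1 <= M -> Cmod s <= M -> Cmod (agm_lim s) <= M.
Proof.
  intros Hs HM HsM. apply Ccv_Cmod_le with (fun n => fst (agm s n)).
  - intros n. apply agm_bound; assumption.
  - apply agm_cv, Hs.
Qed.

Lemma agm_lim_neq_0 (s : C) : 0 < Re s -> agm_lim s <> 0%C.
Proof.
  intros Hs E. assert (H := agm_lim_re s (Rmin 1 (Re s))).
  assert (0 < Rmin 1 (Re s)) by (apply Rmin_glb_lt; lra).
  assert (Rmin 1 (Re s) <= Re s) by apply Rmin_r.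
  assert (Rmin 1 (Re s) <= 1) by apply Rmin_l.
  rewrite E in H. simpl in H. lra.
Qed.

Lemma agm_is_good_mean (s : C) : 0 < Re s -> is_good_mean 1 s (agm_lim s).
Proof.
  intros Hs. split; [apply common_half_plane_right; simpl; lra|].
  split; [apply agm_lim_neq_0, Hs|].
  split.
  - exists (agm s). split; [reflexivity|]. intros n; apply agm_good_step, Hs.
  - intros u [Hu0 Hu].
    assert (E : forall n, u n = agm s n).
    { apply acute_iterates_unique.
      - exact Hu0.
      - intros n; apply good_step_acute, Hu.
      - intros n; apply good_step_acute, agm_good_step, Hs. }
    split; apply Ccv_filterlim.
    + apply Ccv_ext with (fun n => fst (agm s n)); [intros n; rewrite E; reflexivity|].
      apply agm_cv, Hs.
    + apply Ccv_ext with (fun n => snd (agm s n)); [intros n; rewrite E; reflexivity|].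
      apply agm_cv_snd, Hs.
Qed.

Lemma good_mean_unique (s0 s1 mu nu : C) : is_good_mean s0 s1 mu -> is_good_mean s0 s1 nu -> mu = nu.
Proof.
  intros (_ & _ & [u Hu] & H) (_ & _ & _ & H').
  apply Ccv_unique with (fun n => fst (u n)); apply Ccv_filterlim; [apply H | apply H']; auto.
Qed.

Lemma good_mean_agm (s : C) : 0 < Re s -> good_mean 1 s = agm_lim s.
Proof.
  intros Hs. assert (H := agm_is_good_mean s Hs).
  apply good_mean_unique with (RtoC 1) s; auto.
  unfold good_mean. apply epsilon_spec. exists (agm_lim s). exact H.
Qed.

(** Only acuteness is asked of [u] because the theta iterates are divided by a complex constant
    [T ^ 2]. Dividing both roots by [T] multiplies [t0 * Cconj t1] by a positive real, whereas it
    could turn the roots out of a fixed sector around the positive axis. *)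
Lemma agm_lim_acute_iterates (s mu : C) (u : nat -> C * C) :
  0 < Re s -> u O = (RtoC 1, s) -> (forall n, acute_step (u n) (u (S n))) ->
  Ccv (fun n => fst (u n)) mu -> agm_lim s = mu.
Proof.
  intros Hs H0 Hu Hmu. apply Ccv_unique with (fun n => fst (agm s n)); [apply agm_cv, Hs|].
  apply Ccv_ext with (fun n => fst (u n)); auto.
  intros n. f_equal. apply acute_iterates_unique; auto.
  intros k; apply good_step_acute, agm_good_step, Hs.
Qed.

(** * Sums over the integers *)

(* The sum of [f] over the window [-p <= z < q]. *)
Definition zsum (f : Z -> C) (p q : nat) : C :=
  (csum (fun n => f (Z.of_nat n)) q + csum (fun n => f (- Z.of_nat (S n))%Z) p)%C.

(** The two ends of the window move independently. A shift of the summand or a split by parity then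
    only changes the window, and symmetric windows of any growth are special cases. *)
Definition is_zsum (f : Z -> C) (S : C) : Prop :=
  forall eps, 0 < eps -> exists N, forall p q, (N <= p)%nat -> (N <= q)%nat ->
    Cmod (zsum f p q - S) < eps.

Definition zsummable (g : Z -> R) : Prop :=
  ex_series (fun n => g (Z.of_nat n)) /\ ex_series (fun n => g (- Z.of_nat (S n))%Z).

Lemma is_zsum_intro (f : Z -> C) (A B : C) :
  Ccv (csum (fun n => f (Z.of_nat n))) A -> Ccv (csum (fun n => f (- Z.of_nat (S n))%Z)) B ->
  is_zsum f (A + B)%C.
Proof.
  intros HA HB eps He. assert (He2 : 0 < eps / 2) by lra.
  destruct (proj1 (Ccv_eps _ _) HA _ He2) as [N HN].
  destruct (proj1 (Ccv_eps _ _) HB _ He2) as [M HM].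
  exists (N + M)%nat. intros p q Hp Hq. unfold zsum.
  specialize (HN q ltac:(lia)). specialize (HM p ltac:(lia)).
  match goal with |- Cmod (?a + ?b - _) < _ =>
    replace (a + b - (A + B))%C with ((a - A) + (b - B))%C by ring end.
  eapply Rle_lt_trans; [apply Cmod_triangle | lra].
Qed.

Lemma is_zsum_cv (f : Z -> C) (S : C) (k l : nat -> nat) :
  (forall n, (n <= k n)%nat) -> (forall n, (n <= l n)%nat) ->
  is_zsum f S -> Ccv (fun n => zsum f (k n) (l n)) S.
Proof.
  intros Hk Hl H. apply Ccv_eps. intros eps He. destruct (H eps He) as [N HN].
  exists N. intros n Hn. apply HN; [specialize (Hk n) | specialize (Hl n)]; lia.
Qed.

Lemma is_zsum_unique (f : Z -> C) (S S' : C) : is_zsum f S -> is_zsum f S' -> S = S'.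
Proof.
  intros H H'. apply Ccv_unique with (fun n => zsum f n n);
  apply (is_zsum_cv f _ (fun n => n) (fun n => n)); auto.
Qed.

Lemma is_zsum_abs (f : Z -> C) (g : Z -> R) :
  (forall z, Cmod (f z) <= g z) -> zsummable g -> is_zsum f (ZSeries f).
Proof.
  intros H [H1 H2]. apply is_zsum_intro.
  - apply Ccv_csum_abs with (fun n => g (Z.of_nat n)); auto.
  - apply Ccv_csum_abs with (fun n => g (- Z.of_nat (S n))%Z); auto.
Qed.

Lemma zsum_ext (f g : Z -> C) (p q : nat) : (forall z, f z = g z) -> zsum f p q = zsum g p q.
Proof. intros H. unfold zsum. f_equal; apply csum_ext; auto. Qed.

Lemma is_zsum_ext (f g : Z -> C) (S : C) : (forall z, f z = g z) -> is_zsum f S -> is_zsum g S.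
Proof.
  intros H Hf eps He. destruct (Hf eps He) as [N HN]. exists N. intros p q Hp Hq.
  rewrite <- (zsum_ext f g) by auto. auto.
Qed.

Lemma is_zsum_scal (c : C) (f : Z -> C) (S : C) : is_zsum f S -> is_zsum (fun z => c * f z)%C (c * S)%C.
Proof.
  intros Hf eps He.
  assert (Hc := Cmod_ge_0 c).
  destruct (Hf (eps / (Cmod c + 1))) as [N HN]; [apply Rdiv_lt_0_compat; lra|].
  exists N. intros p q Hp Hq. specialize (HN p q Hp Hq).
  unfold zsum. rewrite !csum_scal, <- Cmult_plus_distr_l.
  change (Cmod (c * zsum f p q - c * S) < eps).
  replace (c * zsum f p q - c * S)%C with (c * (zsum f p q - S))%C by ring.
  rewrite Cmod_mult. set (x := Cmod (zsum f p q - S)) in *.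
  assert (0 <= x) by apply Cmod_ge_0.
  assert (x * (Cmod c + 1) < eps).
  { apply Rmult_lt_compat_r with (r := Cmod c + 1) in HN; [|lra].
    replace (eps / (Cmod c + 1) * (Cmod c + 1)) with eps in HN by (field; lra). exact HN. }
  nra.
Qed.

Lemma zsum_succ (f : Z -> C) (p q : nat) :
  zsum (fun z => f (z + 1)%Z) (S p) q = zsum f p (S q).
Proof.
  unfold zsum. rewrite (csum_split_first (fun n => f (Z.of_nat n))), csum_split_first.
  rewrite (csum_ext (fun n => f (Z.of_nat n + 1)%Z) (fun k => f (Z.of_nat (S k))));
    [|intros; f_equal; lia].
  rewrite (csum_ext (fun k => f (- Z.of_nat (S (S k)) + 1)%Z) (fun n => f (- Z.of_nat (S n))%Z));
    [|intros; f_equal; lia].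
  replace (- Z.of_nat 1 + 1)%Z with (Z.of_nat 0) by lia. ring.
Qed.

Lemma is_zsum_succ (f : Z -> C) (S : C) : is_zsum f S <-> is_zsum (fun z => f (z + 1)%Z) S.
Proof.
  split; intros H eps He; destruct (H eps He) as [N HN]; exists (Datatypes.S N); intros p q Hp Hq.
  - destruct p as [|p]; [lia|]. rewrite zsum_succ. apply HN; lia.
  - destruct q as [|q]; [lia|]. rewrite <- zsum_succ. apply HN; lia.
Qed.

Lemma is_zsum_shift (f : Z -> C) (S : C) (c : Z) :
  is_zsum f S -> is_zsum (fun z => f (z + c)%Z) S.
Proof.
  intros H. induction c using Z.peano_ind.
  - apply is_zsum_ext with f; auto. intros; f_equal; lia.
  - apply -> is_zsum_succ in IHc. revert IHc. apply is_zsum_ext. intros; f_equal; lia.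
  - apply is_zsum_succ. revert IHc. apply is_zsum_ext. intros; f_equal; lia.
Qed.

(** Exact because windows are half-open: the integers of [-2p, 2q) are the 2u and the 2u + 1 with u
    in [-p, q). On the negative side the roles of the two subsequences are exchanged, as -1 is
    odd. *)
Lemma zsum_even_odd (f : Z -> C) (p q : nat) :
  zsum f (2 * p) (2 * q) =
  (zsum (fun u => f (2 * u)%Z) p q + zsum (fun u => f (2 * u + 1)%Z) p q)%C.
Proof.
  assert (H : forall g : nat -> C, forall n,
    csum g (2 * n) = (csum (fun k => g (2 * k)%nat) n + csum (fun k => g (2 * k + 1)%nat) n)%C).
  { intros g n; induction n; [simpl; ring|].
    replace (2 * S n)%nat with (S (S (2 * n))) by lia. cbn [csum]. rewrite IHn.
    replace (2 * n + 1)%nat with (S (2 * n)) by lia. ring. }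
  unfold zsum. rewrite !H.
  rewrite (csum_ext (fun k => f (Z.of_nat (2 * k))) (fun n => f (2 * Z.of_nat n)%Z));
    [|intros; f_equal; lia].
  rewrite (csum_ext (fun k => f (Z.of_nat (2 * k + 1))) (fun n => f (2 * Z.of_nat n + 1)%Z));
    [|intros; f_equal; lia].
  rewrite (csum_ext (fun k => f (- Z.of_nat (S (2 * k)))%Z)
    (fun n => f (2 * - Z.of_nat (S n) + 1)%Z)); [|intros; f_equal; lia].
  rewrite (csum_ext (fun k => f (- Z.of_nat (S (2 * k + 1)))%Z)
    (fun n => f (2 * - Z.of_nat (S n))%Z)); [|intros; f_equal; lia].
  ring.
Qed.

Lemma is_zsum_even_odd (f : Z -> C) (S A B : C) :
  is_zsum f S -> is_zsum (fun u => f (2 * u)%Z) A -> is_zsum (fun u => f (2 * u + 1)%Z) B ->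
  S = (A + B)%C.
Proof.
  intros HS HA HB.
  apply Ccv_unique with (fun n => zsum f (2 * n) (2 * n)).
  - apply (is_zsum_cv f S (fun n => 2 * n)%nat (fun n => 2 * n)%nat); auto; intros; lia.
  - apply Ccv_ext with
      (fun n => zsum (fun u => f (2 * u)%Z) n n + zsum (fun u => f (2 * u + 1)%Z) n n)%C.
    + intros; symmetry; apply zsum_even_odd.
    + apply Ccv_plus; [apply (is_zsum_cv _ A (fun n => n) (fun n => n)) |
        apply (is_zsum_cv _ B (fun n => n) (fun n => n))]; auto.
Qed.

Lemma zsum_dominated (f : nat -> Z -> C) (l : Z -> C) (g : Z -> R) (p q : nat -> nat) :
  (forall N, (N <= p N)%nat) -> (forall N, (N <= q N)%nat) ->
  (forall N z, Cmod (f N z) <= g z) -> zsummable g ->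
  (forall z, Ccv (fun N => f N z) (l z)) ->
  Ccv (fun N => zsum (f N) (p N) (q N)) (ZSeries l).
Proof.
  intros Hp Hq Hf [H1 H2] Hl. apply Ccv_plus.
  - apply (csum_dominated (fun N n => f N (Z.of_nat n)) _ _ q) with (3 := H1); auto.
  - apply (csum_dominated (fun N n => f N (- Z.of_nat (S n))%Z) _ _ p) with (3 := H2); auto.
Qed.

Lemma zsum_switch (a : Z -> Z -> C) (p q p' q' : nat) :
  zsum (fun m => zsum (a m) p q) p' q' = zsum (fun u => zsum (fun m => a m u) p' q') p q.
Proof.
  unfold zsum. rewrite !csum_plus.
  rewrite (csum_switch (fun n k => a (Z.of_nat n) (Z.of_nat k))).
  rewrite (csum_switch (fun n k => a (Z.of_nat n) (- Z.of_nat (S k))%Z)).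
  rewrite (csum_switch (fun n k => a (- Z.of_nat (S n))%Z (Z.of_nat k))).
  rewrite (csum_switch (fun n k => a (- Z.of_nat (S n))%Z (- Z.of_nat (S k))%Z)).
  ring.
Qed.

Lemma zsummable_bound (G : Z -> R) : (forall z, 0 <= G z) -> zsummable G ->
  exists M, forall (f : Z -> C) c p q,
    (forall z, Cmod (f z) <= G z * c) -> 0 <= c -> Cmod (zsum f p q) <= M * c.
Proof.
  intros HG [H1 H2].
  exists (Series (fun n => G (Z.of_nat n)) + Series (fun n => G (- Z.of_nat (S n))%Z)).
  intros f c p q Hf Hc. unfold zsum. eapply Rle_trans; [apply Cmod_triangle|].
  assert (X : forall k n, ex_series (fun n => G (k n)) ->
    Cmod (csum (fun n => f (k n)) n) <= Series (fun n => G (k n)) * c).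
  { intros k n Hk. eapply Rle_trans; [apply Cmod_csum_le|].
    apply Rle_trans with (rsum (fun n => c * G (k n)) n).
    - apply rsum_le. intros i _. rewrite Rmult_comm. apply Hf.
    - rewrite rsum_scal, Rmult_comm. apply Rmult_le_compat_r; auto.
      apply (rsum_Series_bounds (fun n => G (k n))); auto. }
  assert (X1 := X Z.of_nat q H1).
  assert (X2 := X (fun n => - Z.of_nat (S n))%Z p H2). simpl in X2 |- *. lra.
Qed.

(** With a product majorant, both iterated sums are limits of the same N by N square sums: the inner
    partial sums over m are bounded by a multiple of [H u], so [zsum_dominated] passes to the limit
    in the outer sum. The auxiliary claim [X] is this half, applied once to [a] and once to its
    transpose. *)
Lemma zsum_fubini (a : Z -> Z -> C) (G H : Z -> R) (r c : Z -> C) (S1 S2 : C) :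
  (forall z, 0 <= G z) -> (forall z, 0 <= H z) -> zsummable G -> zsummable H ->
  (forall m u, Cmod (a m u) <= G m * H u) ->
  (forall u, is_zsum (fun m => a m u) (r u)) -> (forall m, is_zsum (a m) (c m)) ->
  is_zsum r S1 -> is_zsum c S2 -> S1 = S2.
Proof.
  intros HG HH HGs HHs Ha Hr Hc HS1 HS2.
  assert (X : forall (a : Z -> Z -> C) (G H : Z -> R) (r : Z -> C) (S1 : C),
    (forall z, 0 <= G z) -> (forall z, 0 <= H z) -> zsummable G -> zsummable H ->
    (forall m u, Cmod (a m u) <= G m * H u) ->
    (forall u, is_zsum (fun m => a m u) (r u)) -> is_zsum r S1 ->
    Ccv (fun N => zsum (fun u => zsum (fun m => a m u) N N) N N) S1).
  { clear. intros a G H r S1 HG HH HGs HHs Ha Hr HS1.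
    destruct (zsummable_bound G HG HGs) as [M HM].
    assert (Hb : forall N u, Cmod (zsum (fun m => a m u) N N) <= M * H u).
    { intros N u. apply HM; auto. }
    assert (Hs : zsummable (fun u => M * H u)).
    { destruct HHs; split; apply (ex_series_scal_l (K := R_AbsRing) M (fun n => H _)); auto. }
    assert (Hl : forall z, Ccv (fun N => zsum (fun m => a m z) N N) (r z)).
    { intros z. apply (is_zsum_cv _ _ (fun n => n) (fun n => n)); auto. }
    replace S1 with (ZSeries r).
    - apply (zsum_dominated _ _ (fun u => M * H u) (fun N => N) (fun N => N)); auto.
    - apply is_zsum_unique with r; auto. apply is_zsum_abs with (fun u => M * H u); auto.
      intros z. apply Ccv_Cmod_le with (fun N => zsum (fun m => a m z) N N); auto. }
  apply Ccv_unique with (fun N => zsum (fun u => zsum (fun m => a m u) N N) N N).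
  - apply X with G H r; auto.
  - apply Ccv_ext with (fun N => zsum (fun m => zsum (a m) N N) N N);
      [intros; apply zsum_switch|].
    apply (X (fun u m => a m u) H G c S2); auto.
    intros m u. rewrite Rmult_comm. apply Ha.
Qed.

(** * The theta null value as a function of the nome *)

Definition zsq (z : Z) : nat := Z.to_nat (z * z).

(** At Q = exp(i pi tau) this is theta_00(0, tau), and at -Q it is theta_01(0, tau), since m and m^2
    have the same parity. One function of the nome thus serves for both constants, with natural
    exponents. *)
Definition theta_null (Q : C) : C := ZSeries (fun z => Q ^ zsq z)%C.

Lemma zsq_spec (z : Z) : Z.of_nat (zsq z) = (z * z)%Z.
Proof. unfold zsq. nia. Qed.

Lemma pow_le_exponent (r : R) (n m : nat) : 0 <= r <= 1 -> (n <= m)%nat -> r ^ m <= r ^ n.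
Proof.
  intros Hr H; induction H; [lra|]. simpl.
  assert (0 <= r ^ m) by (apply pow_le; lra). nra.
Qed.

Lemma zsq_summable (r : R) : 0 <= r < 1 -> zsummable (fun z => r ^ zsq z).
Proof.
  intros Hr.
  assert (X : forall k : nat -> Z, (forall n, (n <= zsq (k n))%nat) ->
    ex_series (fun n => r ^ zsq (k n))).
  { intros k Hk. apply (ex_series_le (K := R_AbsRing) (V := R_CompleteNormedModule) _ (fun n => r ^ n)).
    - intros n. change (Rabs (r ^ zsq (k n)) <= r ^ n).
      rewrite Rabs_pos_eq by (apply pow_le; lra). apply pow_le_exponent; [lra|auto].
    - apply ex_series_geom. rewrite Rabs_pos_eq; lra. }
  split; apply X; intros n; unfold zsq; nia.
Qed.

Lemma is_zsum_pow_zsq (Q : C) (k : Z -> Z) : Cmod Q < 1 ->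
  (forall z, (z * z <= k z * k z)%Z) ->
  is_zsum (fun z => Q ^ zsq (k z))%C (ZSeries (fun z => Q ^ zsq (k z))%C).
Proof.
  intros HQ Hk. assert (H0 := Cmod_ge_0 Q).
  apply is_zsum_abs with (fun z => Cmod Q ^ zsq z); [|apply zsq_summable; lra].
  intros z. rewrite Cmod_pow. apply pow_le_exponent; [lra|].
  unfold zsq. apply Z2Nat.inj_le; [nia|nia|auto].
Qed.

Lemma is_zsum_theta_null (Q : C) : Cmod Q < 1 -> is_zsum (fun z => Q ^ zsq z)%C (theta_null Q).
Proof. intros HQ. apply (is_zsum_pow_zsq Q (fun z => z) HQ). intros; lia. Qed.

Lemma Cmod_pow_lt_1 (Q : C) (n : nat) : Cmod Q < 1 -> (0 < n)%nat -> Cmod (Q ^ n) < 1.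
Proof.
  intros HQ Hn. assert (H0 := Cmod_ge_0 Q). rewrite Cmod_pow.
  apply Rle_lt_trans with (Cmod Q ^ 1); [apply pow_le_exponent; [lra|lia]|]. simpl. lra.
Qed.

Lemma zsq_even (u : Z) : zsq (2 * u) = (4 * zsq u)%nat.
Proof. unfold zsq. nia. Qed.

Lemma Cpow_opp_1_even (n : nat) : ((- (1)) ^ (2 * n) = 1)%C.
Proof.
  rewrite Cpow_mult_r. replace ((- (1)) ^ 2)%C with (RtoC 1) by ring. apply Cpow_1_l.
Qed.

Lemma Cpow_opp_zsq_even (Q : C) (u : Z) : ((- Q) ^ zsq (2 * u) = Q ^ zsq (2 * u))%C.
Proof.
  replace (- Q)%C with (- (1) * Q)%C by ring. rewrite Cpow_mult_l, zsq_even.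
  replace (4 * zsq u)%nat with (2 * (2 * zsq u))%nat by lia. rewrite Cpow_opp_1_even. ring.
Qed.

Lemma Cpow_opp_zsq_odd (Q : C) (u : Z) : ((- Q) ^ zsq (2 * u + 1) = - (1) * Q ^ zsq (2 * u + 1))%C.
Proof.
  replace (- Q)%C with (- (1) * Q)%C by ring. rewrite Cpow_mult_l. f_equal.
  replace (zsq (2 * u + 1)) with (1 + 2 * (Z.to_nat (2 * u * u + 2 * u)))%nat
    by (unfold zsq; nia).
  rewrite Cpow_add_r, Cpow_opp_1_even. ring.
Qed.

(** This is theta_10 at the nome Q^4: the exponents 4 (u + 1/2)^2 are integers, so no fractional
    power of a nome is required. *)
Definition theta_odd (Q : C) : C := ZSeries (fun u => Q ^ zsq (2 * u + 1))%C.

Lemma theta_odd_sum (Q : C) : Cmod Q < 1 -> is_zsum (fun u => Q ^ zsq (2 * u + 1))%C (theta_odd Q).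
Proof. intros HQ. apply (is_zsum_pow_zsq Q (fun u => 2 * u + 1)%Z HQ).
  intros z. destruct (Z_le_gt_dec z (-1)); nia. Qed.

Lemma theta_even_sum (Q : C) : Cmod Q < 1 ->
  is_zsum (fun u => Q ^ zsq (2 * u))%C (theta_null (Q ^ 4)).
Proof.
  intros HQ. apply is_zsum_ext with (fun u => (Q ^ 4) ^ zsq u)%C.
  - intros u. rewrite zsq_even, Cpow_mult_r. reflexivity.
  - apply is_zsum_theta_null, Cmod_pow_lt_1; [assumption|lia].
Qed.

Lemma theta_null_split (Q : C) : Cmod Q < 1 ->
  theta_null Q = (theta_null (Q ^ 4) + theta_odd Q)%C /\
  theta_null (- Q) = (theta_null (Q ^ 4) - theta_odd Q)%C.
Proof.
  intros HQ. split.
  - apply (is_zsum_even_odd (fun z => Q ^ zsq z)%C);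
      auto using is_zsum_theta_null, theta_even_sum, theta_odd_sum.
  - replace (theta_null (Q ^ 4) - theta_odd Q)%C
      with (theta_null (Q ^ 4) + - (1) * theta_odd Q)%C by ring.
    apply (is_zsum_even_odd (fun z => (- Q) ^ zsq z)%C).
    + apply is_zsum_theta_null. rewrite Cmod_opp. assumption.
    + apply is_zsum_ext with (fun u => Q ^ zsq (2 * u))%C; [|apply theta_even_sum, HQ].
      intros; symmetry; apply Cpow_opp_zsq_even.
    + apply is_zsum_ext with (fun u => - (1) * Q ^ zsq (2 * u + 1))%C.
      * intros; symmetry; apply Cpow_opp_zsq_odd.
      * apply is_zsum_scal, theta_odd_sum, HQ.
Qed.

(* Sum [Q^(2u^2 + 2v^2)] over [(u, v)] and over [(m, u)] with [m = u + v]: since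
   [2u^2 + 2(m - u)^2 = m^2 + (2u - m)^2], the inner sum only depends on the parity of [m]. *)
Lemma theta_null_square (Q : C) : Cmod Q < 1 ->
  (theta_null (Q ^ 2) ^ 2 = theta_null (Q ^ 4) ^ 2 + theta_odd Q ^ 2)%C.
Proof.
  intros HQ. assert (H0 := Cmod_ge_0 Q).
  (* A product majorant in m and u with base |Q| fails, because 2u^2 + 2(m - u)^2 can be smaller
     than m^2 + u^2 (take m = 2, u = 1). Passing to the square root doubles the exponents on the
     left. *)
  set (rho := sqrt (Cmod Q)).
  assert (Hrho : 0 <= rho < 1).
  { split; [apply sqrt_pos|]. rewrite <- sqrt_1. apply sqrt_lt_1_alt. lra. }
  assert (Hrho2 : Cmod Q = rho ^ 2) by (unfold rho; rewrite pow2_sqrt; auto).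
  assert (HE := is_zsum_theta_null (Q ^ 2) (Cmod_pow_lt_1 Q 2 HQ ltac:(lia))).
  set (T := theta_null (Q ^ 2)) in *. set (E := theta_null (Q ^ 4)). set (O := theta_odd Q).
  set (p := fun z => ((Q ^ 2) ^ zsq z)%C) in HE.
  set (X := fun m => if Z.even m then E else O).
  assert (Ha : forall m u, (p u * p (m - u)%Z = Q ^ zsq m * Q ^ zsq (2 * u - m))%C).
  { intros m u. unfold p. rewrite <- !Cpow_mult_r, <- !Cpow_add_r. f_equal.
    apply Nat2Z.inj. rewrite !Nat2Z.inj_add, !Nat2Z.inj_mul, !zsq_spec. lia. }
  apply (zsum_fubini (fun m u => p u * p (m - u)%Z)%C (fun z => rho ^ zsq z) (fun z => rho ^ zsq z)
    (fun u => T * p u)%C (fun m => Q ^ zsq m * X m)%C).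
  - intros; apply pow_le; lra.
  - intros; apply pow_le; lra.
  - apply zsq_summable; auto.
  - apply zsq_summable; auto.
  - intros m u. rewrite Cmod_mult. unfold p. rewrite !Cmod_pow, Hrho2, <- !pow_mult, <- !pow_add.
    apply pow_le_exponent; [lra|]. apply Nat2Z.inj_le.
    rewrite !Nat2Z.inj_add, !Nat2Z.inj_mul, !zsq_spec. simpl Z.of_nat.
    (* 3 (4u^2 + 4(m - u)^2 - m^2 - u^2) = (3m - 4u)^2 + 5u^2. *)
    assert (0 <= (3 * m - 4 * u) * (3 * m - 4 * u))%Z by apply Z.square_nonneg.
    assert (0 <= u * u)%Z by apply Z.square_nonneg. lia.
  - intros u. rewrite Cmult_comm. apply is_zsum_scal.
    apply is_zsum_ext with (fun m => p (m + - u)%Z); [intros; f_equal; lia|].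
    apply (is_zsum_shift p), HE.
  - intros m.
    apply is_zsum_ext with (fun u => Q ^ zsq m * Q ^ zsq (2 * u - m))%C;
      [intros; symmetry; apply Ha|].
    apply is_zsum_scal. unfold X.
    destruct (Z.Even_or_Odd m) as [[c ->] | [c ->]].
    + rewrite Z.even_even.
      apply is_zsum_ext with (fun u => Q ^ zsq (2 * (u + - c)))%C;
        [intros; do 2 f_equal; lia|].
      apply (is_zsum_shift (fun u => Q ^ zsq (2 * u))%C), theta_even_sum, HQ.
    + rewrite Z.even_odd.
      apply is_zsum_ext with (fun u => Q ^ zsq (2 * (u + (- c - 1)) + 1))%C;
        [intros; do 2 f_equal; lia|].
      apply (is_zsum_shift (fun u => Q ^ zsq (2 * u + 1))%C), theta_odd_sum, HQ.
  - replace (T ^ 2)%C with (T * T)%C by ring. apply is_zsum_scal, HE.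
  - set (c := (fun m => Q ^ zsq m * X m)%C).
    assert (Hc : is_zsum c (ZSeries c)).
    { apply is_zsum_abs with (fun z => (Cmod E + Cmod O) * Cmod Q ^ zsq z).
      - intros z. unfold c. rewrite Cmod_mult, Cmod_pow, Rmult_comm.
        apply Rmult_le_compat_r; [apply pow_le; lra|].
        assert (A := Cmod_ge_0 E). assert (B := Cmod_ge_0 O).
        unfold X. destruct (Z.even z); lra.
      - destruct (zsq_summable (Cmod Q)) as [S1 S2]; [lra|].
        split; apply (ex_series_scal_l (K := R_AbsRing) (Cmod E + Cmod O)
          (fun n => Cmod Q ^ _)); assumption. }
    replace (E ^ 2 + O ^ 2)%C with (ZSeries c); [exact Hc|].
    apply (is_zsum_even_odd c); auto.
    + replace (E ^ 2)%C with (E * E)%C by ring.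
      apply is_zsum_ext with (fun u => E * Q ^ zsq (2 * u))%C.
      * intros u. unfold c, X. rewrite Z.even_even. ring.
      * apply is_zsum_scal, theta_even_sum, HQ.
    + replace (O ^ 2)%C with (O * O)%C by ring.
      apply is_zsum_ext with (fun u => O * Q ^ zsq (2 * u + 1))%C.
      * intros u. unfold c, X. rewrite Z.even_odd. ring.
      * apply is_zsum_scal, theta_odd_sum, HQ.
Qed.

Lemma theta_null_duplication (Q : C) : Cmod Q < 1 ->
  ((theta_null Q ^ 2 + theta_null (- Q) ^ 2) / 2 = theta_null (Q ^ 2) ^ 2)%C.
Proof.
  intros HQ. destruct (theta_null_split Q HQ) as [-> ->].
  rewrite (theta_null_square Q HQ). field.
Qed.

(** A second double sum is avoided. With E and O the even and odd parts at Q, the left side is E^2 -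
    O^2; duplication at Q^2 gives 2E^2 - theta(Q^2)^2 for the right side, and theta(Q^2)^2 = E^2 +
    O^2. *)
Lemma theta_null_duplication_product (Q : C) : Cmod Q < 1 ->
  (theta_null Q * theta_null (- Q) = theta_null (- Q ^ 2) ^ 2)%C.
Proof.
  intros HQ. assert (H2 := Cmod_pow_lt_1 Q 2 HQ ltac:(lia)).
  assert (D := theta_null_duplication _ H2). rewrite <- Cpow_mult_r in D. simpl Nat.mul in D.
  assert (E := theta_null_square Q HQ).
  destruct (theta_null_split Q HQ) as [-> ->].
  replace (theta_null (- Q ^ 2) ^ 2)%C with
    (2 * ((theta_null (Q ^ 2) ^ 2 + theta_null (- Q ^ 2) ^ 2) / 2) - theta_null (Q ^ 2) ^ 2)%C
    by field.
  rewrite D, E. ring.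
Qed.

(** * Complex-valued functions of real variables *)

(** Componentwise, because integrals and derivatives are taken on real and imaginary parts;
    [Ccont_eps] gives back the modulus form for functions on C. *)
Definition Ccont {U : UniformSpace} (f : U -> C) (u : U) : Prop :=
  continuous (fun u => Re (f u)) u /\ continuous (fun u => Im (f u)) u.

Lemma continuous_Rplus {U : UniformSpace} (f g : U -> R) (u : U) :
  continuous f u -> continuous g u -> continuous (fun u => f u + g u) u.
Proof. exact (continuous_plus (V := R_NormedModule) f g u). Qed.

Lemma continuous_Rminus {U : UniformSpace} (f g : U -> R) (u : U) :
  continuous f u -> continuous g u -> continuous (fun u => f u - g u) u.
Proof. exact (continuous_minus (V := R_NormedModule) f g u). Qed.

Lemma continuous_Rmult {U : UniformSpace} (f g : U -> R) (u : U) :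
  continuous f u -> continuous g u -> continuous (fun u => f u * g u) u.
Proof. exact (continuous_mult (K := R_AbsRing) f g u). Qed.

Lemma Ccont_ext {U : UniformSpace} (f g : U -> C) (u : U) :
  (forall u, f u = g u) -> Ccont f u -> Ccont g u.
Proof.
  intros H [H1 H2]; split; [revert H1 | revert H2]; apply continuous_ext;
    intros; rewrite H; reflexivity.
Qed.

Lemma Ccont_const {U : UniformSpace} (c : C) (u : U) : Ccont (fun _ => c) u.
Proof. split; apply continuous_const. Qed.

Lemma Ccont_RtoC {U : UniformSpace} (f : U -> R) (u : U) :
  continuous f u -> Ccont (fun u => RtoC (f u)) u.
Proof. intros H; split; [exact H | apply continuous_const]. Qed.

Lemma Ccont_plus {U : UniformSpace} (f g : U -> C) (u : U) :
  Ccont f u -> Ccont g u -> Ccont (fun u => f u + g u)%C u.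
Proof. intros [] []; split; apply continuous_Rplus; assumption. Qed.

Lemma Ccont_minus {U : UniformSpace} (f g : U -> C) (u : U) :
  Ccont f u -> Ccont g u -> Ccont (fun u => f u - g u)%C u.
Proof. intros [] []; split; apply continuous_Rminus; assumption. Qed.

Lemma Ccont_mult {U : UniformSpace} (f g : U -> C) (u : U) :
  Ccont f u -> Ccont g u -> Ccont (fun u => f u * g u)%C u.
Proof.
  intros [] []; split; [apply continuous_Rminus | apply continuous_Rplus];
    apply continuous_Rmult; assumption.
Qed.

Lemma Ccont_Cexp {U : UniformSpace} (f : U -> C) (u : U) :
  Ccont f u -> Ccont (fun u => Cexp (f u)) u.
Proof.
  intros [H1 H2]; split.
  - apply continuous_ext with (fun u => exp (Re (f u)) * cos (Im (f u)));
      [intros; symmetry; apply re_Cexp|].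
    apply continuous_Rmult; [apply (continuous_comp _ exp) | apply (continuous_comp _ cos)];
      auto using continuous_exp, continuous_cos.
  - apply continuous_ext with (fun u => exp (Re (f u)) * sin (Im (f u)));
      [intros; symmetry; apply im_Cexp|].
    apply continuous_Rmult; [apply (continuous_comp _ exp) | apply (continuous_comp _ sin)];
      auto using continuous_exp, continuous_sin.
Qed.

Lemma Ccont_csum {U : UniformSpace} (f : nat -> U -> C) (n : nat) (u : U) :
  (forall k, Ccont (f k) u) -> Ccont (fun u => csum (fun k => f k u) n) u.
Proof. intros H; induction n; [apply Ccont_const | apply Ccont_plus; auto]. Qed.

Lemma Ccont_locally {U : UniformSpace} (f : U -> C) (u : U) :
  Ccont f u <-> forall eps, 0 < eps -> locally u (fun v => Cmod (f v - f u) < eps).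
Proof.
  split.
  - intros [H1 H2] eps He. assert (He2 : 0 < eps / 2) by lra.
    apply filterlim_locally with (eps := mkposreal _ He2) in H1.
    apply filterlim_locally with (eps := mkposreal _ He2) in H2.
    generalize (filter_and _ _ H1 H2). apply filter_imp. intros v [A B].
    change (Rabs (Re (f v) - Re (f u)) < eps / 2) in A.
    change (Rabs (Im (f v) - Im (f u)) < eps / 2) in B.
    rewrite <- re_minus in A. rewrite <- im_minus in B.
    eapply Rle_lt_trans; [apply Cmod_le_re_im | lra].
  - intros X. split; apply filterlim_locally; intros eps; generalize (X eps (cond_pos eps));
      apply filter_imp; intros v Hv.
    + change (Rabs (Re (f v) - Re (f u)) < eps). rewrite <- re_minus.
      eapply Rle_lt_trans; [apply re_le_Cmod | exact Hv].
    + change (Rabs (Im (f v) - Im (f u)) < eps). rewrite <- im_minus.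
      eapply Rle_lt_trans; [apply im_le_Cmod | exact Hv].
Qed.

Lemma Ccont_eps (f : C -> C) (z : C) :
  Ccont f z <->
  forall eps, 0 < eps -> exists d, 0 < d /\ forall w, Cmod (w - z) < d -> Cmod (f w - f z) < eps.
Proof.
  rewrite Ccont_locally. split; intros H eps He.
  - destruct (H eps He) as [d Hd]. exists d. split; [apply cond_pos|]. intros w Hw.
    apply Hd, C_NormedModule_mixin_compat1, Hw.
  - destruct (H eps He) as (d & Hd & Hw). assert (Hd2 : 0 < d / 2) by lra.
    exists (mkposreal _ Hd2). intros w B. apply Hw.
    apply C_NormedModule_mixin_compat2 in B.
    change (Cmod (w - z) < sqrt 2 * (d / 2)) in B.
    assert (H2 := sqrt_2_le_2). nra.
Qed.

Lemma Ccont_comp {U : UniformSpace} (g : U -> C) (f : C -> C) (u : U) :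
  Ccont g u -> Ccont f (g u) -> Ccont (fun u => f (g u)) u.
Proof.
  intros Hg Hf. apply Ccont_locally. intros eps He.
  destruct (proj1 (Ccont_eps f _) Hf eps He) as (d & Hd & Hw).
  generalize (proj1 (Ccont_locally g u) Hg d Hd). apply filter_imp. intros v; apply Hw.
Qed.

(** * Derivatives of complex-valued functions of a real variable *)

Definition is_Cderive (f : R -> C) (t : R) (l : C) : Prop :=
  is_derive (fun t => Re (f t)) t (Re l) /\ is_derive (fun t => Im (f t)) t (Im l).

Lemma is_Cderive_eq (f : R -> C) (t : R) (l l' : C) : is_Cderive f t l -> l = l' -> is_Cderive f t l'.
Proof. intros H <-. exact H. Qed.

Lemma is_Cderive_ext (f g : R -> C) (t : R) (l : C) :
  (forall t, f t = g t) -> is_Cderive f t l -> is_Cderive g t l.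
Proof.
  intros H [H1 H2]; split; [revert H1 | revert H2]; apply is_derive_ext;
    intros; rewrite H; reflexivity.
Qed.

Lemma is_Cderive_const (c : C) (t : R) : is_Cderive (fun _ => c) t 0.
Proof. split; apply (is_derive_const (V := R_NormedModule)). Qed.

Lemma is_Cderive_id (t : R) : is_Cderive (fun t => RtoC t) t 1.
Proof.
  split; [apply (is_derive_id (K := R_AbsRing))|].
  exact (is_derive_const (K := R_AbsRing) (V := R_NormedModule) 0 t).
Qed.

Lemma is_Cderive_plus (f g : R -> C) (t : R) (l m : C) :
  is_Cderive f t l -> is_Cderive g t m -> is_Cderive (fun t => f t + g t)%C t (l + m)%C.
Proof. intros [] []; split; apply (is_derive_plus (V := R_NormedModule)); assumption. Qed.

Lemma is_derive_Rmult (f g : R -> R) (t l m : R) :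
  is_derive f t l -> is_derive g t m -> is_derive (fun t => f t * g t) t (l * g t + f t * m).
Proof. intros Hf Hg. apply (is_derive_mult f g t l m Hf Hg). intros; apply Rmult_comm. Qed.

Lemma is_Cderive_mult (f g : R -> C) (t : R) (l m : C) :
  is_Cderive f t l -> is_Cderive g t m ->
  is_Cderive (fun t => f t * g t)%C t (l * g t + f t * m)%C.
Proof.
  intros [H1 H2] [H3 H4]; split.
  - replace (Re (l * g t + f t * m)) with
      ((Re l * Re (g t) + Re (f t) * Re m) - (Im l * Im (g t) + Im (f t) * Im m))
      by (rewrite re_plus, !re_mult; ring).
    apply (is_derive_minus (V := R_NormedModule)); apply is_derive_Rmult; assumption.
  - replace (Im (l * g t + f t * m)) with
      ((Re l * Im (g t) + Re (f t) * Im m) + (Im l * Re (g t) + Im (f t) * Re m))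
      by (rewrite im_plus, !im_mult; ring).
    apply (is_derive_plus (V := R_NormedModule)); apply is_derive_Rmult; assumption.
Qed.

Lemma is_Cderive_Cexp (f : R -> C) (t : R) (l : C) :
  is_Cderive f t l -> is_Cderive (fun t => Cexp (f t)) t (l * Cexp (f t))%C.
Proof.
  intros [H1 H2].
  assert (X : forall (h h' g : R -> R) (g' : R), (forall y, is_derive h y (h' y)) ->
    is_derive g t g' -> is_derive (fun t => h (g t)) t (g' * h' (g t))).
  { intros h h' g g' Hh Hg. exact (is_derive_comp (V := R_NormedModule) h g t _ _ (Hh _) Hg). }
  assert (He := X exp exp _ _ is_derive_exp H1).
  assert (Hc := X cos (fun y => - sin y) _ _ is_derive_cos H2).
  assert (Hs := X sin cos _ _ is_derive_sin H2).
  split.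
  - apply is_derive_ext with (fun t => exp (Re (f t)) * cos (Im (f t)));
      [intros; symmetry; apply re_Cexp|].
    replace (Re (l * Cexp (f t))) with
      (Re l * exp (Re (f t)) * cos (Im (f t)) + exp (Re (f t)) * (Im l * - sin (Im (f t))))
      by (rewrite re_mult, re_Cexp, im_Cexp; ring).
    exact (is_derive_Rmult _ _ _ _ _ He Hc).
  - apply is_derive_ext with (fun t => exp (Re (f t)) * sin (Im (f t)));
      [intros; symmetry; apply im_Cexp|].
    replace (Im (l * Cexp (f t))) with
      (Re l * exp (Re (f t)) * sin (Im (f t)) + exp (Re (f t)) * (Im l * cos (Im (f t))))
      by (rewrite im_mult, re_Cexp, im_Cexp; ring).
    exact (is_derive_Rmult _ _ _ _ _ He Hs).
Qed.

Lemma is_Cderive_cont (f : R -> C) (t : R) (l : C) : is_Cderive f t l -> Ccont f t.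
Proof.
  intros [H1 H2]; split; apply (ex_derive_continuous (K := R_AbsRing) (V := R_NormedModule));
    eexists; eassumption.
Qed.

(** The factor 2 comes from applying the mean value theorem to the real and imaginary parts
    separately; [cint_bound] loses the same factor. Both serve for estimates that tend to 0 or that
    only have to be finite. *)
Lemma Cderive_increment_bound (f df : R -> C) (a b eta : R) :
  a <= b -> (forall t, a <= t <= b -> is_Cderive f t (df t)) ->
  (forall t, a <= t <= b -> Cmod (df t) <= eta) ->
  Cmod (f b - f a) <= 2 * eta * (b - a).
Proof.
  intros Hab Hd Hb.
  assert (X : forall p : C -> R, (forall z, Rabs (p z) <= Cmod z) ->
    (forall t, a <= t <= b -> is_derive (fun t => p (f t)) t (p (df t))) ->
    Rabs (p (f b) - p (f a)) <= eta * (b - a)).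
  { intros p Hp Hpd.
    destruct (MVT_gen (fun t => p (f t)) a b (fun t => p (df t))) as [c [Hc E]].
    - rewrite Rmin_left, Rmax_right by assumption. intros; apply Hpd; lra.
    - rewrite Rmin_left, Rmax_right by assumption. intros x Hx.
      apply continuity_pt_filterlim.
      apply (ex_derive_continuous (K := R_AbsRing) (V := R_NormedModule)).
      eexists; apply Hpd; assumption.
    - rewrite Rmin_left, Rmax_right in Hc by assumption.
      rewrite E, Rabs_mult, (Rabs_pos_eq (b - a)) by lra.
      apply Rmult_le_compat_r; [lra|]. eapply Rle_trans; [apply Hp | auto]. }
  assert (X1 := X Re re_le_Cmod (fun t Ht => proj1 (Hd t Ht))).
  assert (X2 := X Im im_le_Cmod (fun t Ht => proj2 (Hd t Ht))).
  rewrite <- re_minus in X1. rewrite <- im_minus in X2.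
  eapply Rle_trans; [apply Cmod_le_re_im | lra].
Qed.

(** * Integrals of complex-valued functions *)

Definition cint (f : R -> C) (a b : R) : C :=
  (RInt (fun x => Re (f x)) a b, RInt (fun x => Im (f x)) a b).

Lemma ex_RInt_cont (f : R -> R) (a b : R) : (forall x, continuous f x) -> ex_RInt f a b.
Proof. intros H. apply (ex_RInt_continuous (V := R_CompleteNormedModule)). auto. Qed.

Lemma ex_RInt_re (f : R -> C) (a b : R) : (forall x, Ccont f x) -> ex_RInt (fun x => Re (f x)) a b.
Proof. intros H. exact (ex_RInt_cont _ a b (fun x => proj1 (H x))). Qed.

Lemma ex_RInt_im (f : R -> C) (a b : R) : (forall x, Ccont f x) -> ex_RInt (fun x => Im (f x)) a b.
Proof. intros H. exact (ex_RInt_cont _ a b (fun x => proj2 (H x))). Qed.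

Lemma cint_ext (f g : R -> C) (a b : R) : (forall x, f x = g x) -> cint f a b = cint g a b.
Proof.
  intros H. unfold cint. f_equal; apply RInt_ext; intros x _; rewrite H; reflexivity.
Qed.

Lemma cint_plus (f g : R -> C) (a b : R) :
  (forall x, Ccont f x) -> (forall x, Ccont g x) ->
  cint (fun x => f x + g x)%C a b = (cint f a b + cint g a b)%C.
Proof.
  intros Hf Hg. apply C_eq.
  - exact (RInt_plus (V := R_CompleteNormedModule) _ _ a b (ex_RInt_re f a b Hf) (ex_RInt_re g a b Hg)).
  - exact (RInt_plus (V := R_CompleteNormedModule) _ _ a b (ex_RInt_im f a b Hf) (ex_RInt_im g a b Hg)).
Qed.

Lemma cint_scal (c : C) (f : R -> C) (a b : R) :
  (forall x, Ccont f x) -> cint (fun x => c * f x)%C a b = (c * cint f a b)%C.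
Proof.
  intros Hf.
  assert (Hr := ex_RInt_re f a b Hf). assert (Hi := ex_RInt_im f a b Hf).
  assert (S : forall (k : R) g, ex_RInt g a b -> ex_RInt (fun x => k * g x) a b)
    by (intros k g Hg; exact (ex_RInt_scal (V := R_NormedModule) g a b k Hg)).
  assert (E : forall (k : R) g, ex_RInt g a b -> RInt (fun x => k * g x) a b = k * RInt g a b)
    by (intros k g Hg; exact (RInt_scal (V := R_CompleteNormedModule) g a b k Hg)).
  apply C_eq.
  - rewrite re_mult. unfold cint; cbn [Re Im fst snd].
    rewrite <- !E by assumption.
    rewrite <- (RInt_minus (V := R_CompleteNormedModule)) by auto.
    apply RInt_ext; intros; rewrite re_mult; reflexivity.
  - rewrite im_mult. unfold cint; cbn [Re Im fst snd].
    rewrite <- !E by assumption.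
    rewrite <- (RInt_plus (V := R_CompleteNormedModule)) by auto.
    apply RInt_ext; intros; rewrite im_mult; reflexivity.
Qed.

Lemma cint_minus (f g : R -> C) (a b : R) :
  (forall x, Ccont f x) -> (forall x, Ccont g x) ->
  cint (fun x => f x - g x)%C a b = (cint f a b - cint g a b)%C.
Proof.
  intros Hf Hg.
  rewrite (cint_ext _ (fun x => f x + (- (1)) * g x)%C) by (intros; ring).
  rewrite cint_plus, cint_scal; auto; [ring|].
  intros; apply Ccont_mult; auto using Ccont_const.
Qed.

Lemma cint_csum (f : nat -> R -> C) (n : nat) (a b : R) :
  (forall k x, Ccont (f k) x) ->
  cint (fun x => csum (fun k => f k x) n) a b = csum (fun k => cint (f k) a b) n.
Proof.
  intros Hf; induction n; simpl.
  - apply C_eq; simpl; rewrite RInt_const; apply Rmult_0_r.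
  - rewrite cint_plus, IHn; auto. intros; apply Ccont_csum; auto.
Qed.

Lemma cint_FTC (F f : R -> C) (a b : R) :
  (forall x, is_Cderive F x (f x)) -> (forall x, Ccont f x) -> cint f a b = (F b - F a)%C.
Proof.
  intros HF Hf. apply C_eq; apply is_RInt_unique.
  - exact (is_RInt_derive (V := R_CompleteNormedModule) (fun x => Re (F x)) (fun x => Re (f x))
      a b (fun x _ => proj1 (HF x)) (fun x _ => proj1 (Hf x))).
  - exact (is_RInt_derive (V := R_CompleteNormedModule) (fun x => Im (F x)) (fun x => Im (f x))
      a b (fun x _ => proj2 (HF x)) (fun x _ => proj2 (Hf x))).
Qed.

Lemma cint_bound (f : R -> C) (g : R -> R) (a b : R) :
  a <= b -> (forall x, Ccont f x) -> (forall x, continuous g x) ->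
  (forall x, a <= x <= b -> Cmod (f x) <= g x) ->
  Cmod (cint f a b) <= 2 * RInt g a b.
Proof.
  intros Hab Hf Hg H.
  assert (X : forall p : C -> R, (forall z, Rabs (p z) <= Cmod z) ->
    (forall x, continuous (fun x => p (f x)) x) ->
    Rabs (RInt (fun x => p (f x)) a b) <= RInt g a b).
  { intros p Hp Hc.
    eapply Rle_trans; [apply abs_RInt_le; [assumption | apply ex_RInt_cont; assumption]|].
    apply RInt_le; [assumption | | apply ex_RInt_cont; assumption|].
    - apply ex_RInt_cont. intros x.
      apply (continuous_comp (fun x => p (f x)) Rabs); [apply Hc | apply continuous_Rabs].
    - intros x Hx. eapply Rle_trans; [apply Hp | apply H; lra]. }
  assert (X1 := X Re re_le_Cmod (fun x => proj1 (Hf x))).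
  assert (X2 := X Im im_le_Cmod (fun x => proj2 (Hf x))).
  eapply Rle_trans; [apply Cmod_le_re_im|]. simpl. lra.
Qed.

Lemma cint_bound_const (f : R -> C) (M a b : R) :
  a <= b -> (forall x, Ccont f x) -> (forall x, a <= x <= b -> Cmod (f x) <= M) ->
  Cmod (cint f a b) <= 2 * M * (b - a).
Proof.
  intros Hab Hf H. eapply Rle_trans.
  - apply cint_bound with (g := fun _ => M); auto. intros; apply continuous_const.
  - rewrite RInt_const. change (scal (b - a) M) with ((b - a) * M). lra.
Qed.

Lemma is_derive_RInt_parameter (f df : R -> R -> R) (a b t0 d : R) :
  0 < d ->
  (forall t x, Rabs (t - t0) < d -> is_derive (fun t => f t x) t (df t x)) ->
  (forall x, continuous (fun p : R * R => df (fst p) (snd p)) (t0, x)) ->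
  (forall t x, Rabs (t - t0) < d -> continuous (f t) x) ->
  is_derive (fun t => RInt (f t) a b) t0 (RInt (df t0) a b).
Proof.
  intros Hd H1 H2 H3.
  replace (RInt (df t0) a b) with (RInt (fun x => Derive (fun u => f u x) t0) a b).
  - apply (is_derive_RInt_param f a b t0).
    + exists (mkposreal d Hd). intros t Ht x _. exists (df t x). apply H1. exact Ht.
    + intros x _. apply continuity_2d_pt_ext_loc with df.
      * exists (mkposreal d Hd). intros u v Hu Hv. symmetry.
        apply is_derive_unique, H1. exact Hu.
      * apply continuity_2d_pt_filterlim.
        replace (Derive (fun z => f z x) t0) with (df t0 x).
        -- exact (H2 x).
        -- symmetry. apply is_derive_unique, H1. rewrite Rminus_diag, Rabs_R0. exact Hd.
    + exists (mkposreal d Hd). intros t Ht. apply ex_RInt_cont. intros; apply H3. exact Ht.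
  - apply RInt_ext. intros x _. apply is_derive_unique, H1. rewrite Rminus_diag, Rabs_R0. exact Hd.
Qed.

Lemma is_Cderive_cint (f df : R -> R -> C) (a b t0 d : R) :
  0 < d ->
  (forall t x, Rabs (t - t0) < d -> is_Cderive (fun t => f t x) t (df t x)) ->
  (forall x, Ccont (fun p : R * R => df (fst p) (snd p)) (t0, x)) ->
  (forall t x, Rabs (t - t0) < d -> Ccont (f t) x) ->
  is_Cderive (fun t => cint (f t) a b) t0 (cint (df t0) a b).
Proof.
  intros Hd H1 H2 H3; split.
  - exact (is_derive_RInt_parameter (fun t x => Re (f t x)) (fun t x => Re (df t x)) a b t0 d Hd
      (fun t x Ht => proj1 (H1 t x Ht)) (fun x => proj1 (H2 x)) (fun t x Ht => proj1 (H3 t x Ht))).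
  - exact (is_derive_RInt_parameter (fun t x => Im (f t x)) (fun t x => Im (df t x)) a b t0 d Hd
      (fun t x Ht => proj2 (H1 t x Ht)) (fun x => proj2 (H2 x)) (fun t x Ht => proj2 (H3 t x Ht))).
Qed.

Ltac ccont := intros; repeat match goal with
  | |- Ccont (fun _ => ?c) _ => apply (Ccont_const c)
  | |- Ccont (fun x => Cexp (@?f x)) _ => apply (Ccont_Cexp f)
  | |- Ccont (fun x => Cplus (@?f x) (@?g x)) _ => apply (Ccont_plus f g)
  | |- Ccont (fun x => Cminus (@?f x) (@?g x)) _ => apply (Ccont_minus f g)
  | |- Ccont (fun x => Cmult (@?f x) (@?g x)) _ => apply (Ccont_mult f g)
  | |- Ccont (fun x => RtoC (@?f x)) _ => apply (Ccont_RtoC f)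
  end; try apply continuous_id; try apply continuous_fst; try apply continuous_snd.

Ltac cderive := repeat match goal with
  | |- is_Cderive (fun _ => ?c) _ _ => apply (is_Cderive_const c)
  | |- is_Cderive (fun x => RtoC x) _ _ => apply is_Cderive_id
  | |- is_Cderive (fun x => Cexp (@?f x)) _ _ => apply (is_Cderive_Cexp f)
  | |- is_Cderive (fun x => Cplus (@?f x) (@?g x)) _ _ => apply (is_Cderive_plus f g)
  | |- is_Cderive (fun x => Cmult (@?f x) (@?g x)) _ _ => apply (is_Cderive_mult f g)
  | H : is_Cderive _ _ _ |- _ => exact H
  end.

(** * Fourier series at a point of differentiability *)

(* Makes [ring] recognise equalities stated in a Coquelicot structure over [R]. *)
Ltac Req := match goal with |- @eq _ ?a ?b => change (@eq R a b) end.

(** Continuity is confined to one period because the function [h] of [dirichlet_limit] has a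
    denominator that vanishes at the nonzero integers. *)
Definition pcont (f : R -> R) : Prop := forall x, - / 2 <= x <= / 2 -> continuous f x.

Definition inner (f g : R -> R) : R := RInt (fun x => f x * g x) (- / 2) (/ 2).

Lemma ex_RInt_pcont (f : R -> R) : pcont f -> ex_RInt f (- / 2) (/ 2).
Proof.
  intros H. apply (ex_RInt_continuous (V := R_CompleteNormedModule)).
  rewrite Rmin_left, Rmax_right by lra. exact H.
Qed.

Lemma pcont_mult (f g : R -> R) : pcont f -> pcont g -> pcont (fun x => f x * g x).
Proof. intros Hf Hg x Hx. apply continuous_Rmult; auto. Qed.

Lemma pcont_minus (f g : R -> R) : pcont f -> pcont g -> pcont (fun x => f x - g x).
Proof. intros Hf Hg x Hx. apply continuous_Rminus; auto. Qed.

Lemma pcont_scal (c : R) (f : R -> R) : pcont f -> pcont (fun x => c * f x).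
Proof. intros Hf. apply pcont_mult; auto. intros x _; apply continuous_const. Qed.

Lemma inner_comm (f g : R -> R) : inner f g = inner g f.
Proof. apply RInt_ext; intros; apply Rmult_comm. Qed.

Lemma inner_minus_scal (f g h : R -> R) (c : R) : pcont f -> pcont g -> pcont h ->
  inner (fun x => f x - c * g x) h = inner f h - c * inner g h.
Proof.
  intros Hf Hg Hh. unfold inner.
  assert (E1 := ex_RInt_pcont _ (pcont_mult f h Hf Hh)).
  assert (E2 := ex_RInt_pcont _ (pcont_mult g h Hg Hh)).
  apply is_RInt_unique. apply is_RInt_ext with (fun x => f x * h x - c * (g x * h x));
    [intros x _; Req; ring|].
  apply (is_RInt_minus (V := R_NormedModule));
    [|apply (is_RInt_scal (V := R_NormedModule))];
    apply (RInt_correct (V := R_CompleteNormedModule)); assumption.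
Qed.

(** The numerators of the Dirichlet kernels. They are orthogonal on [-1/2, 1/2], so Bessel's
    inequality does the work of the Riemann-Lebesgue lemma for them. *)
Definition odd_sine (n : nat) (x : R) : R := sin ((2 * INR n + 1) * (PI * x)).

Lemma pcont_odd_sine (n : nat) : pcont (odd_sine n).
Proof.
  intros x _. unfold odd_sine.
  apply (continuous_comp (fun x => (2 * INR n + 1) * (PI * x)) sin); [|apply continuous_sin].
  apply (ex_derive_continuous (K := R_AbsRing) (V := R_NormedModule)). auto_derive. exact I.
Qed.

Lemma is_RInt_const_unit (c : R) : is_RInt (fun _ => c) (- / 2) (/ 2) c.
Proof.
  assert (H := is_RInt_const (V := R_NormedModule) (- / 2) (/ 2) c).
  refine (eq_ind _ (fun l : R => is_RInt (fun _ : R => c) (- / 2) (/ 2) l) H c _).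
  change ((/ 2 - - / 2) * c = c). field.
Qed.

Lemma RInt_cos_even (k : Z) : k <> 0%Z ->
  is_RInt (fun x => cos (2 * IZR k * (PI * x))) (- / 2) (/ 2) 0.
Proof.
  intros Hk. assert (Hpi := PI_RGT_0). assert (Hk' := not_0_IZR k Hk).
  replace 0 with (minus (sin (2 * IZR k * (PI * / 2)) / (2 * IZR k * PI))
    (sin (2 * IZR k * (PI * - / 2)) / (2 * IZR k * PI))).
  - apply (is_RInt_derive (V := R_CompleteNormedModule)
      (fun x => sin (2 * IZR k * (PI * x)) / (2 * IZR k * PI))).
    + intros x _. auto_derive; [exact I|]. field. lra.
    + intros x _. apply (ex_derive_continuous (K := R_AbsRing) (V := R_NormedModule)).
      auto_derive. exact I.
  - replace (2 * IZR k * (PI * / 2)) with (IZR k * PI) by field.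
    replace (2 * IZR k * (PI * - / 2)) with (IZR (- k) * PI) by (rewrite opp_IZR; field).
    rewrite !sin_eq_0_1 by (eexists; reflexivity).
    change (0 / (2 * IZR k * PI) - 0 / (2 * IZR k * PI) = 0). field. lra.
Qed.

Lemma inner_odd_sine (n m : nat) :
  inner (odd_sine n) (odd_sine m) = if Nat.eqb n m then / 2 else 0.
Proof.
  assert (E : forall x, odd_sine n x * odd_sine m x =
    / 2 * (cos (2 * IZR (Z.of_nat n - Z.of_nat m) * (PI * x))
           - cos (2 * IZR (Z.of_nat n + Z.of_nat m + 1) * (PI * x)))).
  { intros x. unfold odd_sine. rewrite minus_IZR, !plus_IZR, <- !INR_IZR_INZ.
    replace (2 * (INR n - INR m) * (PI * x)) with
      ((2 * INR n + 1) * (PI * x) - (2 * INR m + 1) * (PI * x)) by ring.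
    replace (2 * (INR n + INR m + 1) * (PI * x)) with
      ((2 * INR n + 1) * (PI * x) + (2 * INR m + 1) * (PI * x)) by ring.
    rewrite cos_minus, cos_plus. field. }
  unfold inner. rewrite (RInt_ext _ _ _ _ (fun x _ => E x)).
  apply is_RInt_unique.
  assert (H2 := RInt_cos_even (Z.of_nat n + Z.of_nat m + 1) ltac:(lia)).
  assert (X : forall l v : R, is_RInt (fun x => cos (2 * IZR (Z.of_nat n - Z.of_nat m) * (PI * x)))
    (- / 2) (/ 2) l -> v = / 2 * (l - 0) ->
    is_RInt (fun x => / 2 * (cos (2 * IZR (Z.of_nat n - Z.of_nat m) * (PI * x))
      - cos (2 * IZR (Z.of_nat n + Z.of_nat m + 1) * (PI * x)))) (- / 2) (/ 2) v).
  { intros l v Hl ->. apply (is_RInt_scal (V := R_NormedModule)).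
    apply (is_RInt_minus (V := R_NormedModule)); assumption. }
  destruct (Nat.eqb_spec n m) as [<- | Hne].
  - refine (X 1 (/ 2) _ _); [|ring].
    apply is_RInt_ext with (fun _ => 1).
    + intros x _. rewrite Z.sub_diag, Rmult_0_r, Rmult_0_l, cos_0. reflexivity.
    + apply is_RInt_const_unit.
  - refine (X 0 0 _ _); [apply RInt_cos_even; lia | ring].
Qed.

(* Bessel's inequality for the orthogonal system [odd_sine]. *)
Lemma inner_odd_sine_vanishes (h : R -> R) : pcont h ->
  is_lim_seq (fun n => inner h (odd_sine n)) 0.
Proof.
  intros Hh. set (b := fun n => inner h (odd_sine n)).
  (* [r n] is [h] minus its projection on the first n modes; the factor 2 is the inverse of their
     squared norm. *)
  set (r := fix r n := match n with O => h | S k => fun x => r k x - 2 * b k * odd_sine k x end).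
  assert (Hr : forall n, pcont (r n)).
  { induction n; [exact Hh|]. apply pcont_minus; [assumption|].
    apply pcont_scal, pcont_odd_sine. }
  assert (Hrs : forall n m, (n <= m)%nat -> inner (r n) (odd_sine m) = b m).
  { induction n; intros m Hm; [reflexivity|].
    simpl. rewrite inner_minus_scal by auto using pcont_odd_sine.
    rewrite IHn by lia. rewrite inner_odd_sine.
    destruct (Nat.eqb_spec n m); [lia|]. ring. }
  assert (HE : forall n, inner (r (S n)) (r (S n)) = inner (r n) (r n) - 2 * (b n * b n)).
  { intros n. simpl r at 1. rewrite inner_minus_scal by auto using pcont_odd_sine.
    rewrite (inner_comm (r n)), (inner_comm (odd_sine n)). simpl r.
    rewrite !inner_minus_scal by auto using pcont_odd_sine.
    rewrite (inner_comm (odd_sine n) (r n)), Hrs by lia. rewrite inner_odd_sine, Nat.eqb_refl. field. }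
  assert (Hpos : forall n, 0 <= inner (r n) (r n)).
  { intros n. apply RInt_ge_0; [lra | apply ex_RInt_pcont, pcont_mult; auto|].
    intros x _. nra. }
  assert (Hsum : forall n, rsum (fun k => b k * b k) n <= inner h h / 2).
  { intros n. assert (X : inner (r n) (r n) = inner h h - 2 * rsum (fun k => b k * b k) n).
    { induction n; [simpl; ring|]. rewrite HE, IHn. cbn [rsum]. ring. }
    specialize (Hpos n). lra. }
  assert (Hex : ex_series (fun k => b k * b k)).
  { destruct (ex_finite_lim_seq_incr (rsum (fun k => b k * b k)) (inner h h / 2)) as [l Hl].
    - intros n. simpl. nra.
    - exact Hsum.
    - exists l. apply is_series_rsum. exact Hl. }
  apply ex_series_lim_0 in Hex.
  apply is_lim_seq_spec. apply is_lim_seq_spec in Hex. intros [eps He].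
  assert (He2 : 0 < eps * eps) by nra.
  destruct (Hex (mkposreal _ He2)) as [N HN]. exists N. intros n Hn.
  specialize (HN n Hn). simpl in HN |- *. rewrite Rminus_0_r in HN |- *.
  rewrite Rabs_pos_eq in HN by nra. apply Rabs_def1; nra.
Qed.

Definition slope0 (f : R -> R) (x : R) : R :=
  if excluded_middle_informative (x = 0) then Derive f 0 else (f x - f 0) / x.

Lemma slope0_0 (f : R -> R) : slope0 f 0 = Derive f 0.
Proof. unfold slope0. destruct (excluded_middle_informative (0 = 0)); [reflexivity | contradiction]. Qed.

Lemma slope0_neq (f : R -> R) (x : R) : x <> 0 -> slope0 f x = (f x - f 0) / x.
Proof.
  intros H. unfold slope0.
  destruct (excluded_middle_informative (x = 0)); [contradiction | reflexivity].
Qed.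

Lemma slope0_mult (f : R -> R) (x : R) : slope0 f x * x = f x - f 0.
Proof.
  unfold slope0. destruct (excluded_middle_informative (x = 0)) as [-> | H]; [ring | field; exact H].
Qed.

Lemma continuous_slope0 (f : R -> R) (x : R) :
  ex_derive f 0 -> continuous f x -> continuous (slope0 f) x.
Proof.
  intros Hd Hc. destruct (excluded_middle_informative (x = 0)) as [-> | H].
  - apply Derive_correct, is_derive_Reals in Hd.
    apply filterlim_locally. intros eps.
    destruct (Hd eps (cond_pos eps)) as [d Hd']. exists d. intros y Hy.
    change (Rabs (y - 0) < d) in Hy. rewrite Rminus_0_r in Hy.
    change (Rabs (slope0 f y - slope0 f 0) < eps).
    destruct (excluded_middle_informative (y = 0)) as [-> | Hy0].
    + rewrite Rminus_diag, Rabs_R0. apply cond_pos.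
    + specialize (Hd' y Hy0 Hy). rewrite Rplus_0_l in Hd'.
      rewrite slope0_0, slope0_neq by exact Hy0. exact Hd'.
  - apply continuous_ext_loc with (fun y => (f y - f 0) * / y).
    + exists (mkposreal _ (Rabs_pos_lt x H)). intros y Hy.
      change (Rabs (y - x) < Rabs x) in Hy.
      symmetry. apply slope0_neq. intros E. rewrite E, Rminus_0_l, Rabs_Ropp in Hy. lra.
    + apply continuous_Rmult.
      * apply continuous_Rminus; [exact Hc | apply continuous_const].
      * apply continuous_Rinv. exact H.
Qed.

Definition dirichlet (N : nat) (x : R) : R :=
  1 + 2 * rsum (fun k => cos (2 * IZR (Z.of_nat (S k)) * (PI * x))) N.

Lemma dirichlet_sin (N : nat) (x : R) : dirichlet N x * sin (PI * x) = odd_sine N x.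
Proof.
  unfold dirichlet, odd_sine. induction N.
  - simpl. replace ((2 * 0 + 1) * (PI * x)) with (PI * x) by ring. ring.
  - cbn [rsum]. rewrite Rmult_plus_distr_l, <- Rplus_assoc, Rmult_plus_distr_r, IHN.
    rewrite <- INR_IZR_INZ, S_INR.
    replace ((2 * INR N + 1) * (PI * x)) with (2 * (INR N + 1) * (PI * x) - PI * x) by ring.
    replace ((2 * (INR N + 1) + 1) * (PI * x)) with (2 * (INR N + 1) * (PI * x) + PI * x) by ring.
    rewrite sin_minus, sin_plus. ring.
Qed.

Lemma RInt_dirichlet (N : nat) : is_RInt (dirichlet N) (- / 2) (/ 2) 1.
Proof.
  replace 1 with (1 + 2 * 0) by ring.
  apply (is_RInt_plus (V := R_NormedModule)).
  - apply is_RInt_const_unit.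
  - apply (is_RInt_scal (V := R_NormedModule)). induction N.
    + apply is_RInt_const_unit.
    + simpl rsum. replace 0 with (0 + 0) by ring. apply (is_RInt_plus (V := R_NormedModule)).
      * exact IHN.
      * apply RInt_cos_even. lia.
Qed.

(** Write phi(x) = phi(0) + x * slope. The constant contributes phi(0), as the kernel has integral
    1. In the rest the kernel's denominator sin(pi x) is divided by x as well, which leaves the
    continuous function [h] against [odd_sine N]. Differentiability at 0 is what makes [h]
    continuous there. *)
Lemma dirichlet_limit (phi : R -> R) : (forall x, continuous phi x) -> ex_derive phi 0 ->
  is_lim_seq (fun N => RInt (fun x => phi x * dirichlet N x) (- / 2) (/ 2)) (phi 0).
Proof.
  intros Hc Hd. assert (Hpi := PI_RGT_0).
  set (s := fun x => sin (PI * x)).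
  set (h := fun x => slope0 phi x * / slope0 s x).
  assert (Hs' : ex_derive s 0) by (unfold s; auto_derive; exact I).
  assert (Hs0 : s 0 = 0) by (unfold s; rewrite Rmult_0_r; apply sin_0).
  assert (Hsl : forall x, - / 2 <= x <= / 2 -> slope0 s x <> 0).
  { intros x Hx. unfold slope0. destruct (excluded_middle_informative (x = 0)) as [-> | H].
    - replace (Derive s 0) with PI; [lra|]. symmetry. apply is_derive_unique.
      unfold s. auto_derive; [exact I|]. rewrite Rmult_0_r, cos_0. ring.
    - rewrite Hs0, Rminus_0_r. unfold s. intros E.
      assert (sin (PI * x) <> 0).
      { destruct (Rtotal_order x 0) as [Hn | [|Hp]]; [|contradiction|].
        - assert (0 < sin (- (PI * x))) by (apply sin_gt_0; nra). rewrite sin_neg in *. lra.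
        - assert (0 < sin (PI * x)) by (apply sin_gt_0; nra). lra. }
      apply H0. replace (sin (PI * x)) with (sin (PI * x) / x * x) by (field; exact H).
      rewrite E. ring. }
  assert (Hh : pcont h).
  { intros x Hx. apply continuous_Rmult; [apply continuous_slope0; auto|].
    apply (continuous_comp (slope0 s) Rinv); [|apply continuous_Rinv; auto].
    apply continuous_slope0; auto.
    apply (ex_derive_continuous (K := R_AbsRing) (V := R_NormedModule)).
    unfold s. auto_derive. exact I. }
  assert (E : forall N, RInt (fun x => phi x * dirichlet N x) (- / 2) (/ 2) =
    phi 0 * 1 + inner h (odd_sine N)).
  { intros N. unfold inner.
    apply is_RInt_unique.
    apply is_RInt_ext with (fun x => phi 0 * dirichlet N x + h x * odd_sine N x).
    - rewrite Rmin_left, Rmax_right by lra. intros x Hx.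
      rewrite <- dirichlet_sin. change (sin (PI * x)) with (s x).
      replace (s x) with (slope0 s x * x) by (rewrite slope0_mult, Hs0; ring).
      replace (phi x) with (phi 0 + slope0 phi x * x) by (rewrite slope0_mult; ring).
      unfold h. Req. field. apply Hsl; lra.
    - apply (is_RInt_plus (V := R_NormedModule)).
      + apply (is_RInt_scal (V := R_NormedModule)), RInt_dirichlet.
      + apply (RInt_correct (V := R_CompleteNormedModule)), ex_RInt_pcont, pcont_mult;
          auto using pcont_odd_sine. }
  apply is_lim_seq_ext with (fun N => phi 0 * 1 + inner h (odd_sine N)); [intros; symmetry; apply E|].
  replace (Finite (phi 0)) with (Finite (phi 0 * 1 + 0)) by (f_equal; ring).
  apply is_lim_seq_plus'; [apply is_lim_seq_const|].
  apply inner_odd_sine_vanishes, Hh.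
Qed.

(** * Gaussian integrals and Poisson summation *)

(** Throughout, [a] stands for -i tau: the upper half plane becomes Re a > 0, and tau -> -1/tau
    becomes a -> 1/a. *)
Definition gau (a : C) (xi x : R) : C :=
  Cexp (- (RtoC PI * a) * (RtoC x * RtoC x) + 2 * Ci * RtoC PI * RtoC xi * RtoC x).

Definition gint (a : C) (xi L : R) : C := cint (gau a xi) (- L) L.

(** With this end point the interval is a union of unit periods centred at -M, ..., M, and a mode of
    integer frequency takes the same value at both ends. *)
Definition half_odd (M : nat) : R := INR M + / 2.

Lemma Ccont_gau (a : C) (xi x : R) : Ccont (gau a xi) x.
Proof. unfold gau. ccont. Qed.

Lemma re_gau_exponent (a : C) (xi x : R) :
  Re (- (RtoC PI * a) * (RtoC x * RtoC x) + 2 * Ci * RtoC PI * RtoC xi * RtoC x)%C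
  = - (PI * Re a * (x * x)).
Proof. destruct a as [u v]. simpl. ring. Qed.

Lemma Cmod_gau (a : C) (xi x : R) : Cmod (gau a xi x) = exp (- (PI * Re a * (x * x))).
Proof. unfold gau. rewrite Cmod_Cexp, re_gau_exponent. reflexivity. Qed.

(** One factor 1/(1 + x^2) is integrable through arctan; the other absorbs a polynomial factor or
    gives decay at the end points. It is got by squaring m (1 + x^2) <= exp of half the exponent.
    Uniformity in v >= u is for [gint_mass], where the width varies along a segment. *)
Lemma gaussian_decay (u : R) : 0 < u ->
  exists K, 0 < K /\ forall v x, u <= v ->
    exp (- (PI * v * (x * x))) <= K * / (1 + x * x) * / (1 + x * x).
Proof.
  intros Hu. assert (Hpi := PI_RGT_0).
  set (m := Rmin 1 (PI * u / 2)).
  assert (Hm : 0 < m).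
  { apply Rmin_glb_lt; [lra|]. assert (0 < PI * u) by nra. lra. }
  assert (Hm1 : m <= 1) by apply Rmin_l.
  assert (Hm2 : m <= PI * u / 2) by apply Rmin_r.
  exists (/ m * / m). split; [assert (0 < / m) by (apply Rinv_0_lt_compat; lra); nra|].
  intros v x Hv. assert (Hx : 0 <= x * x) by nra.
  assert (H1 : m * (1 + x * x) <= exp (PI * v * (x * x) / 2)).
  { apply Rle_trans with (1 + PI * v * (x * x) / 2).
    - assert (PI * u * (x * x) <= PI * v * (x * x)).
      { apply Rmult_le_compat_r; [assumption|]. apply Rmult_le_compat_l; lra. }
      assert (m * (x * x) <= PI * u / 2 * (x * x)) by (apply Rmult_le_compat_r; assumption). lra.
    - destruct (Req_dec (PI * v * (x * x) / 2) 0) as [E | E].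
      + rewrite E, exp_0. lra.
      + left. apply exp_ineq1. exact E. }
  replace (- (PI * v * (x * x))) with (- (PI * v * (x * x) / 2) + - (PI * v * (x * x) / 2)) by field.
  rewrite exp_plus, exp_Ropp.
  assert (H2 : / exp (PI * v * (x * x) / 2) <= / m * / (1 + x * x)).
  { rewrite <- Rinv_mult. apply Rinv_le_contravar; [nra | exact H1]. }
  assert (0 < / exp (PI * v * (x * x) / 2)) by (apply Rinv_0_lt_compat, exp_pos).
  apply Rle_trans with ((/ m * / (1 + x * x)) * (/ m * / (1 + x * x))); [nra|].
  right; ring.
Qed.

Lemma is_Cderive_gau (a : C) (xi x : R) :
  is_Cderive (gau a xi) x
    ((- (2 * RtoC PI * a) * RtoC x + 2 * Ci * RtoC PI * RtoC xi) * gau a xi x)%C.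
Proof.
  unfold gau. eapply is_Cderive_eq; [cderive | ring].
Qed.

Lemma RInt_arctan_bound (K L : R) : 0 <= K ->
  RInt (fun x => K * / (1 + x * x)) (- L) L <= K * PI.
Proof.
  intros HK.
  assert (H : is_RInt (fun x => / (1 + x * x)) (- L) L (minus (atan L) (atan (- L)))).
  { apply (is_RInt_derive (V := R_CompleteNormedModule)).
    - intros x _. replace (/ (1 + x * x)) with (/ (1 + x ^ 2)) by (f_equal; ring).
      apply is_derive_Reals. apply derivable_pt_lim_atan.
    - intros x _. apply (ex_derive_continuous (K := R_AbsRing) (V := R_NormedModule)).
      auto_derive. nra. }
  assert (E : RInt (fun x => K * / (1 + x * x)) (- L) L = K * (atan L - atan (- L))).
  { apply is_RInt_unique. apply (is_RInt_scal (V := R_NormedModule)). exact H. }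
  rewrite E. apply Rmult_le_compat_l; [assumption|].
  assert (H1 := atan_bound L). assert (H2 := atan_bound (- L)). lra.
Qed.

Lemma continuous_arctan_derivative (K x : R) : continuous (fun x => K * / (1 + x * x)) x.
Proof.
  apply (ex_derive_continuous (K := R_AbsRing) (V := R_NormedModule)). auto_derive. nra.
Qed.

Lemma inv_1_sqr_le_1 (x : R) : 0 < / (1 + x * x) <= 1.
Proof.
  split; [apply Rinv_0_lt_compat; nra|].
  rewrite <- Rinv_1. apply Rinv_le_contravar; nra.
Qed.

Lemma inv_half_odd_sqr_lim : is_lim_seq (fun M => / (1 + half_odd M * half_odd M)) 0.
Proof.
  apply is_lim_seq_le_le with (fun _ => 0) (fun M => / (INR M + 1)).
  - intros M. assert (H := pos_INR M). split.
    + left. apply inv_1_sqr_le_1.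
    + apply Rinv_le_contravar; [lra|]. unfold half_odd. nra.
  - apply is_lim_seq_const.
  - exact is_lim_seq_inv_INR.
Qed.

Lemma Cexp_2PI_Z (k : Z) : Cexp (2 * Ci * RtoC PI * RtoC (IZR k)) = RtoC 1.
Proof.
  assert (H2 : Cexp (2 * Ci * RtoC PI) = RtoC 1).
  { replace (2 * Ci * RtoC PI)%C with (Ci * RtoC PI + Ci * RtoC PI)%C by ring.
    rewrite Cexp_plus, Cexp_PI. ring. }
  assert (H : forall n, Cexp (2 * Ci * RtoC PI * RtoC (INR n)) = RtoC 1).
  { intros n. rewrite Cmult_comm, Cexp_nat, H2. apply Cpow_1_l. }
  destruct (Z_le_gt_dec 0 k) as [Hk | Hk].
  - rewrite <- (Z2Nat.id k), <- INR_IZR_INZ by lia. apply H.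
  - replace (RtoC (IZR k)) with (- RtoC (INR (Z.to_nat (- k))))%C.
    + replace (2 * Ci * RtoC PI * - RtoC (INR (Z.to_nat (- k))))%C
        with (- (2 * Ci * RtoC PI * RtoC (INR (Z.to_nat (- k)))))%C by ring.
      rewrite Cexp_opp, H. field.
    + rewrite INR_IZR_INZ, Z2Nat.id, opp_IZR by lia. rewrite RtoC_opp. ring.
Qed.

Lemma gau_half_odd (a : C) (n : Z) (M : nat) :
  gau a (IZR n) (- half_odd M) = gau a (IZR n) (half_odd M).
Proof.
  unfold gau. set (L := half_odd M).
  replace (- (RtoC PI * a) * (RtoC L * RtoC L) + 2 * Ci * RtoC PI * RtoC (IZR n) * RtoC L)%C with
    (- (RtoC PI * a) * (RtoC (- L) * RtoC (- L)) + 2 * Ci * RtoC PI * RtoC (IZR n) * RtoC (- L)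
      + 2 * Ci * RtoC PI * RtoC (IZR (n * (2 * Z.of_nat M + 1))))%C.
  - rewrite (Cexp_plus (_ + _)), Cexp_2PI_Z. ring.
  - rewrite mult_IZR, plus_IZR, mult_IZR, <- INR_IZR_INZ, RtoC_opp.
    replace (2 * INR M + 1) with (2 * L) by (unfold L, half_odd; field).
    rewrite !RtoC_mult. ring.
Qed.

(** Integrates the x-derivative of [gau]: this is the differential equation in the frequency, up to
    the boundary term on the right. *)
Lemma gint_FTC_x (a : C) (xi L : R) :
  (2 * Ci * RtoC PI * RtoC xi * gint a xi L
   - 2 * RtoC PI * a * cint (fun x => RtoC x * gau a xi x) (- L) L
   = gau a xi L - gau a xi (- L))%C.
Proof.
  rewrite <- (cint_FTC (gau a xi) _ (- L) L (is_Cderive_gau a xi)).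
  2: { unfold gau; ccont. }
  unfold gint. rewrite <- !cint_scal, <- cint_minus.
  - apply cint_ext. intros; ring.
  - unfold gau; ccont.
  - unfold gau; ccont.
  - unfold gau; ccont.
  - apply Ccont_gau.
Qed.

(** Integrates the derivative of x times the Gaussian: this is the differential equation in the
    width, up to a boundary term. *)
Lemma gint_FTC_x2 (a : C) (L : R) :
  (gint a 0 L - 2 * RtoC PI * a * cint (fun x => RtoC x * RtoC x * gau a 0 x) (- L) L
   = RtoC L * gau a 0 L + RtoC L * gau a 0 (- L))%C.
Proof.
  replace (RtoC L * gau a 0 L + RtoC L * gau a 0 (- L))%C with
    (RtoC L * gau a 0 L - RtoC (- L) * gau a 0 (- L))%C by (rewrite RtoC_opp; ring).
  assert (D : forall x, is_Cderive (fun x => RtoC x * gau a 0 x)%C x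
    (1 * gau a 0 x + RtoC x *
      ((- (2 * RtoC PI * a) * RtoC x + 2 * Ci * RtoC PI * RtoC 0) * gau a 0 x))%C).
  { intros x. assert (Hg := is_Cderive_gau a 0 x). cderive. }
  rewrite <- (cint_FTC _ _ (- L) L D).
  2: { unfold gau. ccont. }
  unfold gint. rewrite <- cint_scal, <- cint_minus.
  - apply cint_ext. intros; ring.
  - apply Ccont_gau.
  - unfold gau. ccont.
  - unfold gau. ccont.
Qed.

(** Two integrations by parts in one, with the primitive c g + 2 pi a x g chosen so that the terms
    in x g cancel in its derivative. At half-odd end points g takes equal values, so c g contributes
    nothing at the boundary and no term of order c survives. *)
Lemma gint_FTC_twice (a : C) (n : Z) (M : nat) : n <> 0%Z ->
  let c := (2 * Ci * RtoC PI * RtoC (IZR n))%C in let L := half_odd M in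
  (c * c * gint a (IZR n) L =
   4 * RtoC PI * a * RtoC L * gau a (IZR n) L
   + cint (fun x => (- (2 * RtoC PI * a) + 4 * RtoC PI * RtoC PI * a * a * (RtoC x * RtoC x))
       * gau a (IZR n) x) (- L) L)%C.
Proof.
  intros Hn c L.
  set (g := gau a (IZR n)).
  set (h := fun x : R => (- (2 * RtoC PI * a) + 4 * RtoC PI * RtoC PI * a * a * (RtoC x * RtoC x))%C).
  assert (D : forall x, is_Cderive (fun x => c * g x + 2 * RtoC PI * a * (RtoC x * g x))%C x
    (c * ((- (2 * RtoC PI * a) * RtoC x + c) * g x)
     + 2 * RtoC PI * a * (1 * g x + RtoC x * ((- (2 * RtoC PI * a) * RtoC x + c) * g x)))%C).
  { intros x. assert (Hg := is_Cderive_gau a (IZR n) x). fold g c in Hg.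
    eapply is_Cderive_eq; [cderive | ring]. }
  assert (Hg : forall x, Ccont g x) by (intros; apply Ccont_gau).
  assert (E := cint_FTC _ _ (- L) L D ltac:(unfold c, g, gau; ccont)).
  rewrite (cint_ext _ (fun x => c * c * g x - h x * g x)%C) in E by (intros; unfold h; ring).
  rewrite cint_minus, cint_scal in E.
  - assert (G : g (- L) = g L) by apply gau_half_odd. rewrite G in E.
    change (gint a (IZR n) L) with (cint g (- L) L).
    change (cint _ (- L) L) with (cint (fun x => h x * g x)%C (- L) L) at 2.
    change (gau a (IZR n) L) with (g L).
    match type of E with ?l = _ =>
      replace (c * c * cint g (- L) L)%C with (l + cint (fun x => h x * g x) (- L) L)%C by ring end.
    rewrite E, RtoC_opp. ring.
  - exact Hg.
  - unfold g, gau; ccont.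
  - unfold h, g, gau; ccont.
Qed.

(** * Quadratic decay in the frequency, uniform in the window *)

Definition inv_sqr_weight (z : Z) : R := / (1 + Rabs (IZR z)) * / (1 + Rabs (IZR z)).

Lemma inv_sqr_weight_pos (z : Z) : 0 < inv_sqr_weight z.
Proof.
  unfold inv_sqr_weight. assert (H := Rabs_pos (IZR z)).
  assert (0 < / (1 + Rabs (IZR z))) by (apply Rinv_0_lt_compat; lra). nra.
Qed.

Lemma inv_sqr_weight_summable : zsummable inv_sqr_weight.
Proof.
  assert (X : ex_series (fun n => / (INR n + 1) * / (INR n + 1))).
  { destruct (ex_finite_lim_seq_incr (rsum (fun n => / (INR n + 1) * / (INR n + 1))) 2) as [l Hl].
    - intros n. cbn [rsum]. assert (0 <= / (INR n + 1) * / (INR n + 1)) by apply Rle_0_sqr. lra.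
    (* Telescoping majorant: 1/k^2 <= 2 (1/k - 1/(k + 1)) with k = n + 1. *)
    - intros n. apply Rle_trans with (2 * (1 - / (INR n + 1))).
      + induction n; [simpl; lra|]. cbn [rsum]. rewrite S_INR.
        assert (H := pos_INR n).
        assert (E : / (INR n + 1) * / (INR n + 1) <= 2 * (/ (INR n + 1) - / (INR n + 1 + 1))).
        { replace (2 * (/ (INR n + 1) - / (INR n + 1 + 1)))
            with (/ (INR n + 1) * (2 * / (INR n + 1 + 1))) by (field; lra).
          apply Rmult_le_compat_l; [left; apply Rinv_0_lt_compat; lra|].
          apply Rmult_le_reg_r with ((INR n + 1) * (INR n + 1 + 1)); [nra|].
          replace (/ (INR n + 1) * ((INR n + 1) * (INR n + 1 + 1))) with (INR n + 1 + 1) by (field; lra).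
          replace (2 * / (INR n + 1 + 1) * ((INR n + 1) * (INR n + 1 + 1)))
            with (2 * (INR n + 1)) by (field; lra). lra. }
        lra.
      + assert (0 < / (INR n + 1)) by (apply Rinv_0_lt_compat; assert (H := pos_INR n); lra). lra.
    - exists l. apply is_series_rsum. exact Hl. }
  assert (Y : forall k : nat -> Z, (forall n, INR n <= Rabs (IZR (k n))) ->
    ex_series (fun n => inv_sqr_weight (k n))).
  { intros k Hk. refine (ex_series_le (K := R_AbsRing) (V := R_CompleteNormedModule) _ _ _ X).
    intros n. change (Rabs (inv_sqr_weight (k n)) <= / (INR n + 1) * / (INR n + 1)).
    rewrite Rabs_pos_eq by (left; apply inv_sqr_weight_pos).
    assert (H := pos_INR n). specialize (Hk n).
    unfold inv_sqr_weight.
    assert (0 < / (1 + Rabs (IZR (k n)))) by (apply Rinv_0_lt_compat; lra).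
    assert (/ (1 + Rabs (IZR (k n))) <= / (INR n + 1)) by (apply Rinv_le_contravar; lra).
    nra. }
  split; apply Y; intros n.
  - rewrite <- INR_IZR_INZ. apply Rle_abs.
  - rewrite opp_IZR, Rabs_Ropp, <- INR_IZR_INZ, S_INR.
    eapply Rle_trans; [|apply Rle_abs]. lra.
Qed.

Lemma Cmod_gau_decay (a : C) : 0 < Re a ->
  exists K, 0 < K /\ forall xi x, Cmod (gau a xi x) <= K * / (1 + x * x) * / (1 + x * x).
Proof.
  intros Ha. destruct (gaussian_decay _ Ha) as (K & HK & H). exists K. split; [exact HK|].
  intros xi x. rewrite Cmod_gau. apply H. lra.
Qed.

(** The summable majorant, independent of M, for the exchange of limits in [gint_theta_null]. For n
    <> 0 the factor 1/n^2 comes from [gint_FTC_twice]; for n = 0 the integral of the modulus is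
    bounded through arctan. *)
Lemma gint_bound (a : C) : 0 < Re a ->
  exists B, 0 <= B /\ forall n M, Cmod (gint a (IZR n) (half_odd M)) <= B * inv_sqr_weight n.
Proof.
  intros Ha. destruct (Cmod_gau_decay a Ha) as (K & HK & Hg).
  assert (Hpi := PI_RGT_0). assert (Ha0 := Cmod_ge_0 a).
  set (K2 := (2 * PI * Cmod a + 4 * PI * PI * Cmod a * Cmod a) * K).
  assert (HK2 : 0 <= K2).
  { apply Rmult_le_pos; [|lra].
    assert (0 <= PI * Cmod a) by nra. nra. }
  set (B := 4 * PI * Cmod a * K + 2 * (K2 * PI)).
  assert (HB : 0 <= B).
  { unfold B. assert (0 <= PI * Cmod a * K) by (apply Rmult_le_pos; nra).
    assert (0 <= K2 * PI) by nra. lra. }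
  exists (B + 2 * (K * PI)). assert (0 < K * PI) by nra. split; [lra|].
  intros n M. assert (HL : 0 < half_odd M) by (unfold half_odd; assert (H' := pos_INR M); lra).
  destruct (Z.eq_dec n 0) as [-> | Hn].
  - unfold inv_sqr_weight. rewrite Rabs_R0, Rplus_0_r, Rinv_1, !Rmult_1_r.
    apply Rle_trans with (2 * (K * PI)); [|lra].
    apply Rle_trans with (2 * RInt (fun x => K * / (1 + x * x)) (- half_odd M) (half_odd M)).
    + apply cint_bound; [lra | apply Ccont_gau | apply continuous_arctan_derivative|].
      intros x _. eapply Rle_trans; [apply Hg|].
      assert (H1 := inv_1_sqr_le_1 x). assert (0 < K * / (1 + x * x)) by nra. nra.
    + assert (X := RInt_arctan_bound K (half_odd M)). lra.
  - assert (E := gint_FTC_twice a n M Hn). cbv zeta in E.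
    apply (f_equal Cmod) in E. rewrite !Cmod_mult, !Cmod_R, Cmod_Ci in E.
    rewrite !(Rabs_pos_eq 2), (Rabs_pos_eq PI) in E by lra.
    set (z := Rabs (IZR n)) in *.
    assert (Hz : 1 <= z).
    { unfold z. rewrite <- abs_IZR. apply IZR_le. lia. }
    set (I := Cmod (gint a (IZR n) (half_odd M))) in *. assert (HI : 0 <= I) by apply Cmod_ge_0.
    assert (Hr : 2 * 1 * PI * z * (2 * 1 * PI * z) * I <= B).
    { rewrite E. eapply Rle_trans; [apply Cmod_triangle|]. unfold B. apply Rplus_le_compat.
      - rewrite !Cmod_mult, !Cmod_R, !Rabs_pos_eq by lra.
        rewrite !Rmult_assoc. apply Rmult_le_compat_l; [lra|].
        apply Rmult_le_compat_l; [lra|]. apply Rmult_le_compat_l; [lra|].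
        specialize (Hg (IZR n) (half_odd M)).
        set (L := half_odd M) in *. assert (H1 := inv_1_sqr_le_1 L).
        assert (L * / (1 + L * L) <= 1).
        { apply Rmult_le_reg_r with (1 + L * L); [nra|].
          rewrite Rmult_assoc, Rinv_l by nra. nra. }
        apply Rle_trans with (L * (K * / (1 + L * L) * / (1 + L * L)));
          [apply Rmult_le_compat_l; lra|].
        replace (L * (K * / (1 + L * L) * / (1 + L * L))) with
          (K * ((L * / (1 + L * L)) * / (1 + L * L))) by ring.
        assert (0 <= L * / (1 + L * L)) by nra.
        assert ((L * / (1 + L * L)) * / (1 + L * L) <= 1) by nra. nra.
      - apply Rle_trans with (2 * RInt (fun x => K2 * / (1 + x * x)) (- half_odd M) (half_odd M)).
        + apply cint_bound; [lra | | apply continuous_arctan_derivative|].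
          * unfold gau; ccont.
          * intros x _. rewrite Cmod_mult.
            apply Rle_trans with ((2 * PI * Cmod a + 4 * PI * PI * Cmod a * Cmod a) * (1 + x * x)
              * (K * / (1 + x * x) * / (1 + x * x))).
            -- apply Rmult_le_compat; try apply Cmod_ge_0; [|apply Hg].
               eapply Rle_trans; [apply Cmod_triangle|].
               rewrite Cmod_opp, !Cmod_mult, !Cmod_R,
                 !(Rabs_pos_eq 2), !(Rabs_pos_eq 4), !(Rabs_pos_eq PI) by lra.
               assert (0 <= PI * Cmod a) by nra. assert (0 <= x * x) by nra.
               rewrite <- Rabs_mult, (Rabs_pos_eq (x * x)) by assumption.
               assert (0 <= (PI * Cmod a) * (x * x)) by (apply Rmult_le_pos; assumption).
               assert (0 <= (PI * Cmod a) * (PI * Cmod a)) by nra. nra.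
            -- right. unfold K2. field. nra.
        + assert (X := RInt_arctan_bound K2 (half_odd M) HK2). lra. }
    assert (Hpi3 : 1 <= 2 * PI) by (assert (X := PI2_1); lra).
    assert (Hzz : z * z * 4 * I <= B * 4).
    { assert (1 <= 2 * PI * (2 * PI)) by nra.
      assert (0 <= z * z * I) by (apply Rmult_le_pos; nra).
      assert (z * z * I <= (2 * PI * (2 * PI)) * (z * z * I)) by nra. nra. }
    unfold inv_sqr_weight. fold z.
    apply Rmult_le_reg_r with ((1 + z) * (1 + z)); [nra|].
    replace ((B + 2 * (K * PI)) * (/ (1 + z) * / (1 + z)) * ((1 + z) * (1 + z)))
      with (B + 2 * (K * PI)) by (field; lra).
    assert ((1 + z) * (1 + z) <= 4 * (z * z)) by nra.
    assert (X : I * ((1 + z) * (1 + z)) <= I * (4 * (z * z))) by (apply Rmult_le_compat_l; assumption).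
    assert (Hs : 2 * 1 * PI * z * (2 * 1 * PI * z) * I = (PI * PI) * (I * (4 * (z * z)))) by ring.
    assert (1 <= PI * PI) by (assert (Y := PI2_1); nra).
    assert (0 <= I * (4 * (z * z))) by (apply Rmult_le_pos; nra). nra.
Qed.

(** * The Fourier transform of the Gaussian in the limit *)

Lemma is_Cderive_gint_xi (a : C) (xi L : R) :
  is_Cderive (fun xi => gint a xi L) xi
    (2 * Ci * RtoC PI * cint (fun x => RtoC x * gau a xi x) (- L) L)%C.
Proof.
  rewrite <- cint_scal by (unfold gau; ccont).
  apply (is_Cderive_cint (fun xi x => gau a xi x)
    (fun xi x => 2 * Ci * RtoC PI * (RtoC x * gau a xi x))%C _ _ _ 1); [lra | | |].
  - intros t x _. unfold gau at 1. eapply is_Cderive_eq.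
    + cderive.
    + unfold gau. ring.
  - intros x. unfold gau. ccont.
  - intros t x _. apply Ccont_gau.
Qed.

(** Up to a boundary term the transform satisfies y' = -(2 pi xi / a) y. After multiplication by the
    integrating factor [w] only the boundary term is left in the derivative, and it is O(1/(1 +
    L^2)) uniformly for |xi| <= |n|. *)
Lemma gint_fourier (a : C) (n : Z) : 0 < Re a ->
  Ccv (fun M => gint a (IZR n) (half_odd M)
    - Cexp (- (RtoC PI / a * (RtoC (IZR n) * RtoC (IZR n)))) * gint a 0 (half_odd M))%C 0.
Proof.
  intros Ha. assert (Hpi := PI_RGT_0).
  assert (Ha0 : a <> 0%C) by (intros E; rewrite E in Ha; simpl in Ha; lra).
  assert (Hm : 0 < Cmod a) by (apply Cmod_gt_0, Ha0).
  destruct (Cmod_gau_decay a Ha) as (K & HK & Hg).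
  set (w := fun xi => Cexp (RtoC PI / a * (RtoC xi * RtoC xi))).
  set (N := Rabs (IZR n)). assert (HN : 0 <= N) by apply Rabs_pos.
  set (W := exp (PI / Cmod a * (N * N))).
  assert (Hw : forall xi, - N <= xi <= N -> Cmod (w xi) <= W).
  { intros xi Hxi. unfold w. rewrite Cmod_Cexp. unfold W. apply exp_le_compat.
    assert (HM : Cmod (RtoC PI / a * (RtoC xi * RtoC xi)) = PI / Cmod a * (xi * xi)).
    { rewrite !Cmod_mult, Cmod_div, !Cmod_R, (Rabs_pos_eq PI), <- Rabs_mult,
        (Rabs_pos_eq (xi * xi)) by (assumption || lra || nra). reflexivity. }
    eapply Rle_trans; [apply Rle_abs|]. eapply Rle_trans; [apply re_le_Cmod|]. rewrite HM.
    apply Rmult_le_compat_l; [|nra]. left. apply Rdiv_lt_0_compat; lra. }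
  assert (D : forall L xi, is_Cderive (fun xi => gint a xi L * w xi)%C xi
    (- (Ci / a) * (gau a xi L - gau a xi (- L)) * w xi)%C).
  { intros L xi.
    assert (Dw : is_Cderive w xi (2 * RtoC PI / a * RtoC xi * w xi)%C).
    { eapply is_Cderive_eq.
      - unfold w. cderive.
      - unfold w. field. exact Ha0. }
    assert (Dg := is_Cderive_gint_xi a xi L).
    eapply is_Cderive_eq; [cderive|].
    rewrite <- gint_FTC_x.
    replace (- (Ci / a) * (2 * Ci * RtoC PI * RtoC xi * gint a xi L -
       2 * RtoC PI * a * cint (fun x => RtoC x * gau a xi x) (- L) L) * w xi)%C
      with ((2 * Ci * RtoC PI * cint (fun x => RtoC x * gau a xi x) (- L) L
             - (Ci * Ci) * (2 * RtoC PI / a * RtoC xi * gint a xi L)) * w xi)%C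
      by (field; exact Ha0).
    replace (Ci * Ci)%C with (- (1))%C by (apply C_eq; simpl; ring). ring. }
  apply Ccv_squeeze with (fun M => (W * (2 * (/ Cmod a * (2 * K) * W) * N))
    * / (1 + half_odd M * half_odd M)).
  2: { apply is_lim_seq_scal_0, inv_half_odd_sqr_lim. }
  intros M. set (L := half_odd M).
  set (Y := fun xi => (gint a xi L * w xi)%C).
  assert (Hq := inv_1_sqr_le_1 L).
  assert (HD : forall xi, - N <= xi <= N ->
    Cmod (- (Ci / a) * (gau a xi L - gau a xi (- L)) * w xi)
      <= / Cmod a * (2 * K) * W * / (1 + L * L)).
  { intros xi Hxi. rewrite !Cmod_mult, Cmod_opp, Cmod_div, Cmod_Ci by assumption.
    replace (1 / Cmod a) with (/ Cmod a) by (field; lra).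
    assert (H1 : Cmod (gau a xi L - gau a xi (- L)) <= 2 * K * / (1 + L * L)).
    { eapply Rle_trans; [apply Cmod_triangle_minus|].
      assert (X1 := Hg xi L). assert (X2 := Hg xi (- L)).
      replace (- L * - L) with (L * L) in X2 by ring.
      assert (0 < K * / (1 + L * L)) by nra.
      assert (K * / (1 + L * L) * / (1 + L * L) <= K * / (1 + L * L)) by nra. lra. }
    assert (0 < / Cmod a) by (apply Rinv_0_lt_compat; assumption).
    apply Rle_trans with (/ Cmod a * (2 * K * / (1 + L * L)) * W); [|right; ring].
    apply Rmult_le_compat; try apply Cmod_ge_0; auto.
    - apply Rmult_le_pos; [lra | apply Cmod_ge_0].
    - apply Rmult_le_compat_l; lra. }
  assert (HY : Cmod (Y (IZR n) - Y 0) <= 2 * (/ Cmod a * (2 * K) * W * / (1 + L * L)) * N).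
  { destruct (Rle_dec 0 (IZR n)) as [Hn | Hn].
    - assert (EN : N = IZR n) by (apply Rabs_pos_eq; assumption).
      assert (X := Cderive_increment_bound Y _ 0 (IZR n) (/ Cmod a * (2 * K) * W * / (1 + L * L))
        Hn (fun t _ => D L t) (fun t Ht => HD t ltac:(lra))).
      rewrite EN. rewrite Rminus_0_r in X. exact X.
    - assert (EN : N = - IZR n) by (apply Rabs_left; lra).
      assert (X := Cderive_increment_bound Y _ (IZR n) 0 (/ Cmod a * (2 * K) * W * / (1 + L * L))
        ltac:(lra) (fun t _ => D L t) (fun t Ht => HD t ltac:(lra))).
      rewrite EN, Cmod_minus_sym. rewrite Rminus_0_l in X. exact X. }
  assert (HW : Cmod (/ w (IZR n)) <= W).
  { unfold w. rewrite <- Cexp_opp, Cmod_Cexp, re_opp. unfold W. apply exp_le_compat.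
    eapply Rle_trans; [apply Rle_abs|]. rewrite Rabs_Ropp.
    eapply Rle_trans; [apply re_le_Cmod|].
    rewrite !Cmod_mult, Cmod_div, !Cmod_R, (Rabs_pos_eq PI) by (assumption || lra). right; reflexivity. }
  replace (gint a (IZR n) L - Cexp (- (RtoC PI / a * (RtoC (IZR n) * RtoC (IZR n)))) * gint a 0 L - 0)%C
    with (/ w (IZR n) * (Y (IZR n) - Y 0))%C.
  - rewrite Cmod_mult.
    apply Rle_trans with (W * (2 * (/ Cmod a * (2 * K) * W * / (1 + L * L)) * N)); [|right; ring].
    apply Rmult_le_compat; auto using Cmod_ge_0.
  - rewrite Cexp_opp. change (Cexp (RtoC PI / a * (RtoC (IZR n) * RtoC (IZR n)))) with (w (IZR n)).
    unfold Y. replace (w 0) with (RtoC 1).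
    + field. apply Cexp_neq_0.
    + unfold w. replace (RtoC PI / a * (0 * 0))%C with (RtoC 0) by (field; exact Ha0).
      rewrite Cexp_0. reflexivity.
Qed.

(** The width is moved along the segment from 1 to a, which stays in the right half plane by
    convexity and keeps the parameter real. *)
Lemma is_Cderive_gint_segment (a : C) (L t : R) :
  is_Cderive (fun t => gint (1 + RtoC t * (a - 1)) 0 L) t
    (- (RtoC PI * (a - 1)) *
     cint (fun x => RtoC x * RtoC x * gau (1 + RtoC t * (a - 1)) 0 x) (- L) L)%C.
Proof.
  assert (Hc : forall b x, Ccont (fun x => RtoC x * RtoC x * gau b 0 x)%C x).
  { unfold gau; ccont. }
  rewrite <- cint_scal by apply Hc.
  apply (is_Cderive_cint (fun t x => gau (1 + RtoC t * (a - 1)) 0 x)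
    (fun t x => - (RtoC PI * (a - 1)) * (RtoC x * RtoC x * gau (1 + RtoC t * (a - 1)) 0 x))%C _ _ _ 1);
    [lra | | |].
  - intros s x _. unfold gau at 1. eapply is_Cderive_eq.
    + apply is_Cderive_ext with (fun s => Cexp (- (RtoC PI) * (RtoC x * RtoC x)
        + (- (RtoC PI * (a - 1)) * (RtoC x * RtoC x)) * RtoC s))%C; [intros; f_equal; ring|].
      cderive.
    + unfold gau.
      replace (- (RtoC PI * (1 + RtoC s * (a - 1))) * (RtoC x * RtoC x)
          + 2 * Ci * RtoC PI * 0 * RtoC x)%C
        with (- (RtoC PI) * (RtoC x * RtoC x)
        + (- (RtoC PI * (a - 1)) * (RtoC x * RtoC x)) * RtoC s)%C by ring. ring.
  - intros x. unfold gau.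
    apply Ccont_ext with (fun p : R * R => - (RtoC PI * (a - 1)) * (RtoC (snd p) * RtoC (snd p) *
      Cexp ((- (RtoC PI)) * (RtoC (snd p) * RtoC (snd p))
      + (- (RtoC PI * (a - 1))) * RtoC (fst p) * (RtoC (snd p) * RtoC (snd p)))))%C.
    + intros p. do 3 f_equal. ring.
    + ccont.
  - intros s x _. apply Ccont_gau.
Qed.

(** Along the segment, b times the squared integral has a pure boundary term as derivative, by
    [gint_FTC_x2]. The square removes the choice of a root of a; the value of the limit is left open
    until [theta_null_modular]. *)
Lemma gint_mass (a : C) : 0 < Re a ->
  Ccv (fun M => a * gint a 0 (half_odd M) ^ 2 - gint 1 0 (half_odd M) ^ 2)%C 0.
Proof.
  intros Ha. set (u := Rmin 1 (Re a)).
  assert (Hu : 0 < u) by (apply Rmin_glb_lt; lra).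
  assert (Hu1 : u <= 1) by apply Rmin_l. assert (Hua : u <= Re a) by apply Rmin_r.
  destruct (gaussian_decay u Hu) as (K & HK & Hg).
  assert (Hd := Cmod_ge_0 (a - 1)).
  apply Ccv_squeeze with (fun M => (2 * (Cmod (a - 1) * (8 * K)))
    * / (1 + half_odd M * half_odd M)).
  2: { apply is_lim_seq_scal_0, inv_half_odd_sqr_lim. }
  intros M. set (L := half_odd M).
  assert (HL : 0 < L) by (unfold L, half_odd; assert (H' := pos_INR M); lra).
  set (b := fun t => (1 + RtoC t * (a - 1))%C).
  set (k := fun t => gint (b t) 0 L).
  assert (D : forall t, is_Cderive (fun t => b t * (k t * k t))%C t
    ((a - 1) * k t * (RtoC L * gau (b t) 0 L + RtoC L * gau (b t) 0 (- L)))%C).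
  { intros t. assert (Dk := is_Cderive_gint_segment a L t). fold (b t) in Dk.
    change (is_Cderive k t (- (RtoC PI * (a - 1)) *
      cint (fun x => RtoC x * RtoC x * gau (b t) 0 x) (- L) L)%C) in Dk.
    rewrite <- gint_FTC_x2. fold (k t).
    assert (Db : is_Cderive b t (a - 1)%C) by (unfold b; eapply is_Cderive_eq; [cderive | ring]).
    eapply is_Cderive_eq; [cderive | ring]. }
  assert (Hgb : forall t x, 0 <= t <= 1 ->
    Cmod (gau (b t) 0 x) <= K * / (1 + x * x) * / (1 + x * x)).
  { intros t x Ht. rewrite Cmod_gau. apply Hg. unfold b.
    rewrite re_plus, re_scal_l, re_minus, re_RtoC. nra. }
  assert (X : Cmod (b 1 * (k 1 * k 1) - b 0 * (k 0 * k 0))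
    <= 2 * (Cmod (a - 1) * (8 * K) * / (1 + L * L)) * (1 - 0)).
  { refine (Cderive_increment_bound (fun t => b t * (k t * k t))%C _ 0 1
      (Cmod (a - 1) * (8 * K) * / (1 + L * L)) ltac:(lra) (fun t _ => D t) _).
    intros t Ht. rewrite !Cmod_mult.
    (* The trivial bound by the length of the interval suffices: its growth in L is beaten by the
       decay of the boundary term. *)
    assert (H1 : Cmod (k t) <= 4 * L).
    { assert (E : Cmod (k t) <= 2 * 1 * (L - - L)).
      { apply cint_bound_const; [lra | apply Ccont_gau|].
        intros x _. rewrite Cmod_gau. rewrite <- exp_0. apply exp_le_compat.
        assert (0 < Re (b t)).
        { unfold b. rewrite re_plus, re_scal_l, re_minus, re_RtoC. nra. }
        assert (Hpi := PI_RGT_0).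
        assert (0 <= PI * Re (b t) * (x * x)) by (apply Rmult_le_pos; nra). lra. }
      lra. }
    assert (Hq := inv_1_sqr_le_1 L).
    assert (H2 : Cmod (RtoC L * gau (b t) 0 L + RtoC L * gau (b t) 0 (- L))
      <= 2 * L * (K * / (1 + L * L) * / (1 + L * L))).
    { eapply Rle_trans; [apply Cmod_triangle|]. rewrite !Cmod_mult, !Cmod_R, !Rabs_pos_eq by lra.
      assert (X1 := Hgb t L Ht). assert (X2 := Hgb t (- L) Ht).
      replace (- L * - L) with (L * L) in X2 by ring.
      assert (L * Cmod (gau (b t) 0 L) <= L * (K * / (1 + L * L) * / (1 + L * L)))
        by (apply Rmult_le_compat_l; lra).
      assert (L * Cmod (gau (b t) 0 (- L)) <= L * (K * / (1 + L * L) * / (1 + L * L)))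
        by (apply Rmult_le_compat_l; lra). lra. }
    rewrite !Rmult_assoc. apply Rmult_le_compat_l; [assumption|].
    apply Rle_trans with (4 * L * (2 * L * (K * / (1 + L * L) * / (1 + L * L)))).
    - apply Rmult_le_compat; auto using Cmod_ge_0.
    - replace (4 * L * (2 * L * (K * / (1 + L * L) * / (1 + L * L)))) with
        (8 * (K * ((L * L * / (1 + L * L)) * / (1 + L * L)))) by ring.
      assert (L * L * / (1 + L * L) <= 1).
      { apply Rmult_le_reg_r with (1 + L * L); [nra|].
        rewrite Rmult_assoc, Rinv_l by nra. nra. }
      assert (0 <= K * / (1 + L * L)) by nra.
      replace (8 * (K * ((L * L * / (1 + L * L)) * / (1 + L * L)))) with
        (8 * ((K * / (1 + L * L)) * (L * L * / (1 + L * L)))) by ring. nra. }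
  assert (Hb1 : b 1 = a) by (unfold b; ring).
  assert (Hb0 : b 0 = RtoC 1) by (unfold b; ring).
  unfold k in X. rewrite Hb1, Hb0 in X.
  replace (a * gint a 0 L ^ 2 - gint 1 0 L ^ 2 - 0)%C with
    (a * (gint a 0 L * gint a 0 L) - 1 * (gint 1 0 L * gint 1 0 L))%C by ring.
  lra.
Qed.

(** * Poisson summation on a finite window *)

Lemma cint_Chasles (f : R -> C) (a b c : R) : (forall x, Ccont f x) ->
  (cint f a b + cint f b c = cint f a c)%C.
Proof.
  intros Hf. apply C_eq.
  - exact (RInt_Chasles (V := R_CompleteNormedModule) _ a b c
      (ex_RInt_re f a b Hf) (ex_RInt_re f b c Hf)).
  - exact (RInt_Chasles (V := R_CompleteNormedModule) _ a b c
      (ex_RInt_im f a b Hf) (ex_RInt_im f b c Hf)).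
Qed.

Lemma cint_shift (f : R -> C) (a b v : R) : (forall x, Ccont f x) ->
  cint (fun x => f (x + v)) a b = cint f (a + v) (b + v).
Proof.
  intros Hf.
  assert (X : forall g : R -> R, (forall x, continuous g x) ->
    RInt (fun x => g (x + v)) a b = RInt g (a + v) (b + v)).
  { intros g Hg.
    assert (E := RInt_comp_lin (V := R_CompleteNormedModule) g 1 v a b).
    rewrite !Rmult_1_l in E. rewrite <- E by (apply ex_RInt_cont; assumption).
    apply RInt_ext. intros x _. change (g (x + v) = 1 * g (1 * x + v)).
    rewrite !Rmult_1_l. reflexivity. }
  apply C_eq.
  - exact (X (fun x => Re (f x)) (fun x => proj1 (Hf x))).
  - exact (X (fun x => Im (f x)) (fun x => proj2 (Hf x))).
Qed.

Definition sym_sum (f : Z -> C) (N : nat) : C := zsum f N (S N).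

Lemma sym_sum_0 (f : Z -> C) : sym_sum f 0 = f 0%Z.
Proof. unfold sym_sum, zsum. simpl. ring. Qed.

Lemma sym_sum_S (f : Z -> C) (N : nat) :
  sym_sum f (S N) = (sym_sum f N + f (Z.of_nat (S N)) + f (- Z.of_nat (S N))%Z)%C.
Proof. unfold sym_sum, zsum. cbn [csum]. ring. Qed.

Lemma sym_sum_ext (f g : Z -> C) (N : nat) : (forall z, f z = g z) -> sym_sum f N = sym_sum g N.
Proof. apply zsum_ext. Qed.

Lemma Ccont_sym_sum (f : Z -> R -> C) (N : nat) (x : R) :
  (forall z, Ccont (f z) x) -> Ccont (fun x => sym_sum (fun z => f z x) N) x.
Proof.
  intros H. unfold sym_sum, zsum.
  apply Ccont_plus; [apply (Ccont_csum (fun n => f (Z.of_nat n))) |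
    apply (Ccont_csum (fun n => f (- Z.of_nat (S n))%Z))]; auto.
Qed.

Lemma cint_sym_sum (f : Z -> R -> C) (N : nat) (a b : R) :
  (forall z x, Ccont (f z) x) ->
  cint (fun x => sym_sum (fun z => f z x) N) a b = sym_sum (fun z => cint (f z) a b) N.
Proof.
  intros H. unfold sym_sum, zsum.
  rewrite (cint_plus (fun x => csum (fun n => f (Z.of_nat n) x) (S N))
    (fun x => csum (fun n => f (- Z.of_nat (S n))%Z x) N)).
  - rewrite (cint_csum (fun n => f (Z.of_nat n))), (cint_csum (fun n => f (- Z.of_nat (S n))%Z)) by auto.
    reflexivity.
  - intros x; apply (Ccont_csum (fun n => f (Z.of_nat n))); auto.
  - intros x; apply (Ccont_csum (fun n => f (- Z.of_nat (S n))%Z)); auto.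
Qed.

Lemma sym_sum_scal (c : C) (f : Z -> C) (N : nat) :
  sym_sum (fun z => c * f z)%C N = (c * sym_sum f N)%C.
Proof. unfold sym_sum, zsum. rewrite !csum_scal. ring. Qed.

Lemma cint_unit_pieces (g : R -> C) (M : nat) : (forall x, Ccont g x) ->
  cint g (- half_odd M) (half_odd M) =
  sym_sum (fun m => cint (fun x => g (x + IZR m)) (- / 2) (/ 2)) M.
Proof.
  intros Hg. induction M.
  - rewrite sym_sum_0, cint_shift by exact Hg. unfold half_odd. simpl. f_equal; ring.
  - rewrite sym_sum_S, <- IHM, !cint_shift, opp_IZR, <- INR_IZR_INZ by exact Hg.
    replace (- / 2 + INR (S M)) with (half_odd M) by (unfold half_odd; rewrite S_INR; field).
    replace (/ 2 + INR (S M)) with (half_odd (S M)) by (unfold half_odd; ring).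
    replace (- / 2 + - INR (S M)) with (- half_odd (S M)) by (unfold half_odd; ring).
    replace (/ 2 + - INR (S M)) with (- half_odd M) by (unfold half_odd; rewrite S_INR; field).
    rewrite <- (cint_Chasles g (- half_odd (S M)) (- half_odd M) (half_odd (S M))) by exact Hg.
    rewrite <- (cint_Chasles g (- half_odd M) (half_odd M) (half_odd (S M))) by exact Hg. ring.
Qed.

Definition fourier_mode (n : Z) (x : R) : C := Cexp (2 * Ci * RtoC PI * RtoC (IZR n) * RtoC x).

Lemma Ccont_fourier_mode (n : Z) (x : R) : Ccont (fourier_mode n) x.
Proof. unfold fourier_mode. ccont. Qed.

Lemma gau_fourier_mode (a : C) (n : Z) (x : R) :
  gau a (IZR n) x = (gau a 0 x * fourier_mode n x)%C.
Proof. unfold gau, fourier_mode. rewrite <- Cexp_plus. f_equal. ring. Qed.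

Lemma fourier_mode_shift (n m : Z) (x : R) : fourier_mode n (x + IZR m) = fourier_mode n x.
Proof.
  unfold fourier_mode.
  replace (2 * Ci * RtoC PI * RtoC (IZR n) * RtoC (x + IZR m))%C with
    (2 * Ci * RtoC PI * RtoC (IZR n) * RtoC x + 2 * Ci * RtoC PI * RtoC (IZR (n * m)))%C
    by (rewrite RtoC_plus, mult_IZR, RtoC_mult; ring).
  rewrite Cexp_plus, Cexp_2PI_Z. ring.
Qed.

Lemma fourier_mode_sum (N : nat) (x : R) :
  sym_sum (fun n => fourier_mode n x) N = RtoC (dirichlet N x).
Proof.
  induction N.
  - rewrite sym_sum_0. unfold fourier_mode, dirichlet. simpl rsum.
    replace (2 * Ci * RtoC PI * 0 * RtoC x)%C with (RtoC 0) by ring. rewrite Cexp_0. f_equal. ring.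
  - rewrite sym_sum_S, IHN. unfold dirichlet. cbn [rsum].
    unfold fourier_mode. rewrite opp_IZR, RtoC_opp.
    set (k := IZR (Z.of_nat (S N))).
    apply C_eq; rewrite ?re_plus, ?im_plus, ?re_Cexp, ?im_Cexp, ?re_RtoC, ?im_RtoC.
    + replace (Re (2 * Ci * RtoC PI * RtoC k * RtoC x)) with 0 by (simpl; ring).
      replace (Re (2 * Ci * RtoC PI * - RtoC k * RtoC x)) with 0 by (simpl; ring).
      replace (Im (2 * Ci * RtoC PI * RtoC k * RtoC x)) with (2 * k * (PI * x)) by (simpl; ring).
      replace (Im (2 * Ci * RtoC PI * - RtoC k * RtoC x)) with (- (2 * k * (PI * x))) by (simpl; ring).
      rewrite exp_0, cos_neg. ring.
    + replace (Re (2 * Ci * RtoC PI * RtoC k * RtoC x)) with 0 by (simpl; ring).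
      replace (Re (2 * Ci * RtoC PI * - RtoC k * RtoC x)) with 0 by (simpl; ring).
      replace (Im (2 * Ci * RtoC PI * RtoC k * RtoC x)) with (2 * k * (PI * x)) by (simpl; ring).
      replace (Im (2 * Ci * RtoC PI * - RtoC k * RtoC x)) with (- (2 * k * (PI * x))) by (simpl; ring).
      rewrite exp_0, sin_neg. ring.
Qed.

Lemma is_Cderive_sym_sum (f : Z -> R -> C) (df : Z -> C) (N : nat) (x : R) :
  (forall z, is_Cderive (f z) x (df z)) ->
  is_Cderive (fun x => sym_sum (fun z => f z x) N) x (sym_sum df N).
Proof.
  intros H. induction N.
  - apply is_Cderive_ext with (f 0%Z); [intros; symmetry; apply (sym_sum_0 (fun z => f z t))|].
    rewrite sym_sum_0. apply H.
  - apply is_Cderive_ext with (fun x => sym_sum (fun z => f z x) N + f (Z.of_nat (S N)) x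
      + f (- Z.of_nat (S N))%Z x)%C; [intros; symmetry; apply (sym_sum_S (fun z => f z t))|].
    rewrite sym_sum_S.
    apply (is_Cderive_plus (fun x => sym_sum (fun z => f z x) N + f (Z.of_nat (S N)) x)%C); [|apply H].
    apply (is_Cderive_plus (fun x => sym_sum (fun z => f z x) N)); [exact IHN | apply H].
Qed.

Lemma is_Cderive_shift (f : R -> C) (x v : R) (l : C) :
  is_Cderive f (x + v) l -> is_Cderive (fun x => f (x + v)) x l.
Proof.
  assert (X : forall g : R -> R, forall l : R,
    is_derive g (x + v) l -> is_derive (fun x => g (x + v)) x l).
  { intros g m Hg. replace m with (scal 1 m) by apply Rmult_1_l.
    apply (is_derive_comp (V := R_NormedModule) g (fun x => x + v)); [exact Hg|].
    auto_derive; [exact I | reflexivity]. }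
  intros [H1 H2]; split; [exact (X (fun x => Re (f x)) _ H1) | exact (X (fun x => Im (f x)) _ H2)].
Qed.

(** For fixed M the sum [phi] of 2M + 1 translates is finite, so no convergence enters its
    construction. It is not periodic, but [dirichlet_limit] looks only at [-1/2, 1/2], and there its
    Fourier coefficients reassemble to integrals over the whole window because the modes have period
    1. The conclusion is the Fourier series of [phi] at 0. *)
Lemma gau_poisson_partial (a : C) (M : nat) :
  Ccv (fun N => sym_sum (fun n => gint a (IZR n) (half_odd M)) N)
    (sym_sum (fun m => gau a 0 (IZR m)) M).
Proof.
  set (phi := fun x => sym_sum (fun m => gau a 0 (x + IZR m)) M).
  assert (Hsh : forall z x, Ccont (fun x => gau a 0 (x + IZR z)) x).
  { intros z x. unfold gau. apply Ccont_ext with (fun x => Cexp (- (RtoC PI * a) *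
      ((RtoC x + RtoC (IZR z)) * (RtoC x + RtoC (IZR z)))
      + 2 * Ci * RtoC PI * 0 * (RtoC x + RtoC (IZR z)))%C).
    - intros y. rewrite RtoC_plus. reflexivity.
    - ccont. }
  assert (Hphi : forall x, Ccont phi x).
  { intros x. apply (Ccont_sym_sum (fun m x => gau a 0 (x + IZR m))). intros; apply Hsh. }
  assert (Hphi' : exists l, is_Cderive phi 0 l).
  { eexists. apply (is_Cderive_sym_sum (fun m x => gau a 0 (x + IZR m))). intros z.
    apply is_Cderive_shift. apply is_Cderive_gau. }
  assert (E1 : forall n, gint a (IZR n) (half_odd M) =
    cint (fun x => phi x * fourier_mode n x)%C (- / 2) (/ 2)).
  { intros n. unfold gint. rewrite cint_unit_pieces by apply Ccont_gau.
    rewrite <- (cint_sym_sum (fun m x => gau a (IZR n) (x + IZR m))).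
    - apply cint_ext. intros x. unfold phi. rewrite Cmult_comm, <- sym_sum_scal.
      apply sym_sum_ext. intros m. rewrite (gau_fourier_mode a n), fourier_mode_shift. ring.
    - intros m x. apply Ccont_ext with (fun x => gau a 0 (x + IZR m) * fourier_mode n x)%C.
      + intros y. rewrite (gau_fourier_mode a n), fourier_mode_shift. reflexivity.
      + apply Ccont_mult; [apply Hsh | apply Ccont_fourier_mode]. }
  assert (E2 : forall N, sym_sum (fun n => gint a (IZR n) (half_odd M)) N =
    cint (fun x => phi x * RtoC (dirichlet N x))%C (- / 2) (/ 2)).
  { intros N. rewrite (sym_sum_ext _ _ N E1).
    rewrite <- (cint_sym_sum (fun n x => phi x * fourier_mode n x)%C).
    - apply cint_ext. intros x. rewrite sym_sum_scal, fourier_mode_sum. reflexivity.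
    - intros n x. apply Ccont_mult; [apply Hphi | apply Ccont_fourier_mode]. }
  apply Ccv_ext with (fun N => cint (fun x => phi x * RtoC (dirichlet N x))%C (- / 2) (/ 2));
    [intros; symmetry; apply E2|].
  replace (sym_sum (fun m => gau a 0 (IZR m)) M) with (phi 0)
    by (unfold phi; apply sym_sum_ext; intros; rewrite Rplus_0_l; reflexivity).
  destruct Hphi' as [l [Hl1 Hl2]].
  apply Ccv_components.
  - apply is_lim_seq_ext with (fun N => RInt (fun x => Re (phi x) * dirichlet N x) (- / 2) (/ 2)).
    + intros N. apply RInt_ext. intros x _. symmetry. apply re_scal_r.
    + exact (dirichlet_limit (fun x => Re (phi x)) (fun x => proj1 (Hphi x)) (ex_intro _ _ Hl1)).
  - apply is_lim_seq_ext with (fun N => RInt (fun x => Im (phi x) * dirichlet N x) (- / 2) (/ 2)).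
    + intros N. apply RInt_ext. intros x _. symmetry. apply im_scal_r.
    + exact (dirichlet_limit (fun x => Im (phi x)) (fun x => proj2 (Hphi x)) (ex_intro _ _ Hl2)).
Qed.

(** * Poisson summation for theta null values *)

Definition nome (a : C) : C := Cexp (- (RtoC PI * a)).

Lemma Cmod_nome (a : C) : Cmod (nome a) = exp (- (PI * Re a)).
Proof. unfold nome. rewrite Cmod_Cexp, re_opp, re_scal_l. reflexivity. Qed.

Lemma Cmod_nome_lt_1 (a : C) : 0 < Re a -> Cmod (nome a) < 1.
Proof.
  intros Ha. assert (Hpi := PI_RGT_0). rewrite Cmod_nome, <- exp_0. apply exp_increasing. nra.
Qed.

Lemma RtoC_IZR_sqr (m : Z) : (RtoC (IZR m) * RtoC (IZR m) = RtoC (INR (zsq m)))%C.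
Proof. rewrite <- RtoC_mult, <- mult_IZR, <- zsq_spec, INR_IZR_INZ. reflexivity. Qed.

Lemma Cexp_zsq (c : C) (m : Z) : Cexp (c * (RtoC (IZR m) * RtoC (IZR m))) = (Cexp c ^ zsq m)%C.
Proof. rewrite RtoC_IZR_sqr, Cmult_comm. apply Cexp_nat. Qed.

Lemma gau_nome (a : C) (m : Z) : gau a 0 (IZR m) = (nome a ^ zsq m)%C.
Proof.
  unfold nome. rewrite <- Cexp_zsq. unfold gau. f_equal. ring.
Qed.

(** A diagonal argument: for each M the Fourier sum is cut at a [K M] where it is within 1/(M + 1)
    of its limit, and then M tends to infinity. Since the limit of [gint a 0] is unknown at this
    point, the conclusion is a difference that tends to 0. *)
Lemma gint_theta_null (a : C) : 0 < Re a ->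
  Ccv (fun M => theta_null (nome a) - gint a 0 (half_odd M) * theta_null (nome (/ a)))%C 0.
Proof.
  intros Ha.
  assert (Ha0 : a <> 0%C) by (intros E; rewrite E in Ha; simpl in Ha; lra).
  assert (Hi : 0 < Re (/ a)).
  { destruct a as [u v]. simpl in Ha |- *. apply Rdiv_lt_0_compat; [assumption | nra]. }
  assert (HQ := Cmod_nome_lt_1 _ Hi). assert (HQ0 := Cmod_ge_0 (nome (/ a))).
  destruct (gint_bound a Ha) as (B & HB & Hb).
  set (I := fun M n => gint a (IZR n) (half_odd M)).
  (* The defect between the truncated transform and its Gaussian prediction: it tends to 0 for each
     n by [gint_fourier] and has a summable majorant, so its sum tends to 0. *)
  set (e := fun M n => (I M n - nome (/ a) ^ zsq n * I M 0%Z)%C).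
  assert (HN : forall M, exists N, (M <= N)%nat /\
    Cmod (sym_sum (I M) N - sym_sum (fun m => gau a 0 (IZR m)) M) < / (INR M + 1)).
  { intros M. assert (Hp : 0 < / (INR M + 1)) by (apply Rinv_0_lt_compat; assert (H := pos_INR M); lra).
    destruct (proj1 (Ccv_eps _ _) (gau_poisson_partial a M) _ Hp) as [N HN].
    exists (N + M)%nat. split; [lia|]. apply HN. lia. }
  set (K := fun M => proj1_sig (constructive_indefinite_description _ (HN M))).
  assert (HK : forall M, (M <= K M)%nat /\
    Cmod (sym_sum (I M) (K M) - sym_sum (fun m => gau a 0 (IZR m)) M) < / (INR M + 1)).
  { intros M. unfold K. destruct (constructive_indefinite_description _ (HN M)); assumption. }
  assert (Hpow : forall n, Cmod (nome (/ a) ^ zsq n) = Cmod (nome (/ a)) ^ zsq n)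
    by (intros; apply Cmod_pow).
  assert (He0 : Ccv (fun M => zsum (e M) (K M) (S (K M))) 0).
  { replace (RtoC 0) with (ZSeries (fun _ => RtoC 0)).
    - apply (zsum_dominated _ _ (fun n => B * inv_sqr_weight n + B * Cmod (nome (/ a)) ^ zsq n)
        K (fun M => S (K M))).
      + intros M. apply HK.
      + intros M. destruct (HK M). lia.
      + intros M n. unfold e. eapply Rle_trans; [apply Cmod_triangle_minus|].
        apply Rplus_le_compat; [apply Hb|]. rewrite Cmod_mult, Hpow, Rmult_comm.
        apply Rmult_le_compat_r; [apply pow_le; exact HQ0|].
        eapply Rle_trans; [apply (Hb 0%Z)|].
        unfold inv_sqr_weight. rewrite Rabs_R0, Rplus_0_r, Rinv_1. lra.
      + destruct inv_sqr_weight_summable as [S1 S2].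
        destruct (zsq_summable (Cmod (nome (/ a)))) as [T1 T2]; [lra|].
        split.
        * exact (ex_series_plus (K := R_AbsRing) (V := R_NormedModule) _ _
            (ex_series_scal_l (K := R_AbsRing) B _ S1) (ex_series_scal_l (K := R_AbsRing) B _ T1)).
        * exact (ex_series_plus (K := R_AbsRing) (V := R_NormedModule) _ _
            (ex_series_scal_l (K := R_AbsRing) B _ S2) (ex_series_scal_l (K := R_AbsRing) B _ T2)).
      + intros n. unfold e, I. eapply Ccv_ext; [|apply (gint_fourier a n Ha)].
        intros M. unfold nome. rewrite <- Cexp_zsq.
        replace (- (RtoC PI * / a) * (RtoC (IZR n) * RtoC (IZR n)))%C
          with (- (RtoC PI / a * (RtoC (IZR n) * RtoC (IZR n))))%C by (field; exact Ha0).
        reflexivity.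
    - unfold ZSeries. rewrite !(CSeries_unique (fun _ => RtoC 0) 0); [ring|].
      apply Ccv_ext with (fun _ => RtoC 0); [intros; symmetry; apply csum_0 | apply Ccv_const]. }
  assert (Hth : forall Q, Cmod Q < 1 -> forall k : nat -> nat, (forall n, (n <= k n)%nat) ->
    Ccv (fun M => sym_sum (fun z => Q ^ zsq z)%C (k M)) (theta_null Q)).
  { intros Q HQQ k Hk. apply (is_zsum_cv _ _ k (fun n => S (k n))).
    - exact Hk.
    - intros n. specialize (Hk n). lia.
    - apply is_zsum_theta_null, HQQ. }
  assert (H1 := Hth (nome a) (Cmod_nome_lt_1 a Ha) (fun M => M) (fun M => Nat.le_refl M)).
  assert (H2 := Hth (nome (/ a)) HQ K (fun M => proj1 (HK M))).
  assert (Hd : Ccv (fun M => sym_sum (I M) (K M) - sym_sum (fun m => gau a 0 (IZR m)) M)%C 0).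
  { apply Ccv_squeeze with (fun M => / (INR M + 1)).
    - intros M. destruct (HK M) as [_ H]. left. eapply Rle_lt_trans; [|exact H]. right. f_equal. ring.
    - exact is_lim_seq_inv_INR. }
  assert (Hr : Ccv (fun M => (theta_null (nome (/ a)) - sym_sum (fun z => nome (/ a) ^ zsq z)%C (K M))
     * I M 0%Z)%C 0).
  { apply Ccv_squeeze with (fun M => Cmod (sym_sum (fun z => nome (/ a) ^ zsq z)%C (K M)
      - theta_null (nome (/ a))) * B).
    - intros M. match goal with |- Cmod (?x - _)%C <= _ => replace (x - 0)%C with x by ring end.
      rewrite Cmod_mult, Cmod_minus_sym. apply Rmult_le_compat_l; [apply Cmod_ge_0|].
      eapply Rle_trans; [apply (Hb 0%Z)|].
      unfold inv_sqr_weight. rewrite Rabs_R0, Rplus_0_r, Rinv_1. lra.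
    - replace (Finite 0) with (Finite (0 * B)) by (f_equal; ring).
      apply is_lim_seq_mult'; [exact H2 | apply is_lim_seq_const]. }
  apply Ccv_ext with (fun M => - (1) * (sym_sum (fun z => nome a ^ zsq z)%C M - theta_null (nome a))
    - (sym_sum (I M) (K M) - sym_sum (fun m => gau a 0 (IZR m)) M)
    + zsum (e M) (K M) (S (K M))
    - (theta_null (nome (/ a)) - sym_sum (fun z => nome (/ a) ^ zsq z)%C (K M)) * I M 0%Z)%C.
  - intros M. change (zsum (e M) (K M) (S (K M))) with (sym_sum (e M) (K M)).
    assert (E : sym_sum (e M) (K M) = (sym_sum (I M) (K M)
      - sym_sum (fun z => nome (/ a) ^ zsq z)%C (K M) * I M 0%Z)%C).
    { rewrite (Cmult_comm _ (I M 0%Z)), <- sym_sum_scal. unfold e, sym_sum, zsum.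
      rewrite !csum_minus.
      rewrite (csum_ext (fun k => nome (/ a) ^ zsq (Z.of_nat k) * I M 0%Z)%C
        (fun n => I M 0%Z * nome (/ a) ^ zsq (Z.of_nat n))%C) by (intros; ring).
      rewrite (csum_ext (fun k => nome (/ a) ^ zsq (- Z.of_nat (S k)) * I M 0%Z)%C
        (fun n => I M 0%Z * nome (/ a) ^ zsq (- Z.of_nat (S n)))%C) by (intros; ring).
      ring. }
    rewrite E, (sym_sum_ext _ _ M (gau_nome a)). unfold I. ring.
  - replace (RtoC 0) with (- (1) * (theta_null (nome a) - theta_null (nome a)) - 0 + 0 - 0)%C by ring.
    apply Ccv_minus; [|exact Hr]. apply Ccv_plus; [|exact He0]. apply Ccv_minus; [|exact Hd].
    apply Ccv_scal, Ccv_minus; [exact H1 | apply Ccv_const].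
Qed.

(** * Bounds for theta null values, and the transformation law *)

Lemma sym_sum_theta_null (Q : C) : Cmod Q < 1 -> Ccv (sym_sum (fun z => Q ^ zsq z)%C) (theta_null Q).
Proof.
  intros HQ. apply (is_zsum_cv _ _ (fun n => n) (fun n => S n)); auto.
  apply is_zsum_theta_null, HQ.
Qed.

Lemma sym_sum_theta_S (Q : C) (N : nat) :
  sym_sum (fun z => Q ^ zsq z)%C (S N) = (sym_sum (fun z => Q ^ zsq z)%C N + 2 * Q ^ (S N * S N))%C.
Proof.
  rewrite sym_sum_S.
  replace (zsq (Z.of_nat (S N))) with (S N * S N)%nat by (unfold zsq; lia).
  replace (zsq (- Z.of_nat (S N))) with (S N * S N)%nat by (unfold zsq; lia). ring.
Qed.

(** The squares enter only through (k + 1 + N)^2 >= (k + 1)^2 + N, which gives a geometric majorant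
    after the first omitted term. *)
Lemma theta_null_tail (Q : C) (k : nat) : Cmod Q < 1 ->
  Cmod (theta_null Q - sym_sum (fun z => Q ^ zsq z)%C k)
    <= 2 * Cmod Q ^ (S k * S k) / (1 - Cmod Q).
Proof.
  intros HQ. set (r := Cmod Q) in *. assert (Hr : 0 <= r) by apply Cmod_ge_0.
  set (s := sym_sum (fun z => Q ^ zsq z)%C). set (p := r ^ (S k * S k)).
  apply Ccv_Cmod_le with (fun N => s (N + k)%nat - s k)%C.
  2: { apply Ccv_minus; [|apply Ccv_const]. apply (Ccv_incr_n s), sym_sum_theta_null, HQ. }
  intros N. apply Rle_trans with (2 * p / (1 - r) * (1 - r ^ N)).
  - induction N.
    + simpl. replace (s k - s k)%C with (RtoC 0) by ring. rewrite Cmod_0. lra.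
    + change (S N + k)%nat with (S (N + k)). unfold s at 1. rewrite sym_sum_theta_S. fold s.
      match goal with |- Cmod ?e <= _ => match e with (?u + ?t - ?v)%C =>
        replace e with ((u - v) + t)%C by (generalize u t v; intros; ring) end end.
      eapply Rle_trans; [apply Cmod_triangle|].
      rewrite Cmod_mult, Cmod_R, Rabs_pos_eq, Cmod_pow by lra. fold r.
      assert (X : r ^ (S (N + k) * S (N + k)) <= p * r ^ N).
      { unfold p. rewrite <- pow_add. apply pow_le_exponent; [lra | nia]. }
      replace (2 * p / (1 - r) * (1 - r ^ S N)) with
        (2 * p / (1 - r) * (1 - r ^ N) + 2 * (p * r ^ N)) by (simpl; field; lra). lra.
  - assert (0 <= p) by (apply pow_le; assumption).
    assert (0 <= 2 * p / (1 - r)) by (apply Rle_mult_inv_pos; lra).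
    assert (0 <= r ^ N) by (apply pow_le; assumption). nra.
Qed.

Lemma theta_null_near_1 (Q : C) : Cmod Q < 1 ->
  Cmod (theta_null Q - 1) <= 2 * Cmod Q / (1 - Cmod Q).
Proof.
  intros HQ. assert (H := theta_null_tail Q 0 HQ). rewrite sym_sum_0 in H.
  simpl Nat.mul in H. rewrite pow_1 in H. exact H.
Qed.

Lemma theta_null_second_order (Q : C) : Cmod Q < 1 ->
  Cmod (theta_null Q - (1 + 2 * Q)) <= 2 * Cmod Q ^ 4 / (1 - Cmod Q).
Proof.
  intros HQ. assert (H := theta_null_tail Q 1 HQ). rewrite sym_sum_theta_S, sym_sum_0 in H.
  simpl Nat.mul in H. rewrite Cpow_1_r in H. exact H.
Qed.

Lemma theta_null_quarter (Q : C) : Cmod Q <= / 4 -> Cmod (theta_null Q - 1) <= 2 / 3.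
Proof.
  intros HQ. eapply Rle_trans; [apply theta_null_near_1; lra|].
  apply Rmult_le_reg_r with (1 - Cmod Q); [lra|].
  replace (2 * Cmod Q / (1 - Cmod Q) * (1 - Cmod Q)) with (2 * Cmod Q) by (field; lra). lra.
Qed.

(** The disc of radius 2/3 about 1 lies in the sector, as 2/3 < 1/sqrt 2. Two theta values in this
    sector form an acute angle, so they are a good pair of roots. *)
Lemma theta_null_sector (Q : C) : Cmod Q <= / 4 ->
  Rabs (Im (theta_null Q)) < Re (theta_null Q).
Proof.
  intros HQ. assert (H := theta_null_quarter Q HQ).
  set (z := theta_null Q) in *.
  assert (H2 := Cmod2_alt (z - 1)). rewrite re_minus, im_minus, re_RtoC, im_RtoC in H2.
  assert (H0 := Cmod_ge_0 (z - 1)).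
  assert (Cmod (z - 1) ^ 2 <= 4 / 9) by nra.
  assert (Hs : (Re z - 1) ^ 2 + Im z ^ 2 <= 4 / 9) by (rewrite Rminus_0_r in H2; lra).
  assert ((Im z + (1 - Re z)) ^ 2 <= 8 / 9) by (assert (X := pow2_ge_0 (Im z - (1 - Re z))); nra).
  assert ((- Im z + (1 - Re z)) ^ 2 <= 8 / 9) by (assert (X := pow2_ge_0 (Im z + (1 - Re z))); nra).
  apply Rabs_def1; nra.
Qed.

Lemma theta_null_neq_0 (Q : C) : Cmod Q <= / 4 -> theta_null Q <> 0%C.
Proof.
  intros HQ E. assert (H := theta_null_quarter Q HQ). rewrite E in H.
  replace (0 - 1)%C with (- (1))%C in H by ring. rewrite Cmod_m1 in H. lra.
Qed.

(** Chained, this bounds exp from below by rational arithmetic: halve the argument until 1 + y <=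
    exp y is sharp enough, then square back. *)
Lemma exp_sqr_lower (y c d : R) : 0 <= c -> c <= exp (y / 2) -> d <= c * c -> d <= exp y.
Proof.
  intros Hc H Hd. replace y with (y / 2 + y / 2) by field. rewrite exp_plus. nra.
Qed.

Lemma exp_lower_linear (y : R) : 1 + y <= exp y.
Proof.
  destruct (Req_dec y 0) as [-> | H]; [rewrite exp_0; lra|]. left. apply exp_ineq1, H.
Qed.

Lemma exp_opp_upper (y c : R) : 0 < c -> c <= exp y -> exp (- y) <= / c.
Proof. intros Hc H. rewrite exp_Ropp. apply Rinv_le_contravar; assumption. Qed.

(** On R1 one has Re (1/a) = Im tau / |tau|^2, least at the corners 2i + 1/2 and 2i - 1/2, where it
    equals 2/(4 + 1/4) = 8/17. With pi > 3 the claim becomes exp(24/17) >= 4, reached by six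
    halvings. *)
Lemma Cmod_nome_quarter (a : C) : 8 / 17 <= Re a -> Cmod (nome a) <= / 4.
Proof.
  intros Ha. assert (Hpi := PI2_3_2).
  rewrite Cmod_nome. apply Rle_trans with (exp (- (24 / 17))).
  - apply exp_le_compat. nra.
  - apply exp_opp_upper; [lra|].
    apply (exp_sqr_lower _ 2.0025); [lra | | lra].
    apply (exp_sqr_lower _ 1.4152); [lra | | lra].
    apply (exp_sqr_lower _ 1.1897); [lra | | lra].
    apply (exp_sqr_lower _ 1.0908); [lra | | lra].
    apply (exp_sqr_lower _ 1.0445); [lra | | lra].
    apply (exp_sqr_lower _ 1.02202); [lra | | lra].
    eapply Rle_trans; [|apply exp_lower_linear]. lra.
Qed.

(** At a = 1 both nomes coincide and theta does not vanish, so [gint_theta_null] forces the Gaussian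
    integral to tend to 1. By [gint_mass] the limit of a G^2 is then 1 for every a, while G
    theta(1/a) tends to theta(a). *)
Lemma theta_null_modular (a : C) : 0 < Re a ->
  (a * theta_null (nome a) ^ 2 = theta_null (nome (/ a)) ^ 2)%C.
Proof.
  intros Ha.
  assert (H1 : Ccv (fun M => gint 1 0 (half_odd M)) 1).
  { assert (Hq : theta_null (nome 1) <> 0%C).
    { apply theta_null_neq_0, Cmod_nome_quarter. simpl. lra. }
    assert (H := gint_theta_null 1 ltac:(simpl; lra)).
    replace (/ 1)%C with (RtoC 1) in H by field.
    apply Ccv_ext with (fun M => - / theta_null (nome 1) *
      (theta_null (nome 1) - gint 1 0 (half_odd M) * theta_null (nome 1)) + 1)%C.
    - intros M. field. exact Hq.
    - refine (Ccv_eq _ _ _ (Ccv_plus _ _ _ _ (Ccv_scal _ _ _ H) (Ccv_const 1)) _). ring. }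
  assert (H2 := gint_mass a Ha). assert (H3 := gint_theta_null a Ha).
  set (T := theta_null (nome a)) in *. set (T' := theta_null (nome (/ a))) in *.
  apply Ccv_unique with (fun M => a * (gint a 0 (half_odd M) * T') ^ 2)%C.
  - apply Ccv_scal.
    assert (X : Ccv (fun M => gint a 0 (half_odd M) * T')%C T).
    { apply Ccv_ext with (fun M => T - (T - gint a 0 (half_odd M) * T'))%C; [intros; ring|].
      refine (Ccv_eq _ _ _ (Ccv_minus _ _ _ _ (Ccv_const T) H3) _). ring. }
    replace (T ^ 2)%C with (T * T)%C by ring.
    apply Ccv_ext with (fun M => (gint a 0 (half_odd M) * T') * (gint a 0 (half_odd M) * T'))%C;
      [intros; ring|]. apply Ccv_mult; exact X.
  - apply Ccv_ext with (fun M => ((a * gint a 0 (half_odd M) ^ 2 - gint 1 0 (half_odd M) ^ 2)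
      + gint 1 0 (half_odd M) * gint 1 0 (half_odd M)) * (T' ^ 2))%C; [intros; ring|].
    refine (Ccv_eq _ _ _ (Ccv_mult _ _ _ _
      (Ccv_plus _ _ _ _ H2 (Ccv_mult _ _ _ _ H1 H1)) (Ccv_const (T' ^ 2))) _). ring.
Qed.

(** * Theta values as Borchardt iterates *)

Definition nome_doubling (Q : C) (n : nat) : C := Nat.iter n (fun z => z ^ 2)%C Q.

Lemma nome_doubling_bound (Q : C) (n : nat) : Cmod Q <= / 4 ->
  Cmod (nome_doubling Q n) <= / 4 * (/ 2) ^ n.
Proof.
  intros HQ; induction n; [simpl; lra|].
  change (nome_doubling Q (S n)) with (nome_doubling Q n ^ 2)%C. rewrite Cmod_pow.
  assert (H := Cmod_ge_0 (nome_doubling Q n)).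
  assert (0 <= (/ 2) ^ n <= 1).
  { split; [apply pow_le; lra|]. replace 1 with ((/ 2) ^ 0) by reflexivity.
    apply pow_le_exponent; [lra | lia]. }
  simpl. nra.
Qed.

Lemma nome_doubling_quarter (Q : C) (n : nat) : Cmod Q <= / 4 -> Cmod (nome_doubling Q n) <= / 4.
Proof.
  intros HQ. eapply Rle_trans; [apply nome_doubling_bound, HQ|].
  assert ((/ 2) ^ n <= 1).
  { replace 1 with ((/ 2) ^ 0) by reflexivity. apply pow_le_exponent; [lra | lia]. }
  nra.
Qed.

(** Division by [T ^ 2] makes the first entry 1 at the start and turns the limit 1 of the theta
    squares into [/ T ^ 2]. The bound 1/4 persists under squaring of the nome, so the roots
    theta(q)/T and theta(-q)/T are acute at every stage. *)
Lemma agm_lim_theta (Q : C) : Cmod Q <= / 4 ->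
  0 < Re (theta_null (- Q) ^ 2 / theta_null Q ^ 2) ->
  agm_lim (theta_null (- Q) ^ 2 / theta_null Q ^ 2) = (/ theta_null Q ^ 2)%C.
Proof.
  intros HQ Hs. assert (HT := theta_null_neq_0 Q HQ). set (T := theta_null Q) in *.
  set (u := fun n => ((theta_null (nome_doubling Q n) ^ 2 / T ^ 2)%C,
    (theta_null (- nome_doubling Q n) ^ 2 / T ^ 2)%C)).
  assert (HT2 : (T ^ 2 <> 0)%C) by (apply Cpow_nz; exact HT).
  apply agm_lim_acute_iterates with u; [exact Hs | | |].
  - unfold u. simpl nome_doubling. f_equal. fold T. field. exact HT.
  - intros n. assert (Hq := nome_doubling_quarter Q n HQ).
    unfold u. change (nome_doubling Q (S n)) with (nome_doubling Q n ^ 2)%C.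
    set (q := nome_doubling Q n) in *.
    exists (theta_null q / T)%C, (theta_null (- q) / T)%C. cbn [fst snd].
    split; [field; exact HT|]. split; [field; exact HT|].
    rewrite <- theta_null_duplication, <- theta_null_duplication_product by lra. split.
    + assert (S1 := theta_null_sector q Hq).
      assert (S2 := theta_null_sector (- q) ltac:(rewrite Cmod_opp; exact Hq)).
      assert (P1 := Rabs_pos (Im (theta_null q))). assert (P2 := Rabs_pos (Im (theta_null (- q)))).
      apply Rabs_def2 in S1. apply Rabs_def2 in S2.
      set (z := theta_null q) in *. set (w := theta_null (- q)) in *.
      assert (HT' : (Cconj T <> 0)%C).
      { intros E. apply HT. apply (f_equal Cconj) in E. rewrite Cconj_conj in E.
        rewrite E. apply C_eq; simpl; ring. }
      replace (z / T * Cconj (w / T))%C with (RtoC (/ Cmod T ^ 2) * (z * Cconj w))%C.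
      * rewrite re_scal_l, re_mult, re_conj, im_conj.
        apply Rmult_lt_0_compat; [|nra].
        apply Rinv_0_lt_compat, pow_lt, Cmod_gt_0, HT.
      * rewrite RtoC_inv by (apply pow_nonzero, Rgt_not_eq, Cmod_gt_0, HT).
        rewrite Cmod2_conj. unfold Cdiv. rewrite Cmult_conj, Cinv_conj by exact HT.
        field. split; assumption.
    + f_equal; field; exact HT.
  - cbn [fst u]. apply Ccv_ext with
      (fun n => theta_null (nome_doubling Q n) * theta_null (nome_doubling Q n) * / T ^ 2)%C.
    + intros n. unfold u. cbn [fst]. field. exact HT.
    + assert (X : Ccv (fun n => theta_null (nome_doubling Q n)) 1).
      { apply Ccv_squeeze with (fun n => 1 * (/ 2) ^ n); [|apply is_lim_seq_half].
        intros n. assert (Hb := nome_doubling_bound Q n HQ). assert (Hq := nome_doubling_quarter Q n HQ).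
        assert (H0 := Cmod_ge_0 (nome_doubling Q n)).
        eapply Rle_trans; [apply theta_null_near_1; lra|].
        apply Rmult_le_reg_r with (1 - Cmod (nome_doubling Q n)); [lra|].
        unfold Rdiv. rewrite Rmult_assoc, Rinv_l by lra.
        assert (0 <= (/ 2) ^ n) by (apply pow_le; lra). nra. }
      refine (Ccv_eq _ _ _ (Ccv_mult _ _ _ _ (Ccv_mult _ _ _ _ X X) (Ccv_const (/ T ^ 2))) _). ring.
Qed.

(** * Holomorphic functions *)

Lemma continuous_Cmod_sqr {U : UniformSpace} (f : U -> C) (u : U) :
  Ccont f u -> continuous (fun u => Re (f u) ^ 2 + Im (f u) ^ 2) u.
Proof.
  intros [H1 H2].
  apply continuous_ext with (fun u => Re (f u) * Re (f u) + Im (f u) * Im (f u)).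
  - intros v. Req. ring.
  - exact (continuous_Rplus _ _ u (continuous_Rmult _ _ u H1 H1) (continuous_Rmult _ _ u H2 H2)).
Qed.

Lemma Ccont_inv {U : UniformSpace} (f : U -> C) (u : U) :
  Ccont f u -> f u <> 0%C -> Ccont (fun u => / f u)%C u.
Proof.
  intros H Hf. assert (Hs := continuous_Cmod_sqr f u H). destruct H as [H1 H2].
  assert (Hn : Re (f u) ^ 2 + Im (f u) ^ 2 <> 0).
  { rewrite <- Cmod2_alt. apply pow_nonzero, Rgt_not_eq, Cmod_gt_0, Hf. }
  assert (Hd : continuous (fun u => / (Re (f u) ^ 2 + Im (f u) ^ 2)) u).
  { apply (continuous_comp (fun u => Re (f u) ^ 2 + Im (f u) ^ 2) Rinv);
      [exact Hs | apply continuous_Rinv; exact Hn]. }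
  split.
  - exact (continuous_Rmult _ _ u H1 Hd).
  - refine (continuous_Rmult (fun u => - Im (f u)) _ u _ Hd).
    exact (continuous_opp (V := R_NormedModule) (fun u => Im (f u)) u H2).
Qed.

Lemma Ccont_div {U : UniformSpace} (f g : U -> C) (u : U) :
  Ccont f u -> Ccont g u -> g u <> 0%C -> Ccont (fun u => f u / g u)%C u.
Proof. intros Hf Hg H. exact (Ccont_mult f (fun u => / g u)%C u Hf (Ccont_inv g u Hg H)). Qed.

Lemma Ccont_id (z : C) : Ccont (fun z : C => z) z.
Proof. apply Ccont_eps. intros eps He. exists eps. auto. Qed.

(* Complex differentiability in Caratheodory's form. *)
Definition cdiff (f : C -> C) (z l : C) : Prop :=
  exists (phi : C -> C) (d : R), 0 < d /\
    (forall y, Cmod (y - z) < d -> f y = f z + phi y * (y - z))%C /\ phi z = l /\ Ccont phi z.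

Lemma cdiff_Ccont (f : C -> C) (z l : C) : cdiff f z l -> Ccont f z.
Proof.
  intros (phi & d & Hd & H & _ & Hc).
  assert (X : Ccont (fun y => f z + phi y * (y - z))%C z).
  { apply Ccont_plus; [apply Ccont_const|]. apply Ccont_mult; [exact Hc|].
    apply Ccont_minus; [apply Ccont_id | apply Ccont_const]. }
  apply Ccont_eps. intros eps He.
  destruct (proj1 (Ccont_eps _ _) X eps He) as (d' & Hd' & Hw).
  exists (Rmin d d'). split; [apply Rmin_glb_lt; assumption|]. intros w Hw'.
  assert (H1 := Rmin_l d d'). assert (H2 := Rmin_r d d').
  rewrite (H w) by lra. specialize (Hw w ltac:(lra)).
  replace (f z + phi z * (z - z))%C with (f z) in Hw by ring. exact Hw.
Qed.

Lemma cdiff_const (c z : C) : cdiff (fun _ => c) z 0.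
Proof.
  exists (fun _ => RtoC 0), 1. split; [lra|]. split; [intros; ring|].
  split; [reflexivity | apply Ccont_const].
Qed.

Lemma cdiff_id (z : C) : cdiff (fun z => z) z 1.
Proof.
  exists (fun _ => RtoC 1), 1. split; [lra|]. split; [intros; ring|].
  split; [reflexivity | apply Ccont_const].
Qed.

Lemma cdiff_plus (f g : C -> C) (z l m : C) :
  cdiff f z l -> cdiff g z m -> cdiff (fun z => f z + g z)%C z (l + m)%C.
Proof.
  intros (p & d & Hd & Hf & <- & Hp) (q & d' & Hd' & Hg & <- & Hq).
  exists (fun y => p y + q y)%C, (Rmin d d'). split; [apply Rmin_glb_lt; assumption|].
  assert (H1 := Rmin_l d d'). assert (H2 := Rmin_r d d'). split; [|split; [reflexivity|]].
  - intros y Hy. rewrite Hf, Hg by lra. ring.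
  - apply Ccont_plus; assumption.
Qed.

Lemma cdiff_mult (f g : C -> C) (z l m : C) :
  cdiff f z l -> cdiff g z m -> cdiff (fun z => f z * g z)%C z (l * g z + f z * m)%C.
Proof.
  intros Hf Hg. assert (Cg := cdiff_Ccont g z m Hg).
  destruct Hf as (p & d & Hd & Hf & <- & Hp), Hg as (q & d' & Hd' & Hg & <- & Hq).
  exists (fun y => p y * g y + f z * q y)%C, (Rmin d d'). split; [apply Rmin_glb_lt; assumption|].
  assert (H1 := Rmin_l d d'). assert (H2 := Rmin_r d d'). split; [|split; [reflexivity|]].
  - intros y Hy. rewrite Hf by lra. rewrite (Hg y) by lra. ring.
  - apply Ccont_plus; apply Ccont_mult; auto using Ccont_const.
Qed.

Lemma cdiff_comp (f g : C -> C) (z l m : C) :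
  cdiff f (g z) l -> cdiff g z m -> cdiff (fun z => f (g z)) z (l * m)%C.
Proof.
  intros (p & d & Hd & Hf & <- & Hp) Hg. assert (Cg := cdiff_Ccont g z m Hg).
  destruct Hg as (q & d' & Hd' & Hg & <- & Hq).
  destruct (proj1 (Ccont_eps _ _) Cg d Hd) as (d2 & Hd2 & Hw).
  exists (fun y => p (g y) * q y)%C, (Rmin d' d2). split; [apply Rmin_glb_lt; assumption|].
  assert (H1 := Rmin_l d' d2). assert (H2 := Rmin_r d' d2). split; [|split; [reflexivity|]].
  - intros y Hy. rewrite Hf by (apply Hw; lra). rewrite (Hg y) at 2 by lra. ring.
  - apply Ccont_mult; [apply Ccont_comp|]; assumption.
Qed.

Lemma cdiff_inv (z : C) : z <> 0%C -> cdiff Cinv z (- (/ z * / z))%C.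
Proof.
  intros Hz. assert (Hm := proj1 (Cmod_gt_0 z) Hz).
  exists (fun y => - (/ z * / y))%C, (Cmod z). split; [exact Hm|].
  split; [|split; [reflexivity|]].
  - intros y Hy. assert (y <> 0%C).
    { intros ->. rewrite Cmod_minus_sym in Hy. replace (z - 0)%C with z in Hy by ring. lra. }
    field. split; assumption.
  - apply Ccont_ext with (fun y => (- / z) * / y)%C; [intros; ring|].
    apply Ccont_mult; [apply Ccont_const | apply Ccont_inv; [apply Ccont_id | exact Hz]].
Qed.

Lemma Ccont_re_pos (z : C) : 0 < Re z -> exists d, 0 < d /\ forall y, Cmod (y - z) < d -> 0 < Re y.
Proof.
  intros Hz. exists (Re z). split; [exact Hz|]. intros y Hy.
  assert (H := re_le_Cmod (y - z)). rewrite re_minus in H.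
  assert (H' : Rabs (Re y - Re z) < Re z) by lra. apply Rabs_def2 in H'. lra.
Qed.

Lemma Ccont_csqrt (z : C) : 0 < Re z -> Ccont csqrt z.
Proof.
  intros Hz.
  assert (Hm : continuous (fun w : C => Cmod w) z).
  { assert (X : Ccont (fun w => RtoC (Cmod w)) z); [|exact (proj1 X)].
    apply Ccont_eps. intros eps He. exists eps. split; [exact He|]. intros w Hw.
    rewrite <- RtoC_minus, Cmod_R.
    assert (H1 := Cmod_triangle z (w - z)). replace (z + (w - z))%C with w in H1 by ring.
    assert (H2 := Cmod_triangle w (z - w)). replace (w + (z - w))%C with z in H2 by ring.
    rewrite (Cmod_minus_sym z w) in H2. apply Rabs_def1; lra. }
  assert (Hp : continuous (fun w : C => sqrt ((Cmod w + Re w) / 2)) z).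
  { apply (continuous_comp (fun w : C => (Cmod w + Re w) / 2) sqrt); [|apply continuous_sqrt].
    apply continuous_Rmult; [|apply continuous_const].
    apply continuous_Rplus; [exact Hm | exact (proj1 (Ccont_id z))]. }
  assert (Hpos : sqrt ((Cmod z + Re z) / 2) <> 0).
  { apply Rgt_not_eq, sqrt_lt_R0. assert (H := Cmod_ge_0 z). lra. }
  split; [exact Hp|].
  change (continuous (fun w : C => Im w * / (2 * sqrt ((Cmod w + Re w) / 2))) z).
  apply continuous_Rmult; [exact (proj2 (Ccont_id z))|].
  apply (continuous_comp (fun w : C => 2 * sqrt ((Cmod w + Re w) / 2)) Rinv).
  - apply continuous_Rmult; [apply continuous_const | exact Hp].
  - apply continuous_Rinv. lra.
Qed.

Lemma csqrt_sum_neq_0 (y z : C) : 0 < Re y -> 0 < Re z -> (csqrt y + csqrt z <> 0)%C.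
Proof.
  intros Hy Hz E. apply (f_equal Re) in E. rewrite re_plus in E. simpl (Re (RtoC 0)) in E.
  destruct (csqrt_spec y Hy) as [_ H1]. destruct (csqrt_spec z Hz) as [_ H2].
  assert (P1 := Rabs_pos (Im (csqrt y))). assert (P2 := Rabs_pos (Im (csqrt z))). lra.
Qed.

(** The slope function is explicit, since y - z is a difference of squares of roots; the sum of two
    principal roots has positive real part and cannot vanish. *)
Lemma cdiff_csqrt (z : C) : 0 < Re z -> cdiff csqrt z (/ (csqrt z + csqrt z))%C.
Proof.
  intros Hz. destruct (Ccont_re_pos z Hz) as (d & Hd & Hy).
  exists (fun y => / (csqrt y + csqrt z))%C, d. split; [exact Hd|].
  split; [|split; [reflexivity|]].
  - intros y Hyd. specialize (Hy y Hyd).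
    assert (Hn := csqrt_sum_neq_0 y z Hy Hz).
    replace (/ (csqrt y + csqrt z) * (y - z))%C with
      (/ (csqrt y + csqrt z) * (csqrt y ^ 2 - csqrt z ^ 2))%C.
    + field. exact Hn.
    + rewrite (proj1 (csqrt_spec y Hy)), (proj1 (csqrt_spec z Hz)). reflexivity.
  - apply Ccont_inv; [|apply csqrt_sum_neq_0; assumption].
    apply Ccont_plus; [apply Ccont_csqrt, Hz | apply Ccont_const].
Qed.

(** A continuous derivative is part of the notion because [cauchy_formula] differentiates under the
    integral sign. All functions here are built by operations that preserve it, so Goursat's theorem
    is bypassed. *)
Definition holo (U : C -> Prop) (f : C -> C) : Prop :=
  exists f', forall z, U z -> cdiff f z (f' z) /\ Ccont f' z.

Lemma holo_Ccont (U : C -> Prop) (f : C -> C) (z : C) : holo U f -> U z -> Ccont f z.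
Proof. intros [f' H] Hz. destruct (H z Hz) as [H1 _]. exact (cdiff_Ccont f z _ H1). Qed.

Lemma holo_const (U : C -> Prop) (c : C) : holo U (fun _ => c).
Proof. exists (fun _ => RtoC 0). intros z _. split; [apply cdiff_const | apply Ccont_const]. Qed.

Lemma holo_id (U : C -> Prop) : holo U (fun z => z).
Proof. exists (fun _ => RtoC 1). intros z _. split; [apply cdiff_id | apply Ccont_const]. Qed.

Lemma holo_plus (U : C -> Prop) (f g : C -> C) :
  holo U f -> holo U g -> holo U (fun z => f z + g z)%C.
Proof.
  intros [f' Hf] [g' Hg]. exists (fun z => f' z + g' z)%C. intros z Hz.
  destruct (Hf z Hz), (Hg z Hz). split; [apply cdiff_plus | apply Ccont_plus]; assumption.
Qed.

Lemma holo_mult (U : C -> Prop) (f g : C -> C) :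
  holo U f -> holo U g -> holo U (fun z => f z * g z)%C.
Proof.
  intros Hf Hg.
  assert (Cf := fun z => holo_Ccont U f z Hf). assert (Cg := fun z => holo_Ccont U g z Hg).
  destruct Hf as [f' Hf], Hg as [g' Hg]. exists (fun z => f' z * g z + f z * g' z)%C. intros z Hz.
  destruct (Hf z Hz), (Hg z Hz). split; [apply cdiff_mult; assumption|].
  apply Ccont_plus; apply Ccont_mult; auto.
Qed.

Lemma holo_minus (U : C -> Prop) (f g : C -> C) :
  holo U f -> holo U g -> holo U (fun z => f z - g z)%C.
Proof.
  intros Hf Hg.
  destruct (holo_plus U f _ Hf (holo_mult U _ g (holo_const U (- (1))%C) Hg)) as [h Hh].
  exists h. intros z Hz. destruct (Hh z Hz) as [(p & d & Hd & Hp & E & Hc) Hh2].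
  split; [|exact Hh2]. exists p, d. split; [exact Hd|]. split; [|auto].
  intros y Hy. specialize (Hp y Hy).
  replace (f y - g y)%C with (f y + - (1) * g y)%C by ring. rewrite Hp. ring.
Qed.

Lemma holo_inv (U : C -> Prop) (f : C -> C) :
  (forall z, U z -> f z <> 0%C) -> holo U f -> holo U (fun z => / f z)%C.
Proof.
  intros Hn Hf. assert (Cf := fun z => holo_Ccont U f z Hf). destruct Hf as [f' Hf].
  exists (fun z => - (/ f z * / f z) * f' z)%C. intros z Hz. destruct (Hf z Hz) as [H1 H2]. split.
  - apply (cdiff_comp Cinv f); [apply cdiff_inv; auto | exact H1].
  - apply Ccont_mult; [|exact H2].
    apply Ccont_ext with (fun z => - (1) * (/ f z * / f z))%C; [intros; ring|].
    apply Ccont_mult; [apply Ccont_const | apply Ccont_mult; apply Ccont_inv; auto].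
Qed.

Lemma holo_div (U : C -> Prop) (f g : C -> C) :
  (forall z, U z -> g z <> 0%C) -> holo U f -> holo U g -> holo U (fun z => f z / g z)%C.
Proof. intros Hn Hf Hg. exact (holo_mult U f _ Hf (holo_inv U g Hn Hg)). Qed.

Lemma holo_csqrt (U : C -> Prop) (f : C -> C) :
  (forall z, U z -> 0 < Re (f z)) -> holo U f -> holo U (fun z => csqrt (f z)).
Proof.
  intros Hn Hf. assert (Cf := fun z => holo_Ccont U f z Hf). destruct Hf as [f' Hf].
  exists (fun z => / (csqrt (f z) + csqrt (f z)) * f' z)%C. intros z Hz.
  destruct (Hf z Hz) as [H1 H2]. split.
  - apply (cdiff_comp csqrt f); [apply cdiff_csqrt; auto | exact H1].
  - assert (Cs : Ccont (fun z => csqrt (f z)) z)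
      by (apply (Ccont_comp f csqrt); [|apply Ccont_csqrt]; auto).
    apply Ccont_mult; [|exact H2]. apply Ccont_inv; [apply Ccont_plus; exact Cs|].
    apply csqrt_sum_neq_0; auto.
Qed.

(** * Cauchy's formula on a disc *)

Lemma is_derive_caratheodory (f psi : R -> R) (t d : R) : 0 < d ->
  (forall s, Rabs (s - t) < d -> f s = f t + psi s * (s - t)) -> continuous psi t ->
  is_derive f t (psi t).
Proof.
  intros Hd H Hc. apply is_derive_Reals. intros eps He.
  apply filterlim_locally with (eps := mkposreal eps He) in Hc. destruct Hc as [d' Hd'].
  assert (Hm : 0 < Rmin d d') by (apply Rmin_glb_lt; [exact Hd | apply cond_pos]).
  exists (mkposreal _ Hm). intros h Hh0 Hh. simpl in Hh.
  assert (H1 := Rmin_l d d'). assert (H2 := Rmin_r d d').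
  rewrite H by (replace (t + h - t) with h by ring; lra).
  replace ((f t + psi (t + h) * (t + h - t) - f t) / h) with (psi (t + h)) by (field; exact Hh0).
  apply Hd'. change (Rabs (t + h - t) < d'). replace (t + h - t) with h by ring. lra.
Qed.

Lemma is_derive_slope (f : R -> R) (t l : R) : is_derive f t l ->
  exists psi, (forall s, f s = f t + psi s * (s - t)) /\ psi t = l /\ continuous psi t.
Proof.
  intros H. set (g := fun h => f (t + h)).
  assert (Hg : is_derive g 0 l).
  { apply is_derive_Reals in H. apply is_derive_Reals. intros eps He.
    destruct (H eps He) as [d Hd]. exists d. intros h Hh0 Hh. specialize (Hd h Hh0 Hh).
    unfold g. rewrite Rplus_0_l, Rplus_0_r. exact Hd. }
  exists (fun s => slope0 g (s - t)). split; [|split].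
  - intros s. rewrite slope0_mult. unfold g. rewrite Rplus_0_r.
    replace (t + (s - t)) with s by ring. ring.
  - rewrite Rminus_diag, slope0_0. apply is_derive_unique, Hg.
  - apply (continuous_comp (fun s => s - t) (slope0 g)).
    + apply continuous_Rminus; [apply continuous_id | apply continuous_const].
    + rewrite Rminus_diag. apply continuous_slope0; [eexists; exact Hg|].
      apply (ex_derive_continuous (K := R_AbsRing) (V := R_NormedModule)). eexists; exact Hg.
Qed.

(** The slopes of the two parts of [g] combine into one complex slope [q], and the Caratheodory
    factors of [f] and [g] simply multiply. *)
Lemma is_Cderive_comp (f : C -> C) (g : R -> C) (t : R) (l m : C) :
  cdiff f (g t) l -> is_Cderive g t m -> is_Cderive (fun t => f (g t)) t (l * m)%C.
Proof.
  intros (p & d & Hd & Hf & <- & Hp) Hg. assert (Cg := is_Cderive_cont g t m Hg).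
  destruct Hg as [G1 G2].
  destruct (is_derive_slope _ _ _ G1) as (q1 & E1 & F1 & C1).
  destruct (is_derive_slope _ _ _ G2) as (q2 & E2 & F2 & C2).
  set (q := fun s => (q1 s, q2 s) : C).
  assert (Hq : forall s, (g s = g t + q s * RtoC (s - t))%C).
  { intros s. apply C_eq; rewrite ?re_plus, ?im_plus, ?re_scal_r, ?im_scal_r; [apply E1 | apply E2]. }
  assert (Cq : Ccont q t) by (split; assumption).
  destruct (proj1 (Ccont_locally g t) Cg d Hd) as [e He].
  assert (Hpsi : forall s, Rabs (s - t) < e -> (f (g s) = f (g t) + (p (g s) * q s) * RtoC (s - t))%C).
  { intros s Hs. rewrite Hf by (apply He; exact Hs).
    replace (g s - g t)%C with (q s * RtoC (s - t))%C by (rewrite (Hq s); ring). ring. }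
  assert (Cpsi : Ccont (fun s => p (g s) * q s)%C t).
  { apply Ccont_mult; [apply (Ccont_comp g p); assumption | exact Cq]. }
  assert (Em : m = q t).
  { apply C_eq; simpl; symmetry; assumption. }
  rewrite Em.
  split.
  - apply (is_derive_caratheodory (fun s => Re (f (g s))) (fun s => Re (p (g s) * q s)%C) t e);
      [apply cond_pos | | exact (proj1 Cpsi)].
    intros s Hs. rewrite (Hpsi s Hs), re_plus, re_scal_r. reflexivity.
  - apply (is_derive_caratheodory (fun s => Im (f (g s))) (fun s => Im (p (g s) * q s)%C) t e);
      [apply cond_pos | | exact (proj2 Cpsi)].
    intros s Hs. rewrite (Hpsi s Hs), im_plus, im_scal_r. reflexivity.
Qed.

Definition circ (r theta : R) : C := (RtoC r * Cexp (Ci * RtoC theta))%C.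

(** This is dz/(z - w) on the circle |z| = r, divided by i times the angle element, since dz = i z d
    theta. *)
Definition cauchy_kernel (r : R) (w : C) (theta : R) : C := (circ r theta / (circ r theta - w))%C.

Lemma Cmod_circ (r theta : R) : 0 < r -> Cmod (circ r theta) = r.
Proof.
  intros Hr. unfold circ. rewrite Cmod_mult, Cmod_Cexp, Cmod_R, Rabs_pos_eq by lra.
  replace (Re (Ci * RtoC theta)) with 0 by (simpl; ring). rewrite exp_0. ring.
Qed.

Lemma circ_neq (r theta : R) (w : C) : 0 < r -> Cmod w < r -> (circ r theta - w <> 0)%C.
Proof.
  intros Hr Hw E. assert (H := Cmod_circ r theta Hr).
  replace (circ r theta) with (circ r theta - w + w)%C in H by ring.
  rewrite E, Cplus_0_l in H. lra.
Qed.

Lemma circ_neq_0 (r theta : R) : 0 < r -> circ r theta <> 0%C.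
Proof. intros Hr. apply Cmod_gt_0. rewrite Cmod_circ; assumption. Qed.

Lemma Ccont_circ (r theta : R) : Ccont (circ r) theta.
Proof. unfold circ. ccont. Qed.

Lemma is_Cderive_circ (r theta : R) : is_Cderive (circ r) theta (Ci * circ r theta)%C.
Proof. unfold circ. eapply is_Cderive_eq; [cderive | ring]. Qed.

Lemma Ccont_cauchy_kernel (r theta : R) (w : C) : 0 < r -> Cmod w < r ->
  Ccont (cauchy_kernel r w) theta.
Proof.
  intros Hr Hw. apply Ccont_div; [apply Ccont_circ | | apply circ_neq; assumption].
  apply Ccont_minus; [apply Ccont_circ | apply Ccont_const].
Qed.

Lemma Cmod_cauchy_kernel (r theta : R) (w : C) : 0 < r -> Cmod w < r ->
  Cmod (cauchy_kernel r w theta) <= r / (r - Cmod w).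
Proof.
  intros Hr Hw. unfold cauchy_kernel. rewrite Cmod_div by (apply circ_neq; assumption).
  rewrite Cmod_circ by assumption. apply Rmult_le_compat_l; [lra|].
  apply Rinv_le_contravar; [lra|].
  assert (H := Cmod_triangle_lower (circ r theta) (- w)). rewrite Cmod_circ, Cmod_opp in H by assumption.
  exact H.
Qed.

Lemma circ_periodic (r : R) : circ r (2 * PI) = circ r 0.
Proof.
  unfold circ. f_equal.
  assert (H := Cexp_2PI_Z 1).
  replace (2 * Ci * RtoC PI * RtoC (IZR 1))%C with (Ci * RtoC (2 * PI))%C in H
    by (rewrite RtoC_mult; ring).
  rewrite H. replace (Ci * 0)%C with (RtoC 0) by ring. rewrite Cexp_0. reflexivity.
Qed.

Lemma cauchy_kernel_geometric (r theta : R) (w : C) (N : nat) : 0 < r -> Cmod w < r ->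
  cauchy_kernel r w theta =
  (csum (fun n => (/ circ r theta) ^ n * w ^ n) N
   + (w * / circ r theta) ^ N * cauchy_kernel r w theta)%C.
Proof.
  intros Hr Hw. assert (H0 := circ_neq_0 r theta Hr). assert (H1 := circ_neq r theta w Hr Hw).
  induction N; [simpl; ring|].
  rewrite IHN at 1. cbn [csum]. rewrite Cpow_S, Cpow_mult_l.
  set (u := ((/ circ r theta) ^ N)%C). set (v := (w ^ N)%C).
  unfold cauchy_kernel. field. split; assumption.
Qed.

(** Serves twice: with g = 1 it evaluates the integral of the kernel, and with boundary values of a
    function it yields the power series. *)
Lemma cauchy_kernel_expansion (g : R -> C) (r : R) (w : C) :
  0 < r -> Cmod w < r -> (forall x, Ccont g x) ->
  Ccv (csum (fun n => w ^ n * cint (fun th => g th * (/ circ r th) ^ n) 0 (2 * PI)))%C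
    (cint (fun th => g th * cauchy_kernel r w th)%C 0 (2 * PI)).
Proof.
  intros Hr Hw Hg. assert (Hpi := PI_RGT_0).
  assert (Hi : forall x, Ccont (fun th => / circ r th)%C x).
  { intros x. apply Ccont_inv; [apply Ccont_circ | apply circ_neq_0, Hr]. }
  assert (Hip : forall n x, Ccont (fun th => (/ circ r th) ^ n)%C x).
  { induction n; intros x; [apply Ccont_const | apply Ccont_mult; auto]. }
  assert (Hk : forall x, Ccont (cauchy_kernel r w) x) by (intros; apply Ccont_cauchy_kernel; assumption).
  assert (Hw0 := Cmod_ge_0 w).
  set (c := r / (r - Cmod w)).
  set (q := Cmod w / r).
  assert (Hq : 0 <= q < 1).
  { unfold q. split; [apply Rle_mult_inv_pos; assumption|].
    apply Rmult_lt_reg_r with r; [assumption|]. unfold Rdiv. rewrite Rmult_assoc, Rinv_l; lra. }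
  assert (Hgc : forall x, continuous (fun th => Cmod (g th)) x).
  { intros x.
    apply (continuous_comp (fun th => Re (g th) ^ 2 + Im (g th) ^ 2) sqrt); [|apply continuous_sqrt].
    apply continuous_Cmod_sqr, Hg. }
  apply Ccv_squeeze with (fun N => 2 * (c * RInt (fun th => Cmod (g th)) 0 (2 * PI)) * q ^ N).
  - intros N.
    assert (E : (cint (fun th => g th * cauchy_kernel r w th) 0 (2 * PI) =
      csum (fun n => w ^ n * cint (fun th => g th * (/ circ r th) ^ n) 0 (2 * PI)) N
      + cint (fun th => g th * ((w * / circ r th) ^ N * cauchy_kernel r w th)) 0 (2 * PI))%C).
    { rewrite (csum_ext _ (fun n => cint (fun th => w ^ n * (g th * (/ circ r th) ^ n))%C 0 (2 * PI))).
      2: { intros n _. symmetry. apply cint_scal. intros; apply Ccont_mult; auto. }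
      rewrite <- (cint_csum (fun n th => w ^ n * (g th * (/ circ r th) ^ n))%C).
      - rewrite <- cint_plus.
        + apply cint_ext. intros th. rewrite (cauchy_kernel_geometric r th w N Hr Hw) at 1.
          rewrite (csum_ext (fun k => w ^ k * (g th * (/ circ r th) ^ k))%C
            (fun k => g th * ((/ circ r th) ^ k * w ^ k))%C) by (intros; ring).
          rewrite csum_scal. ring.
        + intros x. apply (Ccont_csum (fun n th => w ^ n * (g th * (/ circ r th) ^ n))%C).
          intros; apply Ccont_mult; [apply Ccont_const | apply Ccont_mult; auto].
        + intros x. apply Ccont_mult; [auto|]. apply Ccont_mult; [|auto].
          apply Ccont_ext with (fun th => w ^ N * (/ circ r th) ^ N)%C;
            [intros; symmetry; apply Cpow_mult_l|]. apply Ccont_mult; auto using Ccont_const.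
      - intros; apply Ccont_mult; [apply Ccont_const | apply Ccont_mult; auto]. }
    rewrite E, Cmod_minus_sym.
    match goal with |- Cmod ?e <= _ => match e with (?s + ?t - ?s)%C =>
      replace e with t by (generalize s t; intros; ring) end end.
    apply Rle_trans with (2 * RInt (fun th => (c * q ^ N) * Cmod (g th)) 0 (2 * PI)).
    + apply cint_bound; [lra | | |].
      * intros x. apply Ccont_mult; [auto|]. apply Ccont_mult; [|auto].
        apply Ccont_ext with (fun th => w ^ N * (/ circ r th) ^ N)%C;
          [intros; symmetry; apply Cpow_mult_l|]. apply Ccont_mult; auto using Ccont_const.
      * intros x. apply continuous_Rmult; [apply continuous_const | apply Hgc].
      * intros x _. rewrite !Cmod_mult, Cmod_pow, Cmod_mult, Cmod_inv, Cmod_circ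
          by (auto using circ_neq_0).
        fold (Rdiv (Cmod w) r). fold q. rewrite Rmult_comm.
        apply Rmult_le_compat_r; [apply Cmod_ge_0|]. rewrite Rmult_comm.
        apply Rmult_le_compat_r; [apply pow_le; lra | apply Cmod_cauchy_kernel; assumption].
    + right. assert (Er : RInt (fun th => c * q ^ N * Cmod (g th)) 0 (2 * PI)
        = c * q ^ N * RInt (fun th => Cmod (g th)) 0 (2 * PI)).
      { apply is_RInt_unique. apply (is_RInt_scal (V := R_NormedModule)).
        apply (RInt_correct (V := R_CompleteNormedModule)), ex_RInt_cont, Hgc. }
      rewrite Er. ring.
  - apply is_lim_seq_scal_0, is_lim_seq_geom. rewrite Rabs_pos_eq; lra.
Qed.

Lemma cint_circ (r : R) : cint (circ r) 0 (2 * PI) = 0%C.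
Proof.
  assert (H := cint_FTC _ _ 0 (2 * PI) (is_Cderive_circ r)
    (fun x => Ccont_mult _ _ x (Ccont_const Ci x) (Ccont_circ r x))).
  rewrite cint_scal, circ_periodic in H by apply Ccont_circ.
  apply (f_equal (fun z => - Ci * z)%C) in H.
  replace (- Ci * (Ci * cint (circ r) 0 (2 * PI)))%C
    with (- (Ci * Ci) * cint (circ r) 0 (2 * PI))%C in H by ring.
  replace (Ci * Ci)%C with (- (1))%C in H by (apply C_eq; simpl; ring).
  replace (- - (1) * cint (circ r) 0 (2 * PI))%C with (cint (circ r) 0 (2 * PI)) in H by ring.
  rewrite H. ring.
Qed.

Lemma cint_const (c : C) (a b : R) : cint (fun _ => c) a b = (RtoC (b - a) * c)%C.
Proof.
  apply C_eq; rewrite ?re_scal_l, ?im_scal_l; unfold cint; cbn [Re Im fst snd];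
    rewrite RInt_const; reflexivity.
Qed.

Lemma cint_circ_inv_pow (r : R) (n : nat) : 0 < r ->
  cint (fun th => 1 * (/ circ r th) ^ S n)%C 0 (2 * PI) = 0%C.
Proof.
  intros Hr.
  set (c := (- (RtoC (INR (S n)) * Ci))%C).
  assert (E : forall th, ((/ circ r th) ^ S n = (/ RtoC r) ^ S n * Cexp (c * RtoC th))%C).
  { intros th. unfold circ.
    assert (Hr0 : RtoC r <> 0%C) by (intros E; apply RtoC_inj in E; lra).
    replace (/ (RtoC r * Cexp (Ci * RtoC th)))%C with (/ RtoC r * Cexp (- (Ci * RtoC th)))%C
      by (rewrite Cexp_opp; field; split; [apply Cexp_neq_0 | exact Hr0]).
    rewrite Cpow_mult_l, <- Cexp_nat. f_equal. f_equal. unfold c. ring. }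
  rewrite (cint_ext _ (fun th => (/ RtoC r) ^ S n * Cexp (c * RtoC th))%C)
    by (intros; rewrite E; ring).
  rewrite cint_scal by ccont.
  assert (D : forall x, is_Cderive (fun th => Cexp (c * RtoC th)) x (c * Cexp (c * RtoC x))%C).
  { intros x. eapply is_Cderive_eq; [cderive | ring]. }
  assert (H := cint_FTC _ _ 0 (2 * PI) D ltac:(ccont)).
  rewrite cint_scal in H by ccont.
  replace (Cexp (c * RtoC (2 * PI))) with (RtoC 1) in H.
  2: { symmetry. rewrite <- (Cexp_2PI_Z (- Z.of_nat (S n))). f_equal.
       unfold c. rewrite opp_IZR, RtoC_opp, <- INR_IZR_INZ, RtoC_mult. ring. }
  replace (Cexp (c * 0)) with (RtoC 1) in H
    by (rewrite <- Cexp_0; f_equal; ring).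
  assert (Hc : c <> 0%C).
  { unfold c. intros E0. apply (f_equal Im) in E0. rewrite im_opp, im_scal_l in E0.
    simpl (Im Ci) in E0. simpl (Im (RtoC 0)) in E0. assert (P := pos_INR n). rewrite S_INR in E0. lra. }
  replace (cint (fun th => Cexp (c * RtoC th)) 0 (2 * PI))
    with (/ c * (c * cint (fun th => Cexp (c * RtoC th)) 0 (2 * PI)))%C by (field; exact Hc).
  rewrite H. ring.
Qed.

Lemma cint_cauchy_kernel (r : R) (w : C) : 0 < r -> Cmod w < r ->
  cint (cauchy_kernel r w) 0 (2 * PI) = RtoC (2 * PI).
Proof.
  intros Hr Hw.
  assert (H := cauchy_kernel_expansion (fun _ => RtoC 1) r w Hr Hw (fun x => Ccont_const _ x)).
  rewrite (cint_ext _ (cauchy_kernel r w)) in H by (intros; ring).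
  refine (Ccv_unique _ _ _ (Ccv_incr_n _ 1 _ H) _).
  apply Ccv_ext with (fun _ => RtoC (2 * PI)); [|apply Ccv_const].
  intros N. rewrite Nat.add_1_r, csum_split_first.
  rewrite (csum_ext _ (fun _ => RtoC 0)).
  - rewrite csum_0. simpl Cpow.
    rewrite (cint_ext _ (fun _ => RtoC 1)) by (intros; ring).
    rewrite cint_const, Rminus_0_r. ring.
  - intros k _. rewrite cint_circ_inv_pow by exact Hr. ring.
Qed.

Definition open_disc (z0 : C) (R0 : R) (z : C) : Prop := Cmod (z - z0) < R0.

(** The circle is contracted to w along [P]. The derivative of P in t is circ - w, which cancels the
    denominator of the kernel, so the derivative of the integral is that of f'(P) circ. For t <> 0
    this integrand is a theta-derivative divided by i t, and its integral over a period is 0. Hence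
    the value at t = 1 is that at t = 0, where f is constant. *)
Lemma cauchy_formula (f : C -> C) (z0 w : C) (r R0 : R) :
  0 < r < R0 -> holo (open_disc z0 R0) f -> Cmod w < r ->
  cint (fun th => f (z0 + circ r th) * cauchy_kernel r w th)%C 0 (2 * PI)
  = (RtoC (2 * PI) * f (z0 + w))%C.
Proof.
  intros [Hr HR] Hf Hw. assert (Hpi := PI_RGT_0).
  assert (Cf := fun z => holo_Ccont _ f z Hf). destruct Hf as [f' Hf].
  assert (Hw0 := Cmod_ge_0 w).
  set (P := fun t th => (z0 + (w + RtoC t * (circ r th - w)))%C).
  (* Room around [0, 1], so that derivatives in t are two-sided at its end points: (1 + 2d) r is the
     midpoint of r and R0. *)
  set (d := (R0 - r) / (4 * r)).
  assert (Hd : 0 < d) by (apply Rdiv_lt_0_compat; lra).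
  assert (HP : forall t th, - d <= t <= 1 + d -> open_disc z0 R0 (P t th)).
  { intros t th Ht. unfold open_disc, P.
    replace (z0 + (w + RtoC t * (circ r th - w)) - z0)%C with
      (RtoC (1 - t) * w + RtoC t * circ r th)%C by (rewrite RtoC_minus; ring).
    eapply Rle_lt_trans; [apply Cmod_triangle|].
    rewrite !Cmod_mult, !Cmod_R, Cmod_circ by assumption.
    apply Rle_lt_trans with ((1 + 2 * d) * r).
    - assert (Rabs (1 - t) * Cmod w <= Rabs (1 - t) * r)
        by (apply Rmult_le_compat_l; [apply Rabs_pos | lra]).
      assert (Rabs (1 - t) + Rabs t <= 1 + 2 * d)
        by (unfold Rabs; destruct (Rcase_abs (1 - t)), (Rcase_abs t); lra). nra.
    - unfold d. replace ((1 + 2 * ((R0 - r) / (4 * r))) * r) with (r + (R0 - r) / 2)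
        by (field; lra). lra. }
  assert (CP : forall t th, Ccont (P t) th).
  { intros t th. unfold P, circ. ccont. }
  assert (CP2 : forall t th, Ccont (fun p : R * R => P (fst p) (snd p)) (t, th)).
  { intros t th. unfold P, circ. ccont. }
  assert (CK : forall th, Ccont (cauchy_kernel r w) th)
    by (intros; apply Ccont_cauchy_kernel; assumption).
  set (G := fun t => cint (fun th => f (P t th) * cauchy_kernel r w th)%C 0 (2 * PI)).
  assert (DG : forall t, 0 <= t <= 1 ->
    is_Cderive G t (cint (fun th => f' (P t th) * circ r th)%C 0 (2 * PI))).
  { intros t Ht.
    apply (is_Cderive_cint (fun t th => f (P t th) * cauchy_kernel r w th)%C
      (fun t th => f' (P t th) * circ r th)%C 0 (2 * PI) t d Hd).
    - intros s th Hs. apply Rabs_def2 in Hs.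
      assert (Ds : is_Cderive (fun s => P s th) s (circ r th - w)%C).
      { unfold P. eapply is_Cderive_eq; [cderive | ring]. }
      assert (Dc := is_Cderive_comp f (fun s => P s th) s _ _ (proj1 (Hf _ (HP s th ltac:(lra)))) Ds).
      eapply is_Cderive_eq; [cderive|].
      unfold cauchy_kernel. field. apply circ_neq; assumption.
    - intros th. apply Ccont_mult.
      + apply (Ccont_comp (fun p : R * R => P (fst p) (snd p)) f'); [apply CP2|].
        apply Hf, HP. simpl. lra.
      + unfold circ. ccont.
    - intros s th Hs. apply Rabs_def2 in Hs.
      apply Ccont_mult; [|apply CK]. apply (Ccont_comp (P s) f); [apply CP|].
      apply Cf, HP. lra. }
  (* At t = 0 division by t is impossible, but then f'(P) is constant and the integral of circ
     vanishes. *)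
  assert (Z : forall t, 0 <= t <= 1 -> cint (fun th => f' (P t th) * circ r th)%C 0 (2 * PI) = 0%C).
  { intros t Ht. destruct (Req_dec t 0) as [-> | Ht0].
    - rewrite (cint_ext _ (fun th => f' (z0 + w)%C * circ r th)%C).
      + rewrite cint_scal, cint_circ by apply Ccont_circ. ring.
      + intros th. unfold P. do 2 f_equal. ring.
    - assert (Ci0 : (Ci * RtoC t <> 0)%C).
      { intros E. apply (f_equal Im) in E. rewrite im_scal_r in E. simpl in E. lra. }
      assert (Cg : forall th, Ccont (fun th => f' (P t th) * circ r th)%C th).
      { intros th. apply Ccont_mult; [|apply Ccont_circ].
        apply (Ccont_comp (P t) f'); [apply CP | apply Hf, HP; lra]. }
      assert (D : forall th, is_Cderive (fun th => f (P t th)) th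
        (Ci * RtoC t * (f' (P t th) * circ r th))%C).
      { intros th. assert (Dz := is_Cderive_circ r th).
        assert (Ds : is_Cderive (P t) th (RtoC t * (Ci * circ r th))%C).
        { unfold P. apply is_Cderive_ext with (fun th => z0 + (w + RtoC t * (circ r th + - w)))%C;
            [intros; ring|]. eapply is_Cderive_eq; [cderive | ring]. }
        eapply is_Cderive_eq;
          [exact (is_Cderive_comp f (P t) th _ _ (proj1 (Hf _ (HP t th ltac:(lra)))) Ds)|]. ring. }
      assert (H := cint_FTC _ _ 0 (2 * PI) D (fun th => Ccont_mult _ _ th (Ccont_const _ th) (Cg th))).
      rewrite cint_scal in H by exact Cg.
      unfold P at 2 3 in H. rewrite circ_periodic in H.
      match type of H with (_ * ?I = _)%C => replace I with (/ (Ci * RtoC t) * (Ci * RtoC t * I))%C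
        by (field; split; intros E; apply Ci0; rewrite E; ring) end.
      rewrite H. ring. }
  assert (E : Cmod (G 1 - G 0) <= 2 * 0 * (1 - 0)).
  { refine (Cderive_increment_bound G _ 0 1 0 ltac:(lra) DG _).
    intros t Ht. rewrite Z by exact Ht. rewrite Cmod_0. lra. }
  assert (E0 : G 1 = G 0).
  { assert (H : Cmod (G 1 - G 0) = 0) by (assert (H := Cmod_ge_0 (G 1 - G 0)); lra).
    apply Cmod_eq_0 in H. replace (G 1) with (G 1 - G 0 + G 0)%C by ring. rewrite H. ring. }
  unfold G in E0.
  rewrite (cint_ext _ (fun th => f (z0 + circ r th) * cauchy_kernel r w th)%C) in E0
    by (intros; unfold P; do 2 f_equal; ring).
  rewrite E0, (cint_ext _ (fun th => f (z0 + w) * cauchy_kernel r w th)%C)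
    by (intros; unfold P; do 2 f_equal; ring).
  rewrite cint_scal, cint_cauchy_kernel by assumption. ring.
Qed.

Lemma is_pseries_csum (a : nat -> C) (x l : C) :
  Ccv (csum (fun n => x ^ n * a n)%C) l -> @is_pseries C_AbsRing C_NormedModule a x l.
Proof.
  intros H. unfold is_pseries, is_series.
  apply (Ccv_incr_n _ 1) in H. apply Ccv_filterlim in H.
  refine (filterlim_ext _ _ _ H).
  intros n. rewrite Nat.add_1_r, <- csum_sum_n. apply sum_n_ext. intros k.
  reflexivity.
Qed.

(* Cauchy's formula passes to uniform limits, and expanding its kernel gives the power series. *)
Lemma uniform_limit_power_series (f : nat -> C -> C) (g : C -> C) (e : nat -> R) (z0 : C) (R0 : R) :
  0 < R0 -> (forall n, holo (open_disc z0 R0) (f n)) -> is_lim_seq e 0 ->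
  (forall n z, open_disc z0 R0 z -> Cmod (f n z - g z) <= e n) ->
  exists (a : nat -> C) (r : R), 0 < r /\ forall x, Cmod (x - z0) < r ->
    @is_pseries C_AbsRing C_NormedModule a (x - z0)%C (g x).
Proof.
  intros HR Hf He Hu. assert (Hpi := PI_RGT_0).
  set (r := R0 / 2). assert (Hr : 0 < r) by (unfold r; lra).
  assert (Hrd : forall th, open_disc z0 R0 (z0 + circ r th)%C).
  { intros th. unfold open_disc. replace (z0 + circ r th - z0)%C with (circ r th) by ring.
    rewrite Cmod_circ by exact Hr. unfold r; lra. }
  assert (Cg : forall z, open_disc z0 R0 z -> Ccont g z).
  { intros z Hz. apply Ccont_eps. intros eps Heps.
    assert (He3 : 0 < eps / 3) by lra.
    apply is_lim_seq_spec in He. destruct (He (mkposreal _ He3)) as [N HN].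
    specialize (HN N (Nat.le_refl N)). simpl in HN. rewrite Rminus_0_r in HN.
    apply Rabs_def2 in HN.
    destruct (proj1 (Ccont_eps _ _) (holo_Ccont _ _ z (Hf N) Hz) _ He3) as (d & Hd & Hw).
    exists (Rmin d (R0 - Cmod (z - z0))). unfold open_disc in Hz.
    split; [apply Rmin_glb_lt; lra|]. intros w Hww.
    assert (H1 := Rmin_l d (R0 - Cmod (z - z0))). assert (H2 := Rmin_r d (R0 - Cmod (z - z0))).
    specialize (Hw w ltac:(lra)).
    assert (Hdw : open_disc z0 R0 w).
    { unfold open_disc. replace (w - z0)%C with ((w - z) + (z - z0))%C by ring.
      eapply Rle_lt_trans; [apply Cmod_triangle | lra]. }
    assert (U1 := Hu N w Hdw). assert (U2 := Hu N z Hz).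
    replace (g w - g z)%C with ((f N w - f N z) - (f N w - g w) + (f N z - g z))%C by ring.
    eapply Rle_lt_trans; [apply Cmod_triangle|].
    assert (T := Cmod_triangle_minus (f N w - f N z) (f N w - g w)). lra. }
  assert (Cgc : forall h : C -> C, (forall z, open_disc z0 R0 z -> Ccont h z) ->
    forall th, Ccont (fun th => h (z0 + circ r th))%C th).
  { intros h Hh th. apply (Ccont_comp (fun th => z0 + circ r th)%C h).
    - unfold circ; ccont.
    - apply Hh, Hrd. }
  assert (Hform : forall w, Cmod w < r ->
    cint (fun th => g (z0 + circ r th) * cauchy_kernel r w th)%C 0 (2 * PI)
    = (RtoC (2 * PI) * g (z0 + w))%C).
  { intros w Hw.
    assert (Hwd : open_disc z0 R0 (z0 + w)%C).
    { unfold open_disc. replace (z0 + w - z0)%C with w by ring. unfold r in Hw; lra. }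
    assert (Hk : forall th, Ccont (cauchy_kernel r w) th)
      by (intros; apply Ccont_cauchy_kernel; assumption).
    apply Ccv_unique with
      (fun n => cint (fun th => f n (z0 + circ r th) * cauchy_kernel r w th)%C 0 (2 * PI)).
    - set (c := r / (r - Cmod w)). assert (Hw0 := Cmod_ge_0 w).
      assert (Hc : 0 <= c) by (apply Rle_mult_inv_pos; lra).
      apply Ccv_squeeze with (fun n => 2 * c * (2 * PI) * e n).
      + intros n.
        rewrite <- cint_minus.
        2: { intros; apply Ccont_mult; [|apply Hk]. apply (Cgc (f n)).
             intros; apply (holo_Ccont (open_disc z0 R0)); auto. }
        2: { intros; apply Ccont_mult; [|apply Hk]. apply (Cgc g). auto. }
        rewrite (cint_ext _
          (fun th => (f n (z0 + circ r th) - g (z0 + circ r th)) * cauchy_kernel r w th)%C)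
          by (intros; ring).
        apply Rle_trans with (2 * (e n * c) * (2 * PI - 0)); [|right; ring].
        apply cint_bound_const; [lra | |].
        * intros x. apply Ccont_mult; [|apply Hk]. apply Ccont_minus;
            [apply (Cgc (f n)) | apply (Cgc g)]; auto.
          intros; apply (holo_Ccont (open_disc z0 R0)); auto.
        * intros x _. rewrite Cmod_mult.
          apply Rmult_le_compat; try apply Cmod_ge_0; [auto | apply Cmod_cauchy_kernel; assumption].
      + apply is_lim_seq_scal_0, He.
    - apply Ccv_ext with (fun n => RtoC (2 * PI) * f n (z0 + w))%C.
      + intros n. symmetry. apply cauchy_formula with R0; auto. unfold r; lra.
      + apply Ccv_scal. apply Ccv_squeeze with e; [intros; auto | exact He]. }
  assert (H2pi : RtoC (2 * PI) <> 0%C) by (intros E; apply RtoC_inj in E; lra).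
  exists (fun n =>
    / RtoC (2 * PI) * cint (fun th => g (z0 + circ r th) * (/ circ r th) ^ n) 0 (2 * PI))%C, r.
  split; [exact Hr|]. intros x Hx. apply is_pseries_csum.
  assert (X := cauchy_kernel_expansion (fun th => g (z0 + circ r th)%C) r (x - z0) Hr Hx (Cgc g Cg)).
  rewrite Hform in X by exact Hx. replace (z0 + (x - z0))%C with x in X by ring.
  apply (Ccv_scal (/ RtoC (2 * PI))) in X.
  replace (/ RtoC (2 * PI) * (RtoC (2 * PI) * g x))%C with (g x) in X by (field; exact H2pi).
  refine (Ccv_ext _ _ _ _ X). intros n. rewrite <- csum_scal. apply csum_ext. intros; ring.
Qed.

(** * Theta constants on the fundamental domain *)

Lemma ZSeries_ext (f g : Z -> C) : (forall z, f z = g z) -> ZSeries f = ZSeries g.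
Proof.
  intros H. unfold ZSeries, CSeries.
  f_equal; f_equal; apply Series_ext; intros n; rewrite H; reflexivity.
Qed.

Lemma theta00_nome (tau : C) : theta 0 0 0 tau = theta_null (nome (- Ci * tau)).
Proof.
  apply ZSeries_ext. intros m. unfold nome. rewrite <- Cexp_zsq.
  replace (IZR m + INR 0 / 2) with (IZR m) by (simpl; field).
  replace (INR 0 / 2) with 0 by (simpl; field). f_equal. ring.
Qed.

Lemma theta01_nome (tau : C) : theta 0 1 0 tau = theta_null (- nome (- Ci * tau)).
Proof.
  apply ZSeries_ext. intros m. cbv zeta.
  replace (IZR m + INR 0 / 2) with (IZR m) by (simpl; field).
  replace (RtoC (INR 1 / 2)) with (/ 2)%C.
  2: { simpl INR. rewrite <- RtoC_inv by lra. f_equal. field. }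
  replace (Ci * RtoC PI * RtoC (IZR m) ^ 2 * tau + 2 * Ci * RtoC PI * RtoC (IZR m) * (0 + / 2))%C
    with (- (RtoC PI * (- Ci * tau)) * (RtoC (IZR m) * RtoC (IZR m)) + Ci * RtoC PI * RtoC (IZR m))%C
    by field.
  rewrite Cexp_plus, Cexp_zsq. fold (nome (- Ci * tau)). set (Q := nome (- Ci * tau)).
  destruct (Z.Even_or_Odd m) as [[u ->] | [u ->]].
  - rewrite Cpow_opp_zsq_even, mult_IZR.
    replace (Ci * RtoC PI * RtoC (2 * IZR u))%C with (2 * Ci * RtoC PI * RtoC (IZR u))%C
      by (rewrite RtoC_mult; ring).
    rewrite Cexp_2PI_Z. ring.
  - rewrite Cpow_opp_zsq_odd, plus_IZR, mult_IZR.
    replace (Ci * RtoC PI * RtoC (2 * IZR u + 1))%C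
      with (2 * Ci * RtoC PI * RtoC (IZR u) + Ci * RtoC PI)%C
      by (rewrite RtoC_plus, RtoC_mult; ring).
    rewrite Cexp_plus, Cexp_2PI_Z, Cexp_PI. ring.
Qed.

Lemma Theta_nome (tau : C) :
  Theta tau = (theta_null (- nome (- Ci * (tau / 2))) / theta_null (nome (- Ci * (tau / 2))))%C.
Proof. unfold Theta. rewrite theta00_nome, theta01_nome. reflexivity. Qed.

Lemma re_div (z w : C) : w <> 0%C -> Re (z / w)%C = Re (z * Cconj w)%C / Cmod w ^ 2.
Proof.
  intros Hw. assert (Hm := proj1 (Cmod_gt_0 w) Hw).
  assert (Hc : Cconj w <> 0%C).
  { intros E. rewrite <- Cmod_conj, E, Cmod_0 in Hm. lra. }
  replace (z / w)%C with (RtoC (/ Cmod w ^ 2) * (z * Cconj w))%C.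
  - rewrite re_scal_l. unfold Rdiv. ring.
  - rewrite RtoC_inv by (apply pow_nonzero; lra). rewrite Cmod2_conj. field. split; assumption.
Qed.

(** The numerator and denominator are 1 - 2q and 1 + 2q up to an error [E] of order |q|^4. The bound
    9266/10000 stays below 13/14 by more than the radius [rho] can add. *)
Lemma theta_quotient_bounds (q : C) :
  / 41 <= Cmod q <= 3 / 10 -> 7 / 10 * Cmod q <= Re q ->
  Cmod (theta_null (- q) / theta_null q) ^ 2 <= 9266 / 10000 /\
  / 5 <= Re (theta_null (- q) / theta_null q).
Proof.
  intros Hr Hp. set (r := Cmod q) in *.
  assert (H0 := theta_null_second_order q ltac:(fold r; lra)).
  assert (H1 := theta_null_second_order (- q) ltac:(rewrite Cmod_opp; fold r; lra)).
  rewrite Cmod_opp in H1. fold r in H0, H1.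
  set (E := 2 * r ^ 4 / (1 - r)) in *.
  (* For r <= 3/10 one has 2 r^3 / (1 - r) <= 0.054 / 0.7 < 0.0772. *)
  assert (HE : 0 <= E <= 772 / 10000 * r).
  { unfold E. split.
    - apply Rle_mult_inv_pos; [|lra]. assert (0 <= r ^ 4) by (apply pow_le; lra). lra.
    - apply Rmult_le_reg_r with (1 - r); [lra|].
      unfold Rdiv. rewrite Rmult_assoc, Rinv_l by lra.
      assert (r ^ 2 <= 9 / 100) by nra.
      assert (r ^ 4 <= 27 / 1000 * r) by (replace (r ^ 4) with (r ^ 2 * r * r) by ring; nra). nra. }
  set (t0 := theta_null q) in *. set (t1 := theta_null (- q)) in *.
  set (e0 := (t0 - (1 + 2 * q))%C) in *. set (e1 := (t1 - (1 + 2 * - q))%C) in *.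
  assert (Hq2 : Cmod (2 * q) = 2 * r) by (rewrite Cmod_mult, Cmod_R, Rabs_pos_eq by lra; reflexivity).
  assert (A0 : Cmod (1 + 2 * q) ^ 2 = 1 + 4 * Re q + 4 * r ^ 2).
  { unfold r. rewrite !Cmod2_alt, re_plus, im_plus, re_scal_l, im_scal_l. simpl (Re (RtoC 1)).
    simpl (Im (RtoC 1)). ring. }
  assert (A1 : Cmod (1 + 2 * - q) ^ 2 = 1 - 4 * Re q + 4 * r ^ 2).
  { unfold r. rewrite !Cmod2_alt, re_plus, im_plus, re_scal_l, im_scal_l, re_opp, im_opp.
    simpl (Re (RtoC 1)). simpl (Im (RtoC 1)). ring. }
  assert (B0 : 1 - 2 * r <= Cmod (1 + 2 * q) <= 1 + 2 * r).
  { assert (T := Cmod_triangle_lower 1 (2 * q)). assert (T' := Cmod_triangle 1 (2 * q)).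
    rewrite Cmod_1, Hq2 in T, T'. lra. }
  assert (B1 : Cmod (1 + 2 * - q) <= 1 + 2 * r).
  { replace (1 + 2 * - q)%C with (1 - 2 * q)%C by ring.
    assert (T' := Cmod_triangle_minus 1 (2 * q)). rewrite Cmod_1, Hq2 in T'. lra. }
  assert (T0 : Cmod (1 + 2 * q) - E <= Cmod t0 <= Cmod (1 + 2 * q) + E).
  { replace t0 with (1 + 2 * q + e0)%C by (unfold e0; ring).
    assert (T := Cmod_triangle_lower (1 + 2 * q) e0). assert (T' := Cmod_triangle (1 + 2 * q) e0). lra. }
  assert (T1 : Cmod t1 <= Cmod (1 + 2 * - q) + E).
  { replace t1 with (1 + 2 * - q + e1)%C by (unfold e1; ring).
    assert (T' := Cmod_triangle (1 + 2 * - q) e1). lra. }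
  assert (Hpos : 0 < Cmod t0) by lra.
  assert (Ht0 : t0 <> 0%C) by (apply Cmod_gt_0; exact Hpos).
  assert (Hup : Cmod t0 <= 1024 / 1000 + 2 * r) by lra.
  assert (Hlow : (Cmod (1 + 2 * q) - E) ^ 2 <= Cmod t0 ^ 2) by (apply pow_incr; lra).
  assert (Hup1 : Cmod t1 ^ 2 <= (Cmod (1 + 2 * - q) + E) ^ 2)
    by (apply pow_incr; split; [apply Cmod_ge_0 | lra]).
  assert (Hup2 : Cmod t0 ^ 2 <= (1024 / 1000 + 2 * r) ^ 2) by (apply pow_incr; lra).
  split.
  - rewrite Cmod_div by exact Ht0.
    replace ((Cmod t1 / Cmod t0) ^ 2) with (Cmod t1 ^ 2 / Cmod t0 ^ 2) by (field; lra).
    apply Rmult_le_reg_r with (Cmod t0 ^ 2); [nra|].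
    unfold Rdiv at 1. rewrite Rmult_assoc, Rinv_l by nra.
    (* |1 + 2q|^2 - |1 - 2q|^2 = 8 Re q >= 5.6 r, and the errors cost at most 4 (1 + 2r) E < 0.5 r,
       the squares of E cancelling. *)
    assert (Hdiff : Cmod t0 ^ 2 - Cmod t1 ^ 2 >= 51 / 10 * r).
    { assert (Cmod (1 + 2 * q) * E <= (1 + 2 * r) * (772 / 10000 * r)) by (apply Rmult_le_compat; lra).
      assert (Cmod (1 + 2 * - q) * E <= (1 + 2 * r) * (772 / 10000 * r))
        by (apply Rmult_le_compat; try lra; apply Cmod_ge_0).
      assert (Hrr : r * r <= 3 / 10 * r) by (apply Rmult_le_compat_r; lra).
      assert (0 <= E * E) by (apply Rmult_le_pos; lra).
      assert (E1 : (Cmod (1 + 2 * q) - E) ^ 2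
        = Cmod (1 + 2 * q) ^ 2 - 2 * (Cmod (1 + 2 * q) * E) + E * E) by ring.
      assert (E2 : (Cmod (1 + 2 * - q) + E) ^ 2
        = Cmod (1 + 2 * - q) ^ 2 + 2 * (Cmod (1 + 2 * - q) * E) + E * E) by ring.
      lra. }
    assert (Hrr : r * r <= 3 / 10 * r) by (apply Rmult_le_compat_r; lra).
    assert (E3 : (1024 / 1000 + 2 * r) ^ 2 = (1024 / 1000) ^ 2 + 4096 / 1000 * r + 4 * (r * r)) by field.
    lra.
  - rewrite re_div by exact Ht0.
    apply Rmult_le_reg_r with (Cmod t0 ^ 2); [nra|].
    unfold Rdiv. rewrite (Rmult_assoc (Re _)), Rinv_l by nra.
    (* Polarisation: t0 + t1 is close to 2 and t0 - t1 close to 4q, so this estimate depends on q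
       through its modulus alone. *)
    replace (Re (t1 * Cconj t0)) with ((Cmod (t0 + t1) ^ 2 - Cmod (t0 - t1) ^ 2) / 4).
    2: { rewrite !Cmod2_alt, re_plus, im_plus, re_minus, im_minus, re_mult, re_conj, im_conj. field. }
    assert (S1 : 2 - 2 * E <= Cmod (t0 + t1)).
    { replace (t0 + t1)%C with (2 + (e0 + e1))%C by (unfold e0, e1; ring).
      assert (T := Cmod_triangle_lower 2 (e0 + e1)). assert (T' := Cmod_triangle e0 e1).
      rewrite Cmod_R, Rabs_pos_eq in T by lra. lra. }
    assert (S2 : Cmod (t0 - t1) <= 4 * r + 2 * E).
    { replace (t0 - t1)%C with (2 * (2 * q) + (e0 - e1))%C by (unfold e0, e1; ring).
      assert (T := Cmod_triangle (2 * (2 * q)) (e0 - e1)). assert (T' := Cmod_triangle_minus e0 e1).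
      rewrite Cmod_mult, Hq2, Cmod_R, Rabs_pos_eq in T by lra. lra. }
    assert ((2 - 2 * E) ^ 2 <= Cmod (t0 + t1) ^ 2) by (apply pow_incr; lra).
    assert (Cmod (t0 - t1) ^ 2 <= (4 * r + 2 * E) ^ 2)
      by (apply pow_incr; split; [apply Cmod_ge_0 | lra]).
    assert ((2 - 2 * (24 / 1000)) ^ 2 <= (2 - 2 * E) ^ 2) by (apply pow_incr; lra).
    assert ((4 * r + 2 * E) ^ 2 <= (4 * (3 / 10) + 2 * (24 / 1000)) ^ 2) by (apply pow_incr; lra).
    assert ((1024 / 1000 + 2 * r) ^ 2 <= (1024 / 1000 + 2 * (3 / 10)) ^ 2) by (apply pow_incr; lra).
    lra.
Qed.

Lemma atan_le_id (x : R) : 0 <= x -> atan x <= x.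
Proof.
  intros Hx.
  destruct (MVT_gen atan 0 x (fun y => / (1 + y ^ 2))) as [c [_ E]].
  - intros y _. apply is_derive_Reals, derivable_pt_lim_atan.
  - intros y _. apply continuity_pt_filterlim.
    apply (ex_derive_continuous (K := R_AbsRing) (V := R_NormedModule)).
    eexists. apply is_derive_Reals, derivable_pt_lim_atan.
  - rewrite atan_0 in E. assert (H := inv_1_sqr_le_1 c).
    replace (c * c) with (c ^ 2) in H by ring. nra.
Qed.

(** From pi/4 = atan(1/2) + atan(1/3) and atan x <= x. An upper bound for pi is what bounds |q| from
    below when Im tau is near 2. *)
Lemma PI_le_10_3 : PI <= 10 / 3.
Proof.
  assert (H := Machin_2_3). assert (H2 := atan_le_id (/ 2) ltac:(lra)).
  assert (H3 := atan_le_id (/ 3) ltac:(lra)). lra.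
Qed.

Lemma exp_10_3 : exp (10 / 3) <= 41.
Proof.
  replace (10 / 3) with (1 + 1 + 1 + / 3) by field. rewrite !exp_plus.
  assert (H := exp_le_3). assert (H0 := exp_pos 1).
  assert (H1 : exp (/ 3) <= 3 / 2).
  { replace (exp (/ 3)) with (/ exp (- / 3)) by (rewrite exp_Ropp, Rinv_inv; reflexivity).
    replace (3 / 2) with (/ (2 / 3)) by field. apply Rinv_le_contravar; [lra|].
    assert (X := exp_lower_linear (- / 3)). lra. }
  assert (exp 1 * exp 1 <= 9) by nra. assert (exp 1 * exp 1 * exp 1 <= 27) by nra.
  assert (0 < exp 1 * exp 1 * exp 1) by (apply Rmult_lt_0_compat; nra). assert (P := exp_pos (/ 3)). nra.
Qed.

Lemma calR1_im (tau : C) : calR1 tau -> 866 / 1000 <= Im tau <= 2 /\ Im tau ^ 2 >= 3 / 4 /\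
  Re tau ^ 2 <= / 4.
Proof.
  intros (H1 & H2 & H3 & H4).
  assert (H5 : 1 <= Cmod tau ^ 2) by nra. rewrite Cmod2_alt in H5.
  assert (H6 : Re tau ^ 2 <= / 4) by (rewrite <- pow2_abs; assert (P := Rabs_pos (Re tau)); nra).
  repeat split; nra.
Qed.

(** Here |q| = exp(-pi Im tau / 2) and arg q = pi Re tau / 2. The range of Im tau gives the bounds
    on |q|; |Re tau| <= 1/2 keeps the argument within pi/4, whose cosine exceeds 7/10. *)
Lemma Theta_bounds (tau : C) : calR1 tau ->
  Cmod (Theta tau) ^ 2 <= 9266 / 10000 /\ / 5 <= Re (Theta tau).
Proof.
  intros Ht. destruct (calR1_im tau Ht) as ([Hi1 Hi2] & _ & _).
  destruct Ht as (_ & Hre & _). apply Rabs_le_between in Hre.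
  assert (Hpi := PI2_3_2). assert (Hpi2 := PI_le_10_3).
  rewrite Theta_nome. set (q := nome (- Ci * (tau / 2))).
  assert (Ea : (- (RtoC PI * (- Ci * (tau / 2))) = RtoC (PI / 2) * (Ci * tau))%C).
  { rewrite RtoC_div by lra. field. }
  assert (Hci : Re (Ci * tau) = - Im tau /\ Im (Ci * tau) = Re tau)
    by (rewrite re_mult, im_mult; simpl; lra).
  destruct Hci as [Hci1 Hci2].
  assert (Er : Cmod q = exp (- (PI * Im tau / 2))).
  { unfold q, nome. rewrite Ea, Cmod_Cexp, re_scal_l, Hci1. f_equal. field. }
  assert (Eq : Re q = Cmod q * cos (PI / 2 * Re tau)).
  { rewrite Er. unfold q, nome. rewrite Ea, re_Cexp, re_scal_l, im_scal_l, Hci1, Hci2.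
    f_equal. f_equal. field. }
  apply theta_quotient_bounds; fold q.
  - rewrite Er. split.
    + apply Rle_trans with (exp (- (10 / 3))); [|apply exp_le_compat; nra].
      rewrite exp_Ropp. apply Rinv_le_contravar; [apply exp_pos | apply exp_10_3].
    (* From pi > 3 and Im tau >= 0.866 the exponent is at least 1.299. *)
    + apply Rle_trans with (exp (- (129 / 100))); [apply exp_le_compat; nra|].
      replace (3 / 10) with (/ (10 / 3)) by field.
      apply exp_opp_upper; [lra|].
      apply (exp_sqr_lower _ 1.83); [lra | | lra].
      apply (exp_sqr_lower _ 1.355); [lra | | lra].
      apply (exp_sqr_lower _ 1.166); [lra | | lra].
      apply (exp_sqr_lower _ 1.08); [lra | | lra].
      eapply Rle_trans; [|apply exp_lower_linear]. lra.
  - rewrite Eq, Rmult_comm. apply Rmult_le_compat_l; [apply Cmod_ge_0|].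
    assert (Hc : forall y, 0 <= y <= PI / 4 -> 7 / 10 <= cos y).
    { intros y Hy. apply Rle_trans with (cos (PI / 4)).
      - rewrite cos_PI4. assert (Hs : sqrt 2 <= 10 / 7).
        { rewrite <- (sqrt_Rsqr (10 / 7)) by lra. apply sqrt_le_1_alt. unfold Rsqr; lra. }
        assert (0 < sqrt 2) by (apply sqrt_lt_R0; lra).
        apply Rmult_le_reg_r with (sqrt 2); [assumption|].
        replace (1 / sqrt 2 * sqrt 2) with 1 by (field; lra). lra.
      - apply cos_decr_1; lra. }
    destruct (Rle_dec 0 (Re tau)).
    + apply Hc. nra.
    + rewrite <- cos_neg. apply Hc. nra.
Qed.

(** * The inverse of Theta *)

(* A domain containing [calV] on which both quotients in [F] have positive real part. *)
Definition half_disc (x : C) : Prop := 0 < Re x /\ Cmod x ^ 2 <= 13 / 14.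

Definition quotS (x : C) : C := (2 * x / (1 + x ^ 2))%C.
Definition quotK (x : C) : C := ((1 - x ^ 2) / (1 + x ^ 2))%C.

Lemma calV_half_disc (x : C) : calV x -> half_disc x.
Proof.
  intros (tau & Ht & Hx). unfold rho in Hx.
  destruct (Theta_bounds tau Ht) as [H1 H2].
  set (t := Theta tau) in *. assert (H0 := Cmod_ge_0 t).
  assert (Hre := re_le_Cmod (x - t)). rewrite re_minus in Hre.
  assert (Ha : Rabs (Re x - Re t) < 14 / 100000) by lra. apply Rabs_def2 in Ha.
  assert (Hm := Cmod_triangle t (x - t)). replace (t + (x - t))%C with x in Hm by ring.
  assert (Hx0 := Cmod_ge_0 x). split; [lra|].
  assert (Cmod t <= 1) by nra.
  apply Rle_trans with ((Cmod t + 14 / 100000) ^ 2); [apply pow_incr; lra | nra].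
Qed.

Lemma calV_Theta (tau : C) : calR1 tau -> calV (Theta tau).
Proof.
  intros Ht. exists tau. split; [exact Ht|].
  replace (Theta tau - Theta tau)%C with (RtoC 0) by ring. rewrite Cmod_0. unfold rho. lra.
Qed.

Lemma calV_open (x : C) : calV x -> exists d : R, 0 < d /\ forall y : C, open_disc x d y -> calV y.
Proof.
  intros (tau & Ht & Hx). exists (rho - Cmod (x - Theta tau)). split; [lra|].
  intros y Hy. exists tau. split; [exact Ht|]. unfold open_disc in Hy.
  replace (y - Theta tau)%C with ((y - x) + (x - Theta tau))%C by ring.
  eapply Rle_lt_trans; [apply Cmod_triangle | lra].
Qed.

Lemma one_plus_sqr_bounds (x : C) : half_disc x ->
  1 - Cmod x ^ 2 <= Cmod (1 + x ^ 2) <= 1 + Cmod x ^ 2.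
Proof.
  intros [_ H]. rewrite <- Cmod_pow.
  assert (T := Cmod_triangle_lower 1 (x ^ 2)). assert (T' := Cmod_triangle 1 (x ^ 2)).
  rewrite Cmod_1 in T, T'. lra.
Qed.

Lemma one_plus_sqr_neq_0 (x : C) : half_disc x -> (1 + x ^ 2 <> 0)%C.
Proof.
  intros Hx. assert (H := one_plus_sqr_bounds x Hx). destruct Hx as [_ Hx].
  apply Cmod_gt_0. lra.
Qed.

Lemma re_quotS (x : C) : half_disc x -> 0 < Re (quotS x).
Proof.
  intros Hx. assert (Hn := one_plus_sqr_neq_0 x Hx). unfold quotS.
  rewrite re_div by exact Hn. apply Rdiv_lt_0_compat; [|apply pow_lt, Cmod_gt_0, Hn].
  replace (2 * x * Cconj (1 + x ^ 2))%C with (RtoC 2 * (x * Cconj (1 + x ^ 2)))%C by ring.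
  rewrite re_scal_l. destruct Hx as [Hx _]. apply Rmult_lt_0_compat; [lra|].
  replace (Re (x * Cconj (1 + x ^ 2))) with (Re x * (1 + (Re x ^ 2 + Im x ^ 2)))
    by (destruct x; simpl; ring).
  apply Rmult_lt_0_compat; [exact Hx | nra].
Qed.

Lemma re_quotK (x : C) : half_disc x ->
  Re (quotK x) = (1 - (Cmod x ^ 2) ^ 2) / Cmod (1 + x ^ 2) ^ 2.
Proof.
  intros Hx. assert (Hn := one_plus_sqr_neq_0 x Hx). unfold quotK.
  rewrite re_div by exact Hn. f_equal. rewrite Cmod2_alt. destruct x; simpl; ring.
Qed.

(* With [X = |x|^2] these all follow from [(1 + X)^2 <= 27 (1 - X^2)], i.e. [X <= 13/14]. *)
Lemma quot_bounds (x : C) : half_disc x ->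
  / 27 <= Re (quotK x) /\ Cmod (quotS x) <= 27 /\ Cmod (quotS x) <= 27 * Re (quotK x) /\
  Cmod (quotK x) <= 28.
Proof.
  intros Hx. assert (Hn := one_plus_sqr_neq_0 x Hx). assert (Hb := one_plus_sqr_bounds x Hx).
  rewrite re_quotK by exact Hx. destruct Hx as [_ Hx].
  unfold quotS, quotK. rewrite !Cmod_div, Cmod_mult, Cmod_R, Rabs_pos_eq by (exact Hn || lra).
  assert (Hk : Cmod (1 - x ^ 2) <= 1 + Cmod x ^ 2).
  { assert (T := Cmod_triangle_minus 1 (x ^ 2)). rewrite Cmod_1, Cmod_pow in T. exact T. }
  assert (H0 := Cmod_ge_0 x).
  set (D := Cmod (1 + x ^ 2)) in *. set (m := Cmod x) in *. set (X := m ^ 2) in *.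
  assert (HX : 0 <= X) by (apply pow2_ge_0).
  assert (Hm : 2 * m <= 1 + X) by (unfold X; assert (P := pow2_ge_0 (m - 1)); nra).
  assert (HD : 0 < D) by lra.
  assert (HD2 : 0 < D ^ 2) by (apply pow_lt; exact HD).
  assert (HDD : D ^ 2 <= (1 + X) ^ 2) by (apply pow_incr; lra).
  assert (HX2 : (1 + X) ^ 2 <= 27 * (1 - X ^ 2)) by nra.
  repeat split.
  - apply Rmult_le_reg_r with (D ^ 2); [exact HD2|].
    unfold Rdiv. rewrite (Rmult_assoc (1 - X ^ 2)), Rinv_l by lra. lra.
  - apply Rmult_le_reg_r with D; [exact HD|].
    unfold Rdiv. rewrite Rmult_assoc, Rinv_l by lra. lra.
  - apply Rmult_le_reg_r with (D ^ 2); [exact HD2|].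
    replace (2 * m / D * D ^ 2) with (2 * m * D) by (field; lra).
    replace (27 * ((1 - X ^ 2) / D ^ 2) * D ^ 2) with (27 * (1 - X ^ 2)) by (field; lra).
    apply Rle_trans with ((1 + X) * (1 + X)); [apply Rmult_le_compat; lra | nra].
  - apply Rmult_le_reg_r with D; [exact HD|].
    unfold Rdiv. rewrite Rmult_assoc, Rinv_l by lra. lra.
Qed.

Lemma re_quotK_pos (x : C) : half_disc x -> 0 < Re (quotK x).
Proof. intros Hx. assert (H := quot_bounds x Hx). lra. Qed.

Lemma F_agm (x : C) : half_disc x -> F x = (Ci * (agm_lim (quotS x) / agm_lim (quotK x)))%C.
Proof.
  intros Hx. unfold F. fold (quotS x) (quotK x).
  rewrite !good_mean_agm by (apply re_quotS || apply re_quotK_pos; exact Hx). reflexivity.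
Qed.

Lemma Cmod_agm_lim_lower (s : C) (m : R) : 0 < m <= 1 -> m <= Re s -> m <= Cmod (agm_lim s).
Proof.
  intros Hm Hs. eapply Rle_trans; [apply agm_lim_re; eassumption|].
  eapply Rle_trans; [apply Rle_abs | apply re_le_Cmod].
Qed.

(** The numerator is at most max(1, |S|) and the denominator at least min(1, Re K), with S and K the
    two quotients. The four possible ratios 1, |S|, 1/Re K and |S|/Re K are each at most 27 by
    [quot_bounds]. *)
Lemma F_bound (x : C) : half_disc x -> Cmod (F x) <= 27.
Proof.
  intros Hx. rewrite F_agm by exact Hx.
  destruct (quot_bounds x Hx) as (H1 & H2 & H3 & _).
  assert (Hk := re_quotK_pos x Hx). assert (Hs := re_quotS x Hx).
  rewrite Cmod_mult, Cmod_Ci, Rmult_1_l, Cmod_div by (apply agm_lim_neq_0, Hk).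
  set (m := Rmin 1 (Re (quotK x))).
  assert (Hm : / 27 <= m) by (apply Rmin_glb; lra).
  assert (Hlow : m <= Cmod (agm_lim (quotK x))).
  { apply Cmod_agm_lim_lower; [split; [lra | apply Rmin_l] | apply Rmin_r]. }
  assert (Hup : Cmod (agm_lim (quotS x)) <= 27 * m).
  { apply Rle_trans with (Rmax 1 (Cmod (quotS x))).
    - apply agm_lim_bound; [exact Hs | apply Rmax_l | apply Rmax_r].
    - apply Rmax_lub; [lra|]. unfold m, Rmin. destruct (Rle_dec 1 (Re (quotK x))); lra. }
  apply Rmult_le_reg_r with (Cmod (agm_lim (quotK x))); [lra|].
  unfold Rdiv. rewrite Rmult_assoc, Rinv_l by lra. lra.
Qed.

Lemma holo_agm (U : C -> Prop) (s : C -> C) (n : nat) :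
  (forall z, U z -> 0 < Re (s z)) -> holo U s ->
  holo U (fun z => fst (agm (s z) n)) /\ holo U (fun z => snd (agm (s z) n)).
Proof.
  intros Hp Hs. induction n as [|n [IH1 IH2]].
  - split; [exact (holo_const U 1) | exact Hs].
  - assert (Hre : forall z, U z -> 0 < Re (fst (agm (s z) n)) /\ 0 < Re (snd (agm (s z) n))).
    { intros z Hz. specialize (Hp z Hz).
      assert (Hm : 0 < Rmin 1 (Re (s z)) <= 1) by (split; [apply Rmin_glb_lt; lra | apply Rmin_l]).
      assert (H := agm_re (s z) _ n Hm (Rmin_r _ _)). lra. }
    split.
    + exact (holo_mult U _ _ (holo_plus U _ _ IH1 IH2) (holo_const U (/ 2)%C)).
    + apply (holo_mult U (fun z => csqrt (fst (agm (s z) n))) (fun z => csqrt (snd (agm (s z) n))));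
        apply holo_csqrt; auto; intros z Hz; apply Hre, Hz.
Qed.

Lemma holo_quotients (U : C -> Prop) : (forall z, U z -> half_disc z) ->
  holo U quotS /\ holo U quotK.
Proof.
  intros HU.
  assert (Hsq : holo U (fun z => z ^ 2)%C).
  { exact (holo_mult U _ _ (holo_id U) (holo_mult U _ _ (holo_id U) (holo_const U 1))). }
  assert (Hn : forall z, U z -> (1 + z ^ 2 <> 0)%C) by (intros; apply one_plus_sqr_neq_0; auto).
  assert (Hd := holo_plus U _ _ (holo_const U 1) Hsq).
  split.
  - exact (holo_div U _ _ Hn (holo_mult U _ _ (holo_const U 2) (holo_id U)) Hd).
  - exact (holo_div U _ _ Hn (holo_minus U _ _ (holo_const U 1) Hsq) Hd).
Qed.

(** * Uniform approximation and analyticity *)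

Definition F_iter (n : nat) (x : C) : C :=
  (Ci * (fst (agm (quotS x) n) / fst (agm (quotK x) n)))%C.

(** Each 27 bounds the inverse of a denominator; each 30 covers |1 - s|, |1 - k| or the modulus of a
    limit, all at most 29 by [quot_bounds]. *)
Lemma F_iter_uniform (x : C) (n : nat) : half_disc x ->
  Cmod (F_iter n x - F x) <= 27 * 27 * (30 * 30 + 30 * 30) * (/ 2) ^ n.
Proof.
  intros Hx. rewrite F_agm by exact Hx. unfold F_iter.
  destruct (quot_bounds x Hx) as (H1 & H2 & _ & H4).
  assert (Hk := re_quotK_pos x Hx). assert (Hs := re_quotS x Hx).
  set (s := quotS x) in *. set (k := quotK x) in *.
  set (p := (/ 2) ^ n). assert (Hp : 0 <= p) by (apply pow_le; lra).
  assert (Es := agm_lim_error s n Hs). assert (Ek := agm_lim_error k n Hk). fold p in Es, Ek.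
  assert (Ds : Cmod (1 - s) <= 30) by (assert (T := Cmod_triangle_minus 1 s); rewrite Cmod_1 in T; lra).
  assert (Dk : Cmod (1 - k) <= 30) by (assert (T := Cmod_triangle_minus 1 k); rewrite Cmod_1 in T; lra).
  assert (Bs : Cmod (agm_lim s) <= 30) by (apply agm_lim_bound; lra).
  assert (Bk : Cmod (agm_lim k) <= 30) by (apply agm_lim_bound; lra).
  assert (Lk : / 27 <= Cmod (agm_lim k)) by (apply Cmod_agm_lim_lower; lra).
  assert (Lb : / 27 <= Cmod (fst (agm k n))).
  { eapply Rle_trans; [exact (proj1 (agm_re k (/ 27) n ltac:(lra) H1))|].
    eapply Rle_trans; [apply Rle_abs | apply re_le_Cmod]. }
  set (a := fst (agm s n)) in *. set (b := fst (agm k n)) in *.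
  set (mu := agm_lim s) in *. set (nu := agm_lim k) in *.
  assert (Hb0 : b <> 0%C) by (apply Cmod_gt_0; lra).
  assert (Hn0 : nu <> 0%C) by (apply Cmod_gt_0; lra).
  replace (Ci * (a / b) - Ci * (mu / nu))%C with
    (Ci * (/ b * / nu * ((a - mu) * nu - mu * (b - nu))))%C by (field; split; assumption).
  rewrite !Cmod_mult, Cmod_Ci, !Cmod_inv by assumption.
  assert (Ib : 0 <= / Cmod b <= 27).
  { split; [left; apply Rinv_0_lt_compat; lra|].
    rewrite <- (Rinv_inv 27). apply Rinv_le_contravar; lra. }
  assert (In : 0 <= / Cmod nu <= 27).
  { split; [left; apply Rinv_0_lt_compat; lra|].
    rewrite <- (Rinv_inv 27). apply Rinv_le_contravar; lra. }
  assert (Hmain : Cmod ((a - mu) * nu - mu * (b - nu)) <= (30 * 30 + 30 * 30) * p).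
  { eapply Rle_trans; [apply Cmod_triangle_minus|]. rewrite !Cmod_mult.
    assert (Cmod (a - mu) <= 30 * p)
      by (eapply Rle_trans; [exact Es | apply Rmult_le_compat_r; assumption]).
    assert (Cmod (b - nu) <= 30 * p)
      by (eapply Rle_trans; [exact Ek | apply Rmult_le_compat_r; assumption]).
    assert (Cmod (a - mu) * Cmod nu <= 30 * p * 30) by (apply Rmult_le_compat; auto using Cmod_ge_0).
    assert (Cmod mu * Cmod (b - nu) <= 30 * (30 * p)) by (apply Rmult_le_compat; auto using Cmod_ge_0).
    lra. }
  rewrite Rmult_1_l, (Rmult_assoc (27 * 27)).
  apply Rmult_le_compat; [apply Rmult_le_pos; lra | apply Cmod_ge_0 | | exact Hmain].
  apply Rmult_le_compat; lra.
Qed.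

Lemma F_analytic : analytic_on calV F.
Proof.
  intros x0 Hx0. destruct (calV_open x0 Hx0) as (d & Hd & Hsub).
  assert (HU : forall z, open_disc x0 d z -> half_disc z) by (intros; apply calV_half_disc; auto).
  apply (uniform_limit_power_series F_iter F
    (fun n => 27 * 27 * (30 * 30 + 30 * 30) * (/ 2) ^ n) x0 d Hd).
  - intros n. destruct (holo_quotients _ HU) as [HS HK].
    apply (holo_mult _ (fun _ => Ci)); [apply holo_const|].
    apply holo_div.
    + intros z Hz. assert (Hk := quot_bounds z (HU z Hz)).
      destruct (agm_re (quotK z) (/ 27) n) as [H _]; [lra | lra|].
      intros E. rewrite E in H. simpl in H. lra.
    + apply holo_agm; [intros; apply re_quotS; auto | exact HS].
    + apply holo_agm; [intros; apply re_quotK_pos; auto | exact HK].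
  - apply is_lim_seq_half.
  - intros n z Hz. apply F_iter_uniform. auto.
Qed.

Lemma nome_double (a : C) : nome (2 * a) = (nome a ^ 2)%C.
Proof.
  unfold nome. simpl Cpow. rewrite Cmult_1_r, <- Cexp_plus. f_equal. ring.
Qed.

(* By duplication the two quotients at [x = Theta tau] are [theta01^2 / theta00^2] at [tau] and,
   after the modular transformation, at [-1/tau]. *)
Lemma F_Theta (tau : C) : calR1 tau -> F (Theta tau) = tau.
Proof.
  intros Ht. assert (Hx := calV_half_disc _ (calV_Theta tau Ht)).
  destruct (calR1_im tau Ht) as ([Hi1 Hi2] & Hi & Hr).
  rewrite F_agm by exact Hx.
  assert (Ps := re_quotS _ Hx). assert (Pk := re_quotK_pos _ Hx).
  assert (Hn := one_plus_sqr_neq_0 _ Hx).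
  (* [e] belongs to tau/2, where Theta takes its theta constants, and [a] to tau, where the first
     Borchardt mean starts. *)
  set (e := (- Ci * (tau / 2))%C). set (a := (- Ci * tau)%C).
  assert (Eae : a = (2 * e)%C) by (unfold a, e; field).
  assert (Hae : Re e = Im tau / 2).
  { assert (H : Re a = Im tau) by (unfold a; rewrite re_mult; simpl; ring).
    rewrite Eae, re_scal_l in H. lra. }
  assert (Ha : Re a = Im tau) by (rewrite Eae, re_scal_l, Hae; field).
  assert (Hm : Cmod a ^ 2 = Re tau ^ 2 + Im tau ^ 2).
  { unfold a. rewrite Cmod_mult, Cmod_opp, Cmod_Ci, Rmult_1_l. apply Cmod2_alt. }
  assert (Ha0 : a <> 0%C) by (intros E; rewrite E in Ha; simpl in Ha; lra).
  assert (He0 : e <> 0%C) by (intros E; apply Ha0; rewrite Eae, E; ring).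
  assert (Hb : 8 / 17 <= Re (/ a)%C).
  { replace (/ a)%C with (1 / a)%C by (field; exact Ha0).
    rewrite re_div by exact Ha0. rewrite Hm.
    replace (Re (1 * Cconj a)) with (Im tau) by (rewrite Cmult_1_l, re_conj; symmetry; exact Ha).
    apply Rmult_le_reg_r with (Re tau ^ 2 + Im tau ^ 2); [nra|].
    unfold Rdiv at 2. rewrite (Rmult_assoc (Im tau)), Rinv_l by nra. nra. }
  set (q := nome e). set (Qb := nome (/ a)).
  assert (Hqa : nome a = (q ^ 2)%C) by (rewrite Eae; apply nome_double).
  assert (Hq2 : Cmod (q ^ 2) <= / 4) by (rewrite <- Hqa; apply Cmod_nome_quarter; lra).
  assert (HQb : Cmod Qb <= / 4) by (apply Cmod_nome_quarter; exact Hb).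
  assert (Hq1 : Cmod q < 1) by (apply Cmod_nome_lt_1; lra).
  assert (N1 := theta_null_neq_0 _ Hq2). assert (N2 := theta_null_neq_0 _ HQb).
  assert (D1 := theta_null_duplication q Hq1). assert (D2 := theta_null_duplication_product q Hq1).
  assert (M1 := theta_null_modular a ltac:(lra)). rewrite Hqa in M1. fold Qb in M1.
  assert (M2 := theta_null_modular e ltac:(lra)). fold q in M2.
  assert (D3 := theta_null_duplication Qb ltac:(lra)).
  (* Twice -1/tau is -1/(tau/2), so duplication at [Qb] links the transformation laws at tau and at
     tau/2. *)
  replace (Qb ^ 2)%C with (nome (/ e)) in D3.
  2: { unfold Qb. rewrite <- nome_double. f_equal. rewrite Eae. field. exact He0. }
  rewrite <- M2, <- M1 in D3.
  assert (Ex : Theta tau = (theta_null (- q) / theta_null q)%C) by apply Theta_nome.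
  set (A0 := theta_null q) in *. set (B0 := theta_null (- q)) in *.
  set (A1 := theta_null (q ^ 2)) in *. set (B1 := theta_null (- q ^ 2)) in *.
  set (Ab := theta_null Qb) in *. set (Bb := theta_null (- Qb)) in *.
  (* |q| can exceed 1/4 here, out of reach of [theta_null_neq_0]. A zero denominator would instead
     give Theta tau = 0, as [Cinv] sends 0 to 0, against Re (Theta tau) > 0. *)
  assert (N0 : A0 <> 0%C).
  { intros E. apply (f_equal Re) in Ex. rewrite E in Ex.
    destruct Hx as [Hx _]. rewrite Ex in Hx. unfold Cdiv in Hx.
    replace (/ 0)%C with (RtoC 0) in Hx by (apply C_eq; simpl; unfold Rdiv; ring).
    rewrite Cmult_0_r in Hx. simpl in Hx. lra. }
  assert (N12 : (A0 ^ 2 + B0 ^ 2 <> 0)%C).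
  { intros E. apply (Cpow_nz A1 2 N1). rewrite <- D1, E. field. }
  assert (Es : quotS (Theta tau) = (B1 ^ 2 / A1 ^ 2)%C).
  { unfold quotS. rewrite Ex, <- D1, <- D2. field. repeat split; assumption. }
  (* The transformation of theta_01 into theta_10, deduced from that of theta_00 at two arguments:
     duplication at [Qb] expresses theta_01^2 at -1/tau by theta_00^2 at -1/tau and -2/tau. *)
  assert (EB : (Bb ^ 2 = a * (A0 ^ 2 - B0 ^ 2) / 2)%C).
  { replace (Bb ^ 2)%C with (2 * ((a * A1 ^ 2 + Bb ^ 2) / 2) - a * A1 ^ 2)%C by field.
    rewrite D3, <- D1, Eae. field. }
  assert (Ek : quotK (Theta tau) = (Bb ^ 2 / Ab ^ 2)%C).
  { unfold quotK. rewrite Ex, EB, <- M1, <- D1. field.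
    repeat split; assumption. }
  rewrite Es in Ps |- *. rewrite Ek in Pk |- *.
  unfold B1, A1 in Ps |- *. unfold Bb, Ab in Pk |- *.
  rewrite agm_lim_theta, agm_lim_theta by assumption.
  fold A1 Ab. rewrite <- M1.
  replace (Ci * (/ A1 ^ 2 / / (a * A1 ^ 2)))%C with (Ci * a)%C by (field; split; assumption).
  unfold a. replace (Ci * (- Ci * tau))%C with (- (Ci * Ci) * tau)%C by ring.
  replace (Ci * Ci)%C with (- (1))%C by (apply C_eq; simpl; ring). ring.
Qed.

Theorem theorem4p4 :
  (forall x : C, calV x ->
     (1 + x ^ 2 <> 0)%C /\
     good_mean_defined 1 (2 * x / (1 + x ^ 2))%C /\
     good_mean_defined 1 ((1 - x ^ 2) / (1 + x ^ 2))%C) /\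
  analytic_on calV F /\
  (forall tau : C, calR1 tau -> F (Theta tau) = tau) /\
  (forall x : C, calV x -> (Cmod (F x) <= 27)%R).
Proof.
  split; [|split; [exact F_analytic | split; [exact F_Theta|]]].
  - intros x Hx. apply calV_half_disc in Hx.
    split; [apply one_plus_sqr_neq_0, Hx|]. split.
    + exists (agm_lim (quotS x)). apply agm_is_good_mean, re_quotS, Hx.
    + exists (agm_lim (quotK x)). apply agm_is_good_mean, re_quotK_pos, Hx.
  - intros x Hx. apply F_bound, calV_half_disc, Hx.
Qed.
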